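(* Let $\alpha\in(0,2)$, $n\ge 2$, and let $X=(X_1,\ldots,X_n)$ be a symmetric $\alpha$-stable random vector with marginals $S_\alpha(1,0,0)$ whose spectral measure $\Lambda$ has some support properly inside each orthant (i.e. the support of $\Lambda$ meets the interior of each of the $2^n$ orthants of $\mathbb{R}^n$). Assume furthermore that $$2\int_{\mathbb{S}^{n-1}}(\mathbf{x}^{(2)}\vee 0)^\alpha\,d\Lambda(\mathbf{x})<1,$$ where $\mathbf{x}^{(2)}$ denotes the second largest coordinate (counted with multiplicity) of the vector $\mathbf{x}$. Then $X^h$ is a color process for all sufficiently large $h$.
   Context: $S_\alpha(1,0,0)$ denotes the symmetric $\alpha$-stable distribution on $\mathbb{R}$ with characteristic function $\theta\mapsto e^{-|\theta|^\alpha}$. A random vector $X$ in $\mathbb{R}^n$ is symmetric $\alpha$-stable with spectral measure $\Lambda$ if its characteristic function is $\theta\mapsto\exp\bigl(-\int_{\mathbb{S}^{n-1}}|\theta\cdot\mathbf{x}|^\alpha\,d\Lambda(\mathbf{x})\bigr)$, where $\Lambda$ is a finite measure on the Euclidean unit sphere $\mathbb{S}^{n-1}$ which is invariant under $\mathbf{x}\mapsto-\mathbf{x}$. A $\{0,1\}$-valued process $(Y_i)_{i\in S}$ is a color process (divide and color process) if there are $p\in[0,1]$ and a random partition $\pi$ of $S$ such that $(Y_i)$ has the same law as the process obtained by sampling $\pi$ and then, independently of $\pi$ and independently for different partition elements, assigning all elements of a partition element the value $1$ with probability $p$ and the value $0$ with probability $1-p$. For a random vector $X=(X_i)$ and $h\in\mathbb{R}$,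 $X^h=(X^h_i)$ with $X^h_i=I(X_i>h)$. *)

(* Defs.v *)
From HB Require Import structures.
From mathcomp Require Import all_boot all_order all_algebra.
From mathcomp Require Import complex.
From mathcomp Require Import all_classical all_reals all_analysis.

Set Implicit Arguments.
Unset Strict Implicit.
Unset Printing Implicit Defensive.

Import Order.TTheory GRing.Theory Num.Theory.
Import numFieldNormedType.Exports.

Local Open Scope classical_set_scope.
Local Open Scope ring_scope.

(** A copy of ['rV[R]_n] carrying the Borel sigma-algebra of its topology;
    it is convertible to ['rV[R]_n]. *)
Definition borel_rV (R : realType) (n : nat) :=
  g_sigma_algebraType (@open 'rV[R]_n).

Definition dot (R : realType) (n : nat) (x y : 'rV[R]_n) : R :=
  \sum_(i < n) x ord0 i * y ord0 i.

Definition usphere (R : realType) (n : nat) : set 'rV[R]_n :=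
  [set x | \sum_(i < n) x ord0 i ^+ 2 = 1].
Arguments usphere {R n}.

(** [s i = true] means that the [i]-th coordinate is nonpositive. *)
Definition orthant (R : realType) (n : nat) (s : {ffun 'I_n -> bool}) :
    set 'rV[R]_n :=
  [set x | forall i, 0 <= (-1) ^+ s i * x ord0 i].

(** Coordinates are sorted in nonincreasing order, so ties are counted with
    multiplicity; the default value [0] is never used when [2 <= n]. *)
Definition second_largest (R : realType) (n : nat) (x : 'rV[R]_n) : R :=
  nth 0 (sort >=%R [seq x ord0 i | i <- enum 'I_n]) 1.

Definition msupport (R : realType) (n : nat)
    (L : {measure set (borel_rV R n) -> \bar R}) : set 'rV[R]_n :=
  [set x | forall U : set 'rV[R]_n, open U -> U x -> (0 < L U)%E].

(** E[exp(i u)] = E[cos u] + i E[sin u] *)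
Definition expect_expi d (T : measurableType d) (R : realType)
    (P : probability T R) (u : T -> R) : R[i] :=
  Complex (fine 'E_P[fun w => cos (u w)]) (fine 'E_P[fun w => sin (u w)]).

Definition charfun d (T : measurableType d) (R : realType)
    (P : probability T R) (Y : T -> R) (t : R) : R[i] :=
  expect_expi P (fun w => t * Y w).

Definition charfun_vec d (T : measurableType d) (R : realType)
    (P : probability T R) (n : nat) (X : 'I_n -> T -> R) (theta : 'rV[R]_n) :
    R[i] :=
  expect_expi P (fun w => dot theta (\row_i X i w)).

(** [Y] has law S_alpha(1,0,0), which is the law with this characteristic
    function. *)
Definition std_sym_stable d (T : measurableType d) (R : realType)
    (P : probability T R) (alpha : R) (Y : T -> R) : Prop :=
  forall t : R, charfun P Y t = (expR (- (`|t| `^ alpha)))%:C%C.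

(** Measures on the sphere are encoded as Borel measures on the whole space
    that do not charge its complement. *)
Definition spectral_measure (R : realType) (n : nat)
    (L : {finite_measure set (borel_rV R n) -> \bar R}) : Prop :=
  L (~` usphere) = 0%E /\
  forall A : set (borel_rV R n), measurable A ->
    L ((fun x : 'rV[R]_n => - x) @^-1` A) = L A.

(** The real-valued integral loses nothing: the integrand is bounded on the
    sphere and the measure is finite. *)
Definition sym_stable d (T : measurableType d) (R : realType)
    (P : probability T R) (n : nat) (alpha : R) (X : 'I_n -> T -> R)
    (L : {finite_measure set (borel_rV R n) -> \bar R}) : Prop :=
  spectral_measure L /\
  forall theta : 'rV[R]_n,
    charfun_vec P X theta =
    (expR (- \int[L]_(x in usphere) (`|dot theta x| `^ alpha)))%:C%C.

(** A random partition of [S] is given by its probability mass function [q]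
    on families of subsets of [S]. *)
Definition random_partition (R : realType) (S : finType)
    (q : {set {set S}} -> R) : Prop :=
  [/\ forall pi, 0 <= q pi,
      \sum_pi q pi = 1
    & forall pi, q pi != 0 -> finset.partition pi finset.setT].

(** The probability that the process [i |-> c (pblock pi i)] equals [eta],
    where [pi] has distribution [q] and, independently of [pi], the colors
    [c B] are i.i.d. with P(c B = 1) = p. For convenience [c] colors every
    subset of [S]; only the colors of the blocks of [pi] are used. *)
Definition color_law (R : realType) (S : finType) (p : R)
    (q : {set {set S}} -> R) (eta : {ffun S -> bool}) : R :=
  \sum_(pi : {set {set S}}) \sum_(c : {ffun {set S} -> bool})
    q pi * (\prod_(B : {set S}) bernoulli_pmf p (c B)) *
    (eta == [ffun i => c (finset.pblock pi i)])%:R.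

Definition is_color_process d (T : measurableType d) (R : realType)
    (P : probability T R) (S : finType) (Y : S -> T -> bool) : Prop :=
  exists (p : R) (q : {set {set S}} -> R),
    [/\ 0 <= p <= 1, random_partition q &
      forall eta : {ffun S -> bool},
        P [set w | forall i, Y i w = eta i] = (color_law p q eta)%:E].

Definition threshold d (T : measurableType d) (R : realType) (n : nat)
    (X : 'I_n -> T -> R) (h : R) (i : 'I_n) (w : T) : bool :=
  h < X i w.

(* Main.v *)
Require Import Defs.
From HB Require Import structures.
From mathcomp Require Import all_boot all_order all_algebra.
From mathcomp Require Import complex.
From mathcomp Require Import all_classical all_reals all_analysis.
From mathcomp Require Import measurable_realfun ring lra.

(** Let [Z] be a marginal of [X] and let [p] be its tail at [h].  Restricting
    the random partition to one block [K] with [2 <= #|K|] (or none) and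
    singletons, the equations for a color law with the law of [X^h] become,
    after division by [p], a linear system equal to the identity up to
    [O(p)].  Its solution is a probability distribution as soon as
    [P(X^h = 1_S) / p] stays away from [0] whenever [2 <= #|S|] and
    [P(at least two coordinates exceed h) / p] stays below [1].

    Both ratios are computed without the Levy measure, by comparing [X] with
    [Z(w) x] under the product of [L(dx)] and [P(dw)]: both have the same limit of [h^alpha (1 - E cos (theta . Y / h))], hence
    of [h^alpha (E f(Y / h) - f 0)] for trigonometric polynomials [f].  The
    limits agree for every [f] that is uniformly approximated by
    trigonometric polynomials with respect to the weight
    [\sum_i min(1, y_i ^ 2)], a class that is an algebra and contains
    functions close to indicators of orthants.  For [Z x] the tails reduce to
    [h^alpha P(Z > h) -> c > 0]. *)

Set Implicit Arguments.
Unset Strict Implicit.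
Unset Printing Implicit Defensive.

Import Order.TTheory GRing.Theory Num.Theory.
Import numFieldNormedType.Exports.

Local Open Scope classical_set_scope.
Local Open Scope ring_scope.

(** * Color laws of partitions with one large block *)

(** Total mass and marginals are the same for every color law with parameter [p], so equations
    remain only for the sets [S] with [2 <= #|S|], as many as there are unknown weights. The second
    ratio is asymptotically at most twice the integral in the hypothesis: two coordinates of [Z x]
    exceed [h] either with [Z > 0], through the second largest coordinate of [x], or with [Z < 0],
    through that of [- x]; by symmetry of [L] both contribute equally. The obstacle in the
    comparison is that uniform limits of trigonometric polynomials are almost periodic and cannot
    follow an indicator far from the origin. The test functions are therefore correct only for
    [|y_i| <= M]; what lies beyond costs [O(M^-alpha)], uniformly in [h]. The weight is forced by
    the factor [h^alpha]: most of the mass of [Y / h] sits near the origin, so an approximation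
    error is harmless only if it vanishes there to second order. The condition [alpha < 2] enters
    through [c > 0]. *)

Section ColorLaws.
Variables (R : realType) (S : finType).
Implicit Types (p : R) (K A B : {set S}) (pi : {set {set S}}).

Definition coloring_weight p (c : {ffun {set S} -> bool}) : R :=
  \prod_B bernoulli_pmf p (c B).

Definition partition_law p pi (eta : {ffun S -> bool}) : R :=
  \sum_(c : {ffun {set S} -> bool})
    coloring_weight p c * (eta == [ffun i => c (finset.pblock pi i)])%:R.

(** The blocks are the fibers of a map that collapses [K] to [None] and separates all other points.
    When [K] is empty or a singleton this is the partition into singletons. *)
Definition merge_partition K : {set {set S}} :=
  preim_partition (fun i => if i \in K then None else Some i) finset.setT.

Definition indic K : {ffun S -> bool} := [ffun i => i \in K].

Lemma color_lawE p q eta :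
  color_law p q eta = \sum_pi q pi * partition_law p pi eta.
Proof.
rewrite /color_law; apply: eq_bigr => pi _; rewrite mulr_sumr.
by apply: eq_bigr => c _; rewrite mulrA.
Qed.

Lemma coloring_weight_ge0 p c : 0 <= p <= 1 -> 0 <= coloring_weight p c.
Proof. by move=> p01; apply: prodr_ge0 => B _; exact: bernoulli_pmf_ge0. Qed.

(** Colors are independent, so the sum factors over subsets: one in [D] must have color 1 and
    contributes [p], any other contributes its total mass 1. *)
Lemma sum_coloring_weight p (D : {set {set S}}) :
  \sum_c coloring_weight p c * \prod_(B in D) (c B)%:R = p ^+ #|D|.
Proof.
under eq_bigr => c _ do rewrite [X in _ * X]big_mkcond /= -big_split /=.
rewrite -(bigA_distr_bigA (fun B b =>
  bernoulli_pmf p b * (if B \in D then b%:R else 1))) /=.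
rewrite (eq_bigr (fun B => if B \in D then p else 1)); last first.
  move=> B _; rewrite big_bool /bernoulli_pmf /=.
  by case: ifP => _; rewrite ?mulr1 ?mulr0 ?addr0// subrKC.
by rewrite -big_mkcond prodr_const.
Qed.

Lemma coloring_weight_tot p : \sum_c coloring_weight p c = 1.
Proof.
rewrite -[RHS](expr0 p) -(@cards0 {set S}) -sum_coloring_weight.
by apply: eq_bigr => c _; rewrite big_set0 mulr1.
Qed.

Lemma coloring_weight1 p B : \sum_c coloring_weight p c * (c B)%:R = p.
Proof.
rewrite -[RHS]expr1 -(cards1 B) -sum_coloring_weight.
by apply: eq_bigr => c _; rewrite big_set1.
Qed.

Lemma coloring_weight2 p A B : A != B ->
  \sum_c coloring_weight p c * (c A && c B)%:R = p ^+ 2.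
Proof.
move=> AB; have := sum_coloring_weight p [set A; B]%SET; rewrite cards2 AB => <-.
by apply: eq_bigr => c _; rewrite big_setU1 ?inE//= big_set1 -mulnb natrM.
Qed.

Lemma partition_law_ge0 p pi eta : 0 <= p <= 1 -> 0 <= partition_law p pi eta.
Proof.
by move=> p01; apply: sumr_ge0 => c _; rewrite mulr_ge0 ?coloring_weight_ge0.
Qed.

Lemma partition_law_tot p pi : \sum_eta partition_law p pi eta = 1.
Proof.
rewrite exchange_big /= -[RHS](coloring_weight_tot p); apply: eq_bigr => c _.
rewrite -mulr_sumr (bigD1 [ffun i => c (finset.pblock pi i)])//= eqxx.
by rewrite big1 ?addr0 ?mulr1// => eta /negPf->.
Qed.

Lemma partition_law_marginal p pi i :
  \sum_(eta : {ffun S -> bool} | eta i) partition_law p pi eta = p.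
Proof.
rewrite exchange_big /= -[RHS](coloring_weight1 p (finset.pblock pi i)).
apply: eq_bigr => c _; rewrite -mulr_sumr; congr (_ * _).
case: (boolP (c (finset.pblock pi i))) => ci.
  rewrite (bigD1 [ffun i => c (finset.pblock pi i)])/= ?ffunE// eqxx.
  by rewrite big1 ?addr0// => eta /andP[_ /negPf->].
rewrite big1// => eta etai; case: eqP => // E.
by move: etai; rewrite E ffunE (negPf ci).
Qed.

Lemma merge_partitionP K : finset.partition (merge_partition K) finset.setT.
Proof. exact: preim_partitionP. Qed.

Lemma eq_pblock_merge K i j :
  (finset.pblock (merge_partition K) i == finset.pblock (merge_partition K) j) =
  (i == j) || (i \in K) && (j \in K).
Proof.
rewrite eq_pblock ?(partition_trivIset (merge_partitionP K))//; last first.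
  by rewrite (cover_partition (merge_partitionP K)) inE.
rewrite /merge_partition /preim_partition pblock_equivalence_partition ?inE//.
  case: (boolP (i \in K)) => iK; case: (boolP (j \in K)) => jK //=.
  - by rewrite orbT.
  - by rewrite orbF; apply/esym/negbTE; apply: contraNneq jK => <-.
  - by rewrite orbF; apply/esym/negbTE; apply: contraNneq iK => ->.
  - by rewrite orbF.
by split; [rewrite eqxx|move=> /eqP ->].
Qed.

(* A set [A] of ones that is not [K] and has two elements either meets two
   blocks or cuts the block [K]. *)
Lemma partition_law_merge_le p K A : 0 <= p <= 1 -> (1 < #|A|)%N -> A != K ->
  partition_law p (merge_partition K) (indic A) <= p ^+ 2.
Proof.
move=> p01 A2 AK.
have [AsK|/fintype.subsetPn [i iA iK]] := boolP (A \subset K).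
  have /properP [_ [j jK jA]] : A \proper K by rewrite finset.properEneq AK.
  have [i iA] : exists i, i \in A by apply/card_gt0P; rewrite (ltn_trans _ A2).
  rewrite /partition_law big1 ?sqr_ge0// => c _; case: eqP => [E|]; last by rewrite mulr0.
  have /eqP Eb : finset.pblock (merge_partition K) i ==
                 finset.pblock (merge_partition K) j.
    by rewrite eq_pblock_merge jK (fintype.subsetP AsK) ?orbT.
  move/ffunP: E => E; have := E i; have := E j.
  by rewrite !ffunE Eb iA (negPf jA) => <-.
have [j jA ji] : exists2 j, j \in A & j != i.
  have : (0 < #|A :\ i|)%N by move: A2; rewrite (cardsD1 i) iA.
  by case/card_gt0P => j; rewrite !inE => /andP[]; exists j.
have /coloring_weight2 <- : finset.pblock (merge_partition K) i !=
                 finset.pblock (merge_partition K) j.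
  by rewrite eq_pblock_merge (negPf iK) eq_sym (negPf ji).
apply: ler_sum => c _; rewrite ler_wpM2l ?coloring_weight_ge0// ler_nat.
case: eqP => // /ffunP E; have := E i; have := E j.
by rewrite !ffunE iA jA => <- <-.
Qed.

Lemma partition_law_block_le p K : 0 <= p <= 1 -> (0 < #|K|)%N ->
  partition_law p (merge_partition K) (indic K) <= p.
Proof.
move=> p01 /card_gt0P [i iK].
rewrite -[leRHS](coloring_weight1 p (finset.pblock (merge_partition K) i)).
apply: ler_sum => c _; rewrite ler_wpM2l ?coloring_weight_ge0// ler_nat.
by case: eqP => // /ffunP /(_ i); rewrite !ffunE iK => <-.
Qed.

(** The ones form exactly [K] if its block has color 1 and no outside point has. A union bound over
    the at most [#|S|] outside points costs [p ^+ 2] each, as their blocks differ from that of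
    [i]. *)
Lemma partition_law_block_ge p K : 0 <= p <= 1 -> (0 < #|K|)%N ->
  p - #|S|%:R * p ^+ 2 <= partition_law p (merge_partition K) (indic K).
Proof.
move=> p01 /card_gt0P [i iK]; set b := finset.pblock (merge_partition K).
rewrite lerBlDr -[leLHS](coloring_weight1 p (b i)).
have le2 : \sum_(j | j \notin K) \sum_c coloring_weight p c * (c (b i) && c (b j))%:R
    <= #|S|%:R * p ^+ 2.
  rewrite (eq_bigr (fun=> p ^+ 2)); last first.
    move=> j jK; rewrite coloring_weight2// eq_pblock_merge (negPf jK) andbF orbF.
    by apply: contraNneq jK => <-.
  by rewrite sumr_const -[leLHS]mulr_natl ler_wpM2r ?sqr_ge0// ler_nat max_card.
apply: le_trans (lerD (lexx _) le2); rewrite exchange_big /= -big_split /=.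
apply: ler_sum => c _; rewrite -mulr_sumr -mulrDr.
rewrite ler_wpM2l ?coloring_weight_ge0//.
case ci: (c (b i)) => /=; last by rewrite addr_ge0// sumr_ge0.
(* If an outside point has color 1, its term in the union bound pays; otherwise the coloring is
   exactly [indic K]. *)
case: (boolP [exists j, (j \notin K) && c (b j)]) => [/existsP[j /andP[jK cj]]|].
  by rewrite (bigD1 j)//= cj [leRHS]addrCA (lerDl (true%:R : R)) addr_ge0// sumr_ge0.
rewrite negb_exists => /forallP H.
rewrite (_ : indic K == _) ?lexx ?lerDl ?sumr_ge0//.
apply/eqP/ffunP => j; rewrite !ffunE; case: (boolP (j \in K)) => jK.
  have /eqP -> : finset.pblock (merge_partition K) j == b i.
    by rewrite eq_pblock_merge jK iK orbT.
  by rewrite ci.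
by have := H j; rewrite jK /= => /negbTE <-.
Qed.

End ColorLaws.

(** In the l1 norm [x *m A - x] is at most half of [x], so multiplication by [A] is injective and
    its inverse at most doubles norms. Reinserting this into the entrywise bound gives the error
    [2 * N%:R * e]. *)
Lemma perturbed_identity_solve (R : realFieldType) (N : nat) (A : 'M[R]_N)
    (b : 'rV[R]_N) (e : R) :
    (forall i j, `|A i j - (i == j)%:R| <= e) -> N%:R * e <= 2^-1 ->
    (forall j, `|b ord0 j| <= 1) ->
  exists x : 'rV[R]_N,
    x *m A = b /\ forall j, `|x ord0 j - b ord0 j| <= 2 * N%:R * e.
Proof.
move=> Ae Ne b1.
have mulE (x : 'rV[R]_N) j : (x *m A) ord0 j - x ord0 j =
    \sum_i x ord0 i * (A i j - (i == j)%:R).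
  rewrite mxE; under [RHS]eq_bigr do rewrite mulrBr.
  rewrite sumrB; congr (_ - _); rewrite (bigD1 j)//= eqxx mulr1 big1 ?addr0//.
  by move=> i /negPf ->; rewrite mulr0.
have dist (x : 'rV[R]_N) j :
    `|(x *m A) ord0 j - x ord0 j| <= (\sum_i `|x ord0 i|) * e.
  rewrite mulE mulr_suml (le_trans (ler_norm_sum _ _ _))//.
  by apply: ler_sum => i _; rewrite normrM ler_wpM2l.
have l1 (x : 'rV[R]_N) :
    \sum_i `|x ord0 i| <= 2 * \sum_i `|(x *m A) ord0 i|.
  set s := \sum_i `|x ord0 i|.
  have s0 : 0 <= s by exact: sumr_ge0.
  suff : s <= \sum_i `|(x *m A) ord0 i| + N%:R * (s * e).
    have := ler_wpM2l s0 Ne; lra.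
  have -> : N%:R * (s * e) = \sum_(i < N) s * e.
    by rewrite sumr_const card_ord mulr_natl.
  rewrite -big_split; apply: ler_sum => i _ /=.
  have := dist x i; rewrite distrC -/s => d.
  by have := ler_normD (x ord0 i - (x *m A) ord0 i) ((x *m A) ord0 i); rewrite subrK; lra.
have Au : A \in unitmx.
  rewrite -row_free_unit -kermx_eq0; apply/eqP/row_matrixP => i.
  have := l1 (row i (kermx A)); rewrite -row_mul mulmx_ker.
  rewrite [X in _ <= 2 * X]big1 => [|j _]; last by rewrite !mxE normr0.
  rewrite mulr0 => s0; apply/rowP => j; rewrite [RHS]mxE [RHS]mxE.
  apply/eqP; rewrite -normr_eq0 eq_le normr_ge0 andbT (le_trans _ s0)//.
  by rewrite (bigD1 j)//= lerDl sumr_ge0.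
exists (b *m invmx A); split=> [|j]; first by rewrite mulmxKV.
rewrite distrC -{1}[b in X in `|X|](mulmxKV Au) (le_trans (dist _ _))//.
have e0 : 0 <= e by exact: le_trans (normr_ge0 _) (Ae j j).
rewrite ler_wpM2r// (le_trans (l1 _))// mulmxKV// ler_wpM2l//.
rewrite -[leRHS]mulr1 mulr_natl -[in leRHS](card_ord N) -sumr_const.
exact: ler_sum.
Qed.

(** * Existence of the random partition when the marginal is small *)

Section ColorCriterion.
Variables (R : realType) (S : finType).
Implicit Types (p : R) (K A B : {set S}).

Lemma indic_inj : injective (@indic S).
Proof. by move=> A B /ffunP E; apply/setP => i; have := E i; rewrite !ffunE. Qed.

Lemma indicK (eta : {ffun S -> bool}) : indic [set i | eta i]%SET = eta.
Proof. by apply/ffunP => i; rewrite ffunE inE. Qed.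

Lemma sum_indic (P : pred {ffun S -> bool}) (F : {ffun S -> bool} -> R) :
  \sum_(eta | P eta) F eta = \sum_(A | P (indic A)) F (indic A).
Proof.
rewrite (reindex (@indic S)) //=; exists (fun eta => [set i | eta i]%SET).
  by move=> A _; apply: indic_inj; rewrite indicK.
by move=> eta _; rewrite indicK.
Qed.

(** With zeros on all sets of two or more elements, the marginal at [i] reduces to the value at
    [[set i]], and the total then to the value at the empty set. *)
Lemma law_determined (d : {ffun S -> bool} -> R) :
    \sum_eta d eta = 0 -> (forall i, \sum_(eta : {ffun S -> bool} | eta i) d eta = 0) ->
    (forall A, (1 < #|A|)%N -> d (indic A) = 0) -> forall eta, d eta = 0.
Proof.
move=> tot marg two.
have one i : d (indic [set i]%SET) = 0.
  rewrite -[RHS](marg i) sum_indic (bigD1 [set i]%SET) ?ffunE ?inE//= big1 ?addr0// => A.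
  rewrite ffunE => /andP[iA Ai]; apply: two; rewrite (cardsD1 i) iA ltnS.
  rewrite card_gt0; apply: contraNneq Ai => Ai0.
  by rewrite -(finset.setD1K iA) Ai0 finset.setU0.
have pos A : (0 < #|A|)%N -> d (indic A) = 0.
  rewrite leq_eqVlt => /predU1P[/esym/eqP/cards1P[i ->]|/two]//.
move=> eta; rewrite -(indicK eta); case: (posnP #|[set i | eta i]%SET|); last exact: pos.
move/cards0_eq => ->; rewrite -[RHS]tot sum_indic (bigD1 finset.set0)//= big1 ?addr0// => A.
by rewrite -card_gt0; exact: pos.
Qed.

(** [merge_partition] identifies the empty set with the singletons, so the distribution on
    partitions is written as the image of weights [x] on subsets. *)
Lemma color_law_merge p (x : {set S} -> R) eta :
  color_law p (fun pi => \sum_K x K * (pi == merge_partition K)%:R) eta =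
  \sum_K x K * partition_law p (merge_partition K) eta.
Proof.
rewrite color_lawE; under eq_bigr do rewrite mulr_suml.
rewrite exchange_big /=; apply: eq_bigr => K _.
rewrite (bigD1 (merge_partition K))//= eqxx mulr1 big1 ?addr0// => pi /negPf->.
by rewrite mulr0 mul0r.
Qed.

Lemma random_partition_merge (x : {set S} -> R) :
    (forall K, 0 <= x K) -> \sum_K x K = 1 ->
  random_partition (fun pi => \sum_K x K * (pi == merge_partition K)%:R).
Proof.
move=> x0 x1; split=> [pi||pi].
- by apply: sumr_ge0 => K _; rewrite mulr_ge0.
- rewrite exchange_big /= -[RHS]x1; apply: eq_bigr => K _.
  by rewrite -mulr_sumr (bigD1 (merge_partition K))//= eqxx big1 ?addr0 ?mulr1// => pi /negPf->.
- apply: contraNT => npi; rewrite big1// => K _; case: eqP npi => [->|]; last by rewrite mulr0.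
  by rewrite merge_partitionP.
Qed.

(** [p0] depends on [delta] and [S] alone, so [nu] may vary with the threshold. The weight of the
    partition into singletons is eliminated as one minus the others, which leaves a square system
    for the weights of the large blocks. *)
Lemma color_law_criterion (delta : R) : 0 < delta ->
  exists2 p0 : R, 0 < p0 & forall p (nu : {ffun S -> bool} -> R), 0 < p < p0 ->
    (forall eta, 0 <= nu eta) -> \sum_eta nu eta = 1 ->
    (forall i, \sum_(eta : {ffun S -> bool} | eta i) nu eta = p) ->
    (forall A, (1 < #|A|)%N -> delta * p <= nu (indic A)) ->
    \sum_(A : {set S} | (1 < #|A|)%N) nu (indic A) <= (1 - delta) * p ->
  exists2 q : {set {set S}} -> R, random_partition q &
    forall eta, nu eta = color_law p q eta.
Proof.
move=> d0; pose N := #|{set S}|; pose n := #|S|.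
(* [C * p] dominates all errors below, in particular [p + N%:R * (2 * N%:R * e)], and [p0] keeps
   [C * p] under half of [delta] and of 1. *)
pose C : R := 2 * N%:R * (N%:R + 1) * (n%:R + 2).
have C0 : 0 < C by rewrite !mulr_gt0// ?ltr_wpDl// ?ler0n// ltr0n; apply/card_gt0P; exists finset.set0.
have N1 : 1 <= N%:R :> R by rewrite ler1n; apply/card_gt0P; exists finset.set0.
have n0 : 0 <= n%:R :> R by [].
exists (Num.min 1 (Num.min delta 1 / (2 * C))).
  have m0 : 0 < Num.min delta 1 by rewrite lt_min d0 ltr01.
  by rewrite lt_min ltr01 divr_gt0// mulr_gt0.
move=> p nu /andP[p0]; rewrite lt_min => /andP[p1].
have C2 : 0 < 2 * C by rewrite mulr_gt0.
rewrite (ltr_pdivlMr _ _ C2) lt_min => /andP[pCd pC1].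
move=> nu0 nu1 numarg nuge nule.
have p01 : 0 <= p <= 1 by rewrite !ltW.
pose D K A := partition_law p (merge_partition K) (indic A).
pose big A := (1 < #|A|)%N.
(* [n%:R * p] comes from [partition_law_block_ge] on the diagonal, and [p] from the subtracted law
   of the partition into singletons. *)
pose e : R := (n%:R + 1) * p.
have e0 : 0 <= e by apply: mulr_ge0; [exact: addr_ge0|exact: ltW].
(* Indices range over all subsets; identity entries decouple the small ones and spare a subtype for
   the large ones. *)
pose A : 'M[R]_N := \matrix_(k, s)
  (if big (enum_val k) && big (enum_val s) then
     (D (enum_val k) (enum_val s) - D finset.set0 (enum_val s)) / p
   else (k == s)%:R).
pose bs s : R := if big s then (nu (indic s) - D finset.set0 s) / p else 0.
pose b : 'rV[R]_N := \row_s bs (enum_val s).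
have D0 K s : 0 <= D K s by exact: partition_law_ge0.
have Dle K s : big s -> s != K -> D K s <= p * p by rewrite -expr2; exact: partition_law_merge_le.
have nes s : big s -> s != finset.set0 by rewrite -card_gt0; exact: ltn_trans.
have D0le s : big s -> D finset.set0 s <= p * p by move=> bs'; apply: Dle => //; exact: nes.
have nup s : big s -> nu (indic s) <= p.
  move=> bs'; have /card_gt0P[i is_] : (0 < #|s|)%N by exact: ltn_trans bs'.
  rewrite -(numarg i) (bigD1 (indic s)) ?ffunE//= lerDl.
  by apply: sumr_ge0 => ? _.
have [||j|x [xA xb]] := @perturbed_identity_solve R N A b e.
- move=> k s; rewrite mxE; case: ifP => [/andP[bk bs']|_]; last first.
    by rewrite subrr normr0 mulr_ge0 ?addr_ge0// ltW.
  rewrite -(inj_eq enum_val_inj); set K := enum_val k; set s' := enum_val s.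
  rewrite -(ler_pM2r p0) -[X in _ * X <= _](gtr0_norm p0) -normrM mulrBl divfK ?gt_eqF//.
  have := D0le s' bs'; have := D0 finset.set0 s'; rewrite /e.
  have np0 : 0 <= n%:R * p * p by rewrite !mulr_ge0// ltW.
  have pp0 : 0 <= p * p by rewrite mulr_ge0// ltW.
  have [Es|ns] := eqVneq K s'; rewrite ?mulr1n ?mulr0n.
    have K0 : (0 < #|K|)%N by exact: ltn_trans bk.
    have := partition_law_block_le p01 K0; have := partition_law_block_ge p01 K0.
    by rewrite -Es -/(D K K) -/n expr2 => ? ? ? ?; rewrite ler_norml; apply/andP; split; lra.
  have := Dle K s' bs'; rewrite eq_sym ns => /(_ isT); have := D0 K s'.
  by move=> ? ? ? ?; rewrite ler_norml; apply/andP; split; lra.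
- have : N%:R * e <= C * p.
    rewrite /e mulrA ler_wpM2r ?ltW// /C; nra.
  by move: pC1; lra.
- rewrite mxE /bs; case: ifP => [bj|]; last by rewrite normr0.
  rewrite -(ler_pM2r p0) -[X in _ * X <= _](gtr0_norm p0) -normrM divfK ?gt_eqF// mul1r.
  have := nup _ bj; have := nu0 (indic (enum_val j)).
  have := D0le _ bj; have := D0 finset.set0 (enum_val j).
  by move=> ? ? ? ?; rewrite ler_norml; apply/andP; split; nra.
pose xs (s : {set S}) : R := x ord0 (enum_rank s).
have xsE s : `|xs s - bs s| <= 2 * N%:R * e.
  by have := xb (enum_rank s); rewrite mxE enum_rankK.
have eqxs s : big s ->
    \sum_(K | big K) xs K * (D K s - D finset.set0 s) = nu (indic s) - D finset.set0 s.
  move=> bs'; have /rowP/(_ (enum_rank s)) := xA; rewrite !mxE enum_rankK /bs bs'.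
  move/(congr1 (fun z => z * p)); rewrite divfK ?gt_eqF// => <-.
  rewrite mulr_suml [RHS](reindex (@enum_rank {set S}))/=; last first.
    by exists enum_val => ? _; rewrite ?enum_rankK ?enum_valK.
  rewrite big_mkcond; apply: eq_bigr => K _; rewrite mxE !enum_rankK bs' andbT.
  case: ifP => bK; first by rewrite -mulrA divfK ?gt_eqF.
  rewrite (inj_eq enum_rank_inj); case: eqP => [E|_]; last by rewrite mulr0 mul0r.
  by move: bK; rewrite E bs'.
have err : 2 * N%:R * e <= C * p.
  rewrite /e mulrA ler_wpM2r ?ltW// /C; nra.
have errN : p + N%:R * (2 * N%:R * e) <= C * p.
  have -> : p + N%:R * (2 * N%:R * e) = (1 + 2 * N%:R * N%:R * (n%:R + 1)) * p.
    by rewrite /e; ring.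
  by rewrite ler_wpM2r ?ltW// /C; nra.
(* [bs s] is at least [delta - p], and [xs s] is within [2 * N%:R * e] of it. *)
have xpos s : big s -> 0 <= xs s.
  move=> bs'; have := xsE s; rewrite /bs bs' ler_norml => /andP[+ _].
  have : delta - p <= (nu (indic s) - D finset.set0 s) / p.
    rewrite ler_pdivlMr//; have := nuge _ bs'; have := D0le _ bs'; lra.
  have : e <= N%:R * e by rewrite ler_peMl.
  have : 2 * N%:R * e <= N%:R * (2 * N%:R * e).
    by rewrite ler_peMl// mulr_ge0// mulr_ge0.
  by move: pCd errN; lra.
(* The gap [delta] in the bound on the sum of [nu] absorbs the errors of at most [N] weights. *)
have xsum : \sum_(K | big K) xs K <= 1.
  have : \sum_(K | big K) xs K <= \sum_(K | big K) (nu (indic K) / p + 2 * N%:R * e).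
    apply: ler_sum => s bs'; have := xsE s; rewrite /bs bs' ler_norml => /andP[_].
    have : 0 <= D finset.set0 s / p by rewrite divr_ge0// ltW.
    by rewrite mulrBl; lra.
  rewrite big_split /= -mulr_suml sumr_const -[_ *+ _]mulr_natl => le1.
  apply: (le_trans le1).
  have : (\sum_(K | big K) nu (indic K)) / p <= 1 - delta by rewrite ler_pdivrMr.
  have : #|big|%:R * (2 * N%:R * e) <= N%:R * (2 * N%:R * e).
    by rewrite ler_wpM2r ?ler_nat ?max_card// mulr_ge0// mulr_ge0.
  by move: errN pCd; lra.
(* The remaining mass goes to the partition into singletons, represented by the empty set. *)
pose y K : R := if big K then xs K else if K == finset.set0 then 1 - \sum_(K | big K) xs K else 0.
have sety : forall (F : {set S} -> R), \sum_K y K * F K =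
    \sum_(K | big K) xs K * F K + (1 - \sum_(K | big K) xs K) * F finset.set0.
  move=> F; rewrite (bigID big)/=; congr (_ + _).
    by apply: eq_bigr => K bK; rewrite /y bK.
  rewrite (bigD1 finset.set0)/= ?/big ?cards0// /y /big cards0 eqxx /= [X in _ + X = _]big1 ?addr0// => K.
  by move=> /andP[/negPf-> /negPf->]; rewrite mul0r.
exists (fun pi => \sum_K y K * (pi == merge_partition K)%:R).
  apply: random_partition_merge => [K|].
    by rewrite /y; case: ifP => [/xpos//|_]; case: ifP => // _; rewrite subr_ge0.
  have := sety (fun=> 1); under eq_bigr do rewrite mulr1; move=> ->.
  by under eq_bigr do rewrite mulr1; rewrite mulr1 subrKC.
move=> eta; apply/eqP; rewrite -subr_eq0; apply/eqP; move: eta.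
have y1 : \sum_K y K = 1.
  have := sety (fun=> 1); under eq_bigr do rewrite mulr1; move=> ->.
  by under eq_bigr do rewrite mulr1; rewrite mulr1 subrKC.
apply: law_determined => [|i|s bs'].
- under eq_bigr do rewrite color_law_merge.
  rewrite sumrB nu1 exchange_big /=; under [X in _ - X]eq_bigr do
    rewrite -mulr_sumr partition_law_tot mulr1.
  by rewrite y1 subrr.
- under eq_bigr do rewrite color_law_merge.
  rewrite sumrB numarg exchange_big /=; under [X in _ - X]eq_bigr do
    rewrite -mulr_sumr partition_law_marginal.
  by rewrite -mulr_suml y1 mul1r subrr.
- rewrite color_law_merge sety; have := eqxs s bs'.
  under eq_bigr do rewrite mulrBr; rewrite sumrB -mulr_suml /D; lra.
Qed.

End ColorCriterion.

(** * Trigonometric approximation *)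

Section SineBounds.
Variable R : realType.
Implicit Types x y : R.

Lemma sin_mean_value x : 0 <= x -> exists2 c, 0 <= c <= x & sin x = cos c * x.
Proof.
move=> x0; have [|c c0x] := @MVT_segment R sin cos 0 x x0.
- by apply: continuous_subspaceT => y; exact: continuous_sin.
- by move: c0x; rewrite in_itv/= sin0 !subr0 => cx ->; exists c.
Qed.

Lemma ler_norm_sin x : `|sin x| <= `|x|.
Proof.
have pos y : 0 <= y -> `|sin y| <= y.
  move=> y0; have [c _ ->] := sin_mean_value y0.
  by rewrite normrM (ger0_norm y0) ler_piMl// cos_max.
have [x0|/ltW x0] := leP 0 x; first by rewrite (ger0_norm x0) pos.
by rewrite (ler0_norm x0); have := pos (- x); rewrite oppr_ge0 sinN normrN; exact.
Qed.

(** The mean value point lies in [[0, 1]], where the cosine is at least [cos 1]. *)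
Lemma sin_ge_linear x : 0 <= x <= 1 -> cos 1 * x <= sin x.
Proof.
case/andP => x0 x1; have [c /andP[c0 cx] ->] := sin_mean_value x0.
rewrite ler_wpM2r//; have [->//|c1] := eqVneq c 1.
have pi1 : 1 <= pi :> R by rewrite (le_trans _ (pi_ge2 R))// ler1n.
have c1' : c <= 1 by exact: le_trans x1.
have i1 : (1 : R) \in `[(0 : R), pi] by rewrite in_itv/= ler01 pi1.
have ic : c \in `[(0 : R), pi] by rewrite in_itv/= c0 (le_trans c1').
by rewrite ltW// (ltr_cos ic i1) lt_neqAle c1.
Qed.

Lemma onem_cosE x : 1 - cos x = 2 * sin (x / 2) ^+ 2.
Proof.
rewrite -[x in cos x](divfK (_ : 2 != 0 :> R))// mulr_natr cos_mulr2n cos2sin2.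
ring.
Qed.

Lemma onem_cos_le x : 1 - cos x <= x ^+ 2 / 2.
Proof.
rewrite onem_cosE -(real_normK (num_real (sin _))).
have : `|sin (x / 2)| ^+ 2 <= `|x / 2| ^+ 2 by rewrite ler_sqr ?nnegrE// ler_norm_sin.
rewrite (real_normK (num_real (x / 2))); lra.
Qed.

Lemma onem_cos_ge x : `|x| <= 2 -> cos 1 ^+ 2 / 2 * x ^+ 2 <= 1 - cos x.
Proof.
move=> x2; rewrite -(cos_norm x) onem_cosE -(real_normK (num_real x)).
have : cos 1 * (`|x| / 2) <= sin (`|x| / 2).
  by apply: sin_ge_linear; rewrite divr_ge0//= ler_pdivrMr// mul1r.
rewrite -ler_sqr ?nnegrE; last 2 first.
- by rewrite mulr_ge0 ?divr_ge0// ltW// cos1_gt0.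
- by rewrite sin_ge0_pi// divr_ge0//= (le_trans _ (pi_ge2 R))// ler_pdivrMr// (le_trans x2)// ler_peMl// ler1n.
lra.
Qed.

(** Quadratic at the origin and bounded at infinity, like the integrand in the integrability
    condition on a Levy measure. *)
Definition trunc_sqr y : R := Num.min 1 (y ^+ 2).

Lemma trunc_sqr_ge0 y : 0 <= trunc_sqr y.
Proof. by rewrite le_min ler01 sqr_ge0. Qed.

Lemma trunc_sqr_le1 y : trunc_sqr y <= 1.
Proof. by rewrite ge_min lexx. Qed.

Lemma trunc_sqr0 : trunc_sqr 0 = 0.
Proof. by rewrite /trunc_sqr expr0n/= min_r. Qed.

Lemma ler_trunc_sqr x y : `|x| <= `|y| -> trunc_sqr x <= trunc_sqr y.
Proof.
move=> xy; rewrite le_min !ge_min lexx/= -(real_normK (num_real x)).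
by rewrite -[in X in _ || X](real_normK (num_real y)) ler_sqr ?nnegrE// xy orbT.
Qed.

Lemma trunc_sqr_ge1 y : 1 <= `|y| -> trunc_sqr y = 1.
Proof.
move=> y1; rewrite /trunc_sqr min_l// -(real_normK (num_real y)).
by rewrite -[leLHS](expr1n _ 2) ler_sqr ?nnegrE.
Qed.

Lemma sin_sqr_le_trunc (k y : R) : 0 <= k <= 1 -> sin (k * y) ^+ 2 <= trunc_sqr y.
Proof.
case/andP => k0 k1; rewrite le_min; apply/andP; split.
  by rewrite -(real_normK (num_real _)) -[leRHS](expr1n _ 2) ler_sqr ?nnegrE// sin_max.
rewrite -(real_normK (num_real (sin _))) -[leRHS](real_normK (num_real y)).
by rewrite ler_sqr ?nnegrE// (le_trans (ler_norm_sin _))// normrM ger0_norm// ler_piMl.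
Qed.

(* Dyadic scales make a trigonometric sum dominate [trunc_sqr] although each
   [1 - cos] vanishes far from the origin. *)
Lemma trunc_sqr_le_cos (K : nat) y : `|y| <= 2 ^+ K.+1 ->
  trunc_sqr y <= 2 / cos 1 ^+ 2 * \sum_(k < K.+1) (1 - cos (2 ^- k * y)).
Proof.
have c0 : 0 < cos 1 ^+ 2 / 2 :> R by rewrite divr_gt0// exprn_gt0// cos1_gt0.
have -> : 2 / cos 1 ^+ 2 = (cos 1 ^+ 2 / 2)^-1 :> R by rewrite invf_div.
rewrite mulrC ler_pdivlMr//.
elim: K => [|K IH] yK.
  rewrite big_ord1 expr0 invr1 mul1r (le_trans _ (onem_cos_ge _)) ?expr1//.
  by rewrite mulrC ler_wpM2l ?(ltW c0)// ge_min lexx orbT.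
rewrite big_ord_recr/=; have [yK'|/ltW yK'] := leP `|y| (2 ^+ K.+1).
  by rewrite (le_trans (IH yK'))// lerDl subr_ge0 cos_le1.
(* At the scale just added the argument has absolute value between 1 and 2, so this one term
   suffices. *)
have z1 : 1 <= `|2 ^- K.+1 * y|.
  by rewrite normrM ger0_norm ?invr_ge0 ?exprn_ge0// mulrC ler_pdivlMr ?exprn_gt0// mul1r.
have z2 : `|2 ^- K.+1 * y| <= 2.
  by rewrite normrM ger0_norm ?invr_ge0 ?exprn_ge0// mulrC ler_pdivrMr ?exprn_gt0// -exprS.
rewrite (le_trans _ (_ : 1 - cos (2 ^- K.+1 * y) <= _))//; last first.
  by rewrite lerDr sumr_ge0// => k _; rewrite subr_ge0 cos_le1.
rewrite (le_trans _ (onem_cos_ge z2))// mulrC ler_wpM2l ?(ltW c0)//.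
rewrite (le_trans (trunc_sqr_le1 _))// -(real_normK (num_real _)).
by rewrite -[leLHS](expr1n _ 2) ler_sqr ?nnegrE.
Qed.

End SineBounds.

(** * Closure properties of weighted trigonometric approximation *)

Section TrigApproximation.
Variables (R : realType) (I : zmodType) (U : Type) (ph : I -> U -> R).
Hypothesis phD : forall a b u, ph (a + b) u = ph a u + ph b u.

(** Frequencies live in an abstract group [I] so that the same results serve real frequencies and
    the vectors of [dot]. *)
Inductive trig_span : (U -> R) -> Prop :=
| trig_cos a : trig_span (fun u => cos (ph a u))
| trig_sin a : trig_span (fun u => sin (ph a u))
| trig_add f g : trig_span f -> trig_span g -> trig_span (fun u => f u + g u)
| trig_scale c f : trig_span f -> trig_span (fun u => c * f u).

Lemma phase0 u : ph 0 u = 0.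
Proof. by apply: (addrI (ph 0 u)); rewrite -phD !addr0. Qed.

Lemma phaseB a b u : ph (a - b) u = ph a u - ph b u.
Proof. by rewrite -[in RHS](subrK b a) phD addrK. Qed.

Lemma trig_cst c : trig_span (fun=> c).
Proof.
have -> : (fun=> c) = (fun u => c * cos (ph 0 u)).
  by apply/funext => u; rewrite phase0 cos0 mulr1.
exact/trig_scale/trig_cos.
Qed.

(** By the product-to-sum formulas, since frequencies can be added and subtracted. *)
Lemma trig_mul f g : trig_span f -> trig_span g -> trig_span (fun u => f u * g u).
Proof.
have half (F : U -> R) : trig_span F -> trig_span (fun u => 2^-1 * F u).
  exact: trig_scale.
have sub F G : trig_span F -> trig_span G -> trig_span (fun u => F u - G u).
  move=> sF sG; have -> : (fun u => F u - G u) = (fun u => F u + -1 * G u).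
    by apply/funext => u; rewrite mulN1r.
  exact/trig_add/trig_scale.
move=> sf; elim: sf g => {f} [a|a|f1 f2 _ IH1 _ IH2|c f _ IH] g sg.
- elim: sg => {g} [b|b|g1 g2 _ IH1 _ IH2|c g _ IH].
  + have -> : (fun u => cos (ph a u) * cos (ph b u)) =
        (fun u => 2^-1 * (cos (ph (a + b) u) + cos (ph (a - b) u))).
      by apply/funext => u; rewrite phaseB phD cosB cosD; lra.
    by apply/half/trig_add; exact: trig_cos.
  + have -> : (fun u => cos (ph a u) * sin (ph b u)) =
        (fun u => 2^-1 * (sin (ph (a + b) u) - sin (ph (a - b) u))).
      by apply/funext => u; rewrite phaseB phD sinB sinD; lra.
    by apply/half/sub; exact: trig_sin.
  + by under eq_fun do rewrite mulrDr; exact: trig_add.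
  + by under eq_fun do rewrite mulrCA; exact: trig_scale.
- elim: sg => {g} [b|b|g1 g2 _ IH1 _ IH2|c g _ IH].
  + have -> : (fun u => sin (ph a u) * cos (ph b u)) =
        (fun u => 2^-1 * (sin (ph (a + b) u) + sin (ph (a - b) u))).
      by apply/funext => u; rewrite phaseB phD sinB sinD; lra.
    by apply/half/trig_add; exact: trig_sin.
  + have -> : (fun u => sin (ph a u) * sin (ph b u)) =
        (fun u => 2^-1 * (cos (ph (a - b) u) - cos (ph (a + b) u))).
      by apply/funext => u; rewrite phaseB phD cosB cosD; lra.
    by apply/half/sub; exact: trig_cos.
  + by under eq_fun do rewrite mulrDr; exact: trig_add.
  + by under eq_fun do rewrite mulrCA; exact: trig_scale.
- by under eq_fun do rewrite mulrDl; apply: trig_add; [exact: IH1|exact: IH2].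
- by under eq_fun do rewrite -mulrA; apply: trig_scale; exact: IH.
Qed.

Lemma trig_exp f k : trig_span f -> trig_span (fun u => f u ^+ k).
Proof.
move=> sf; elim: k => [|k IH]; first exact: trig_cst.
by under eq_fun do rewrite exprS; exact: trig_mul.
Qed.

Lemma trig_bounded f : trig_span f -> exists2 B : R, 0 < B & forall u, `|f u| <= B.
Proof.
elim=> {f} [a|a|f1 f2 _ [B1 B10 f1B] _ [B2 B20 f2B]|c f _ [B B0 fB]].
- by exists 1 => // u; exact: cos_max.
- by exists 1 => // u; exact: sin_max.
- by exists (B1 + B2); [exact: addr_gt0|move=> u; rewrite (le_trans (ler_normD _ _))// lerD].
- exists (`|c| * B + 1) => [|u]; first by rewrite ltr_wpDl// mulr_ge0// ltW.
  by rewrite normrM (le_trans (ler_wpM2l (normr_ge0 c) (fB u)))// lerDl.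
Qed.

(** The error is relative to [W]: approximants coincide with [f] wherever [W] vanishes, and
    integrated errors are bounded by integrals of [W]. *)
Definition trig_approx (W f : U -> R) :=
  forall e : R, 0 < e -> exists2 t, trig_span t & forall u, `|f u - t u| <= e * W u.

Lemma trig_approx_weight W W' f :
  (forall u, W u <= W' u) -> trig_approx W f -> trig_approx W' f.
Proof.
move=> WW' Wf e e0; have [t st tf] := Wf e e0; exists t => // u.
by rewrite (le_trans (tf u))// ler_wpM2l// ltW.
Qed.

Lemma trig_approx_ext W f g : f =1 g -> trig_approx W f -> trig_approx W g.
Proof. by move=> /funext ->. Qed.

Section Closure.
Variables (W : U -> R) (BW : R).
Hypotheses (W0 : forall u, 0 <= W u) (WB : forall u, W u <= BW).

Lemma trig_approx_span f : trig_span f -> trig_approx W f.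
Proof. by move=> sf e e0; exists f => // u; rewrite subrr normr0 mulr_ge0// ltW. Qed.

Lemma trig_approx_bounded f : trig_approx W f -> exists2 B : R, 0 < B & forall u, `|f u| <= B.
Proof.
move=> /(_ 1 ltr01) [t /trig_bounded[B B0 tB] ft].
exists (B + `|BW|) => [|u]; first by rewrite ltr_wpDr.
rewrite -(subrK (t u) (f u)) addrC (le_trans (ler_normD _ _))// lerD//.
by rewrite (le_trans (ft u))// mul1r (le_trans (WB u)) ?ler_norm.
Qed.

Lemma trig_approx_add f g :
  trig_approx W f -> trig_approx W g -> trig_approx W (fun u => f u + g u).
Proof.
move=> af ag e e0; have e2 : 0 < e / 2 by rewrite divr_gt0.
have [s ss fs] := af _ e2; have [t st gt] := ag _ e2.
exists (fun u => s u + t u) => [|u]; first exact: trig_add.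
rewrite opprD addrACA (le_trans (ler_normD _ _))//.
by have := fs u; have := gt u; lra.
Qed.

Lemma trig_approx_scale c f : trig_approx W f -> trig_approx W (fun u => c * f u).
Proof.
move=> af e e0; have c0 : 0 < `|c| + 1 by rewrite ltr_wpDl.
have [t st ft] := af (e / (`|c| + 1)) (divr_gt0 e0 c0).
exists (fun u => c * t u) => [|u]; first exact: trig_scale.
rewrite -mulrBr normrM.
apply: (@le_trans _ _ ((`|c| + 1) * (e / (`|c| + 1) * W u))).
  apply: ler_pM => //; first by rewrite lerDl.
by rewrite mulrA mulrCA divff ?mulr1// gt_eqF.
Qed.

Lemma trig_approx_cst c : trig_approx W (fun=> c).
Proof. exact/trig_approx_span/trig_cst. Qed.

Lemma trig_approx_sub f g :
  trig_approx W f -> trig_approx W g -> trig_approx W (fun u => f u - g u).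
Proof.
move=> af ag; apply: (@trig_approx_ext _ (fun u => f u + -1 * g u)).
  by move=> u; rewrite mulN1r.
by apply: trig_approx_add => //; exact: trig_approx_scale.
Qed.

(** [g] is approximated first, since the precision needed for [f] depends on a bound for the
    approximant [t] of [g]. *)
Lemma trig_approx_mul f g :
  trig_approx W f -> trig_approx W g -> trig_approx W (fun u => f u * g u).
Proof.
move=> af ag e e0; have [B B0 fB] := trig_approx_bounded af.
have [|t st gt] := ag (e / (2 * B)); first by rewrite divr_gt0// mulr_gt0.
have [C C0 tC] := trig_bounded st.
have [|s ss fs] := af (e / (2 * C)); first by rewrite divr_gt0// mulr_gt0.
exists (fun u => s u * t u) => [|u]; first exact: trig_mul.
have -> : f u * g u - s u * t u = f u * (g u - t u) + t u * (f u - s u) by ring.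
rewrite (le_trans (ler_normD _ _))// !normrM.
have h1 : `|f u| * `|g u - t u| <= B * (e / (2 * B) * W u) by exact: ler_pM.
have h2 : `|t u| * `|f u - s u| <= C * (e / (2 * C) * W u) by exact: ler_pM.
apply: le_trans (lerD h1 h2) _; rewrite le_eqVlt; apply/orP; left; apply/eqP.
by field; rewrite !gt_eqF.
Qed.

Lemma trig_approx_sum (J : Type) (s : seq J) (P : pred J) (F : J -> U -> R) :
  (forall j, trig_approx W (F j)) -> trig_approx W (fun u => \sum_(j <- s | P j) F j u).
Proof.
move=> aF; elim: s => [|j s IH].
  by apply: (@trig_approx_ext _ (fun=> 0)) (trig_approx_cst 0) => u; rewrite big_nil.
apply: (@trig_approx_ext _
  (fun u => (if P j then F j u else 0) + \sum_(i <- s | P i) F i u)).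
  by move=> u; rewrite big_cons; case: ifP; rewrite ?add0r.
by apply: trig_approx_add => //; case: (P j) => //; exact: trig_approx_cst.
Qed.

Lemma trig_approx_prod (J : Type) (s : seq J) (F : J -> U -> R) :
  (forall j, trig_approx W (F j)) -> trig_approx W (fun u => \prod_(j <- s) F j u).
Proof.
move=> aF; elim: s => [|j s IH].
  by apply: (@trig_approx_ext _ (fun=> 1)) (trig_approx_cst 1) => u; rewrite big_nil.
apply: (@trig_approx_ext _ (fun u => F j u * \prod_(i <- s) F i u)).
  by move=> u; rewrite big_cons.
exact: trig_approx_mul.
Qed.

Lemma trig_approx_lim f :
    (forall e, 0 < e -> exists2 g, trig_approx W g & forall u, `|f u - g u| <= e * W u) ->
  trig_approx W f.
Proof.
move=> af e e0; have e2 : 0 < e / 2 by rewrite divr_gt0.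
have [g ag fg] := af _ e2; have [t st gt] := ag _ e2.
exists t => // u; rewrite -(subrKA (g u)) (le_trans (ler_normD _ _))//.
by have := fg u; have := gt u; lra.
Qed.

End Closure.

(** The classical iteration behind the Stone-Weierstrass theorem: polynomials in [v] that increase
    to the absolute value on [[-1, 1]]. *)
Fixpoint abs_iter (v : R) (k : nat) : R :=
  if k is k'.+1 then abs_iter v k' + (v ^+ 2 - abs_iter v k' ^+ 2) / 2 else 0.

(** A gap [x] to [|v|] shrinks to at most [x * (1 - x / 2)], because [|v|] plus the iterate is at
    least [x]. This map is increasing on [[0, 1]], so the bound of order [1 / k] propagates by
    induction. *)
Lemma abs_iterP v k : `|v| <= 1 ->
  0 <= abs_iter v k <= `|v| /\ `|v| - abs_iter v k <= 2 / (k.+2)%:R.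
Proof.
move=> v1; elim: k => [|k [/andP[a0 av] ak]] /=.
  by split; [rewrite lexx normr_ge0|rewrite subr0 divff].
have sq : v ^+ 2 = `|v| ^+ 2 by rewrite real_normK// num_real.
rewrite sq; move: (abs_iter v k) a0 av ak => a a0 av ak.
move: (`|v|) v1 (normr_ge0 v) av ak => {sq}{v} v v1 v0 av ak.
have step : v - (a + (v ^+ 2 - a ^+ 2) / 2) = (v - a) * (1 - (v + a) / 2) by field.
split; first by apply/andP; split; nra.
rewrite step; set x := v - a in ak *.
have x0 : 0 <= x by rewrite subr_ge0.
apply: (@le_trans _ _ (x * (1 - x / 2))); first by rewrite ler_wpM2l// /x; lra.
set m : R := k.+2%:R in ak *; have m2 : 2 <= m by rewrite ler_nat.
have -> : k.+3%:R = m + 1 :> R by rewrite -natr1.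
have m0 : 0 < m by lra.
rewrite ler_pdivlMr ?addr_gt0//; move: ak; rewrite ler_pdivlMr// => ak.
have x1 : x <= 1 by rewrite /x; lra.
have h : x * (1 - x / 2) <= 2 / m * (1 - 1 / m).
  have xy : x <= 2 / m by rewrite ler_pdivlMr.
  have y1 : 2 / m <= 1 by rewrite ler_pdivrMr// mul1r.
  have -> : 1 / m = (2 / m) / 2 by rewrite mulrAC divff.
  by move: (2 / m) xy y1 => y xy y1; clearbody x; nra.
apply: le_trans (ler_wpM2r _ h) _; first by rewrite addr_ge0// ltW.
have -> : 2 / m * (1 - 1 / m) * (m + 1) = 2 - 2 / m ^+ 2 by field; rewrite gt_eqF.
by rewrite lerBlDr lerDl divr_ge0 ?exprn_ge0 ?ltW.
Qed.

(** The polynomial approximation of the absolute value is uniform, with no quadratic control at the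
    origin. The constant weight therefore serves here, and [trig_approx_localize] recovers the finer
    one. *)
Let one := fun _ : U => 1 : R.
Let one0 u : 0 <= one u. Proof. exact: ler01. Qed.
Let one1 u : one u <= 1. Proof. exact: lexx. Qed.

Lemma trig_approx_norm f : trig_approx one f -> trig_approx one (fun u => `|f u|).
Proof.
move=> af; have [B B0 fB] := trig_approx_bounded one1 af.
have av : trig_approx one (fun u => B^-1 * f u) by exact: trig_approx_scale.
have v1 u : `|B^-1 * f u| <= 1.
  by rewrite normrM normfV (gtr0_norm B0) mulrC ler_pdivrMr// mul1r.
have aiter k : trig_approx one (fun u => abs_iter (B^-1 * f u) k).
  elim: k => [|k IH]; first exact: trig_approx_cst.
  apply: (@trig_approx_ext _ (fun u => abs_iter (B^-1 * f u) k + 2^-1 *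
    ((B^-1 * f u) * (B^-1 * f u) - abs_iter (B^-1 * f u) k * abs_iter (B^-1 * f u) k))).
    by move=> u /=; rewrite !expr2; ring.
  apply: trig_approx_add => //; apply: trig_approx_scale => //.
  apply: trig_approx_sub; [exact: (trig_approx_mul one1 av av)|exact: (trig_approx_mul one1 IH IH)].
apply: trig_approx_lim => e e0.
pose k := Num.bound (2 * B / e).
exists (fun u => B * abs_iter (B^-1 * f u) k) => [|u]; first exact: trig_approx_scale.
have [/andP[_ le] d] := abs_iterP k (v1 u).
have -> : `|f u| = B * `|B^-1 * f u|.
  by rewrite normrM normfV (gtr0_norm B0) mulrA divff ?mul1r// gt_eqF.
rewrite -mulrBr normrM (gtr0_norm B0) ger0_norm ?subr_ge0// mulr1.
apply: le_trans (ler_wpM2l (ltW B0) d) _.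
rewrite mulrA ler_pdivrMr ?ltr0n//.
have : 2 * B / e < k%:R.
  by apply: archi_boundP; rewrite divr_ge0 ?mulr_ge0 ?ltW.
rewrite ltr_pdivrMr// => h.
have : k%:R <= k.+2%:R :> R by rewrite ler_nat leqW.
move/(ler_wpM2l (ltW e0)); lra.
Qed.

(** Piecewise linear from 0 at [a] to 1 at [b], written with absolute values so that
    [trig_approx_norm] applies. *)
Definition ramp (a b s : R) : R :=
  2^-1 * (`|(s - a) / (b - a)| - `|(s - a) / (b - a) - 1| + 1).

Lemma ramp_low a b s : a < b -> s <= a -> ramp a b s = 0.
Proof.
move=> ab sa; have v0 : (s - a) / (b - a) <= 0.
  by rewrite ler_pdivrMr ?subr_gt0// mul0r subr_le0.
by rewrite /ramp ler0_norm// ler0_norm; lra.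
Qed.

Lemma ramp_high a b s : a < b -> b <= s -> ramp a b s = 1.
Proof.
move=> ab bs; have v1 : 1 <= (s - a) / (b - a).
  by rewrite ler_pdivlMr ?subr_gt0// mul1r lerD2r.
by rewrite /ramp ger0_norm ?ger0_norm; lra.
Qed.

Lemma ramp_01 a b s : a < b -> 0 <= ramp a b s <= 1.
Proof.
move=> ab; rewrite /ramp; set v := (s - a) / (b - a).
have := ler_normD (v - 1) 1; rewrite subrK normr1.
have := ler_normB v v; have := ler_normB v 1; rewrite normr1.
have : `|v - 1| <= `|v| + 1 by rewrite (le_trans (ler_normB _ _))// normr1.
lra.
Qed.

Lemma trig_approx_ramp a b f : trig_approx one f -> trig_approx one (fun u => ramp a b (f u)).
Proof.
move=> af; have av : trig_approx one (fun u => (f u - a) / (b - a)).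
  apply: (@trig_approx_ext _ (fun u => (b - a)^-1 * (f u - a))).
    by move=> u; rewrite mulrC.
  by apply: trig_approx_scale => //; apply: trig_approx_sub => //; exact: trig_approx_cst.
apply: trig_approx_scale => //; apply: trig_approx_add => //; last exact: trig_approx_cst.
apply: trig_approx_sub => //; first exact: trig_approx_norm.
by apply: trig_approx_norm; apply: trig_approx_sub => //; exact: trig_approx_cst.
Qed.

Lemma onem_exp_le (x : R) k : 0 <= x <= 1 -> 1 - (1 - x) ^+ k <= k%:R * x.
Proof.
case/andP => x0 x1; elim: k => [|k IH]; first by rewrite expr0 subrr mul0r.
have : (1 - x) ^+ k <= 1 by rewrite exprn_ile1 ?subr_ge0// lerBlDr lerDl.
by rewrite exprS -natr1; nra.
Qed.

(* Multiplying an approximant by [1 - (1 - s^2)^J] makes it vanish to second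
   order where [s = 0], at little cost where [s^2] is bounded below. *)
Lemma trig_approx_localize (s f : U -> R) (sigma : R) :
    0 < sigma < 1 -> trig_span s -> (forall u, `|s u| <= 1) ->
    trig_approx one f -> (forall u, `|f u| <= 1) ->
    (forall u, s u ^+ 2 < sigma -> f u = 0) ->
  trig_approx (fun u => s u ^+ 2) f.
Proof.
case/andP=> sg0 sg1 ss s1 af f1 f0 e e0.
(* Where [f] is nonzero, [s u ^+ 2] is at least [sigma], so the power [J] of [1 - s u ^+ 2] is at
   most [e / 2 * s u ^+ 2]. The approximant [t] is chosen after [J], as its error gets multiplied by
   up to [J%:R * s u ^+ 2]. *)
have [J JP] : exists J, (1 - sigma) ^+ J <= e / 2 * sigma.
  have := @cvg_expr R (1 - sigma).
  have -> : `|1 - sigma| < 1 by rewrite ger0_norm ?subr_ge0 ?(ltW sg1)// ltrBlDr ltrDl.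
  move=> /(_ isT) /cvgr0_norm_le /(_ (e / 2 * sigma)) [|J _ /(_ J (leqnn J))].
    by rewrite mulr_gt0// divr_gt0.
  move=> h; exists J; apply: le_trans h; exact: ler_norm.
have J0 : 0 < J%:R + 1 :> R by rewrite ltr_wpDl.
have [t st ft] := af (e / 2 / (J%:R + 1)) ltac:(by rewrite !divr_gt0).
exists (fun u => t u * (1 - (1 - s u ^+ 2) ^+ J)) => [|u].
  apply: trig_mul => //.
  have -> : (fun u => 1 - (1 - s u ^+ 2) ^+ J) = (fun u => 1 + -1 * (1 + -1 * s u ^+ 2) ^+ J).
    by apply/funext => u; rewrite !mulN1r.
  apply: trig_add; first exact: trig_cst.
  apply/trig_scale/trig_exp/trig_add; first exact: trig_cst.
  exact/trig_scale/trig_exp.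
have x01 : 0 <= s u ^+ 2 <= 1.
  rewrite sqr_ge0/= -(real_normK (num_real (s u))) -[leRHS](expr1n _ 2).
  by rewrite ler_sqr ?nnegrE.
set x := s u ^+ 2 in x01 *; set r := (1 - x) ^+ J.
have r01 : 0 <= r <= 1.
  by case/andP: x01 => x0 x1; rewrite exprn_ge0 ?exprn_ile1 ?subr_ge0// lerBlDr lerDl.
have -> : f u - t u * (1 - r) = f u * r + (f u - t u) * (1 - r) by ring.
apply: le_trans (ler_normD _ _) _; rewrite !normrM (ger0_norm (x := r)) ?(ger0_norm (x := 1 - r)); last 2 first.
- by rewrite subr_ge0; case/andP: r01.
- by case/andP: r01.
have h1 : `|f u| * r <= e / 2 * x.
  have [/f0 ->|sx] := ltP x sigma.
    by rewrite normr0 mul0r mulr_ge0 ?divr_ge0 ?(ltW e0)//; case/andP: x01.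
  apply: (@le_trans _ _ r); first by rewrite ler_piMl//; case/andP: r01.
  apply: (@le_trans _ _ ((1 - sigma) ^+ J)).
    by rewrite lerXn2r ?nnegrE ?subr_ge0 ?(ltW sg1)//; [case/andP: x01|rewrite lerB].
  by rewrite (le_trans JP)// ler_wpM2l ?divr_ge0 ?(ltW e0).
have h2 : `|f u - t u| * (1 - r) <= e / 2 * x.
  have := ft u; rewrite /one mulr1 => ftu.
  have r1 : 0 <= 1 - r by rewrite subr_ge0; case/andP: r01.
  apply: le_trans (ler_pM (normr_ge0 _) r1 ftu (onem_exp_le J x01)) _.
  rewrite mulrA ler_wpM2r//; first by case/andP: x01.
  rewrite mulrAC ler_pdivrMr// ler_wpM2l ?divr_ge0 ?(ltW e0)// lerDl//.
by rewrite [leRHS](_ : _ = e / 2 * x + e / 2 * x) ?lerD//; field.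
Qed.

End TrigApproximation.

(** * Smoothed indicators of half-lines *)

Section Bump.
Variable R : realType.
Implicit Types M a b y : R.

(** A ramp in [sin (y / M)] instead of [y], hence a function of a single sine. As the sine is
    increasing on [[-1, 1]], this smooths the indicator of a half-line for [|y| <= M]; elsewhere
    only [bump_01] holds. *)
Definition bump M a b y := ramp (sin (a / M)) (sin (b / M)) (sin (y / M)).

Lemma ltr_sin1 x y : `|x| <= 1 -> `|y| <= 1 -> (sin x < sin y :> R) = (x < y).
Proof.
have in1 z : `|z| <= 1 -> z \in `[- (pi / 2), (pi / 2 : R)].
  rewrite ler_norml in_itv/= => /andP[z1 z2].
  by rewrite (le_trans _ z1) ?lerN2 ?pihalf_ge1// (le_trans z2)// pihalf_ge1.
by move=> x1 y1; rewrite ltr_sin ?in1.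
Qed.

Lemma ler_sin1 x y : `|x| <= 1 -> `|y| <= 1 -> (sin x <= sin y :> R) = (x <= y).
Proof. by move=> x1 y1; rewrite !leNgt ltr_sin1. Qed.

Lemma bump_scale_ltr M a b : 0 < a -> a < b -> b <= M -> sin (a / M) < sin (b / M).
Proof.
move=> a0 ab bM; have M0 : 0 < M by lra.
by rewrite ltr_sin1 ?ltr_pM2r ?invr_gt0// normrM normfV (gtr0_norm M0)
   ler_pdivrMr// mul1r ger0_norm; lra.
Qed.

Lemma bump_01 M a b y : 0 < a -> a < b -> b <= M -> 0 <= bump M a b y <= 1.
Proof. by move=> *; apply: ramp_01; exact: bump_scale_ltr. Qed.

Let div_le1 (M z : R) : 0 < M -> `|z| <= M -> `|z / M| <= 1.
Proof. by move=> M0 zM; rewrite normrM normfV (gtr0_norm M0) ler_pdivrMr// mul1r. Qed.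

Lemma bump_low M a b y : 0 < a -> a < b -> b <= M -> `|y| <= M -> y <= a -> bump M a b y = 0.
Proof.
move=> a0 ab bM yM ya; apply: ramp_low; first exact: bump_scale_ltr.
have M0 : 0 < M by lra.
by rewrite ler_sin1 ?div_le1// ?ler_pM2r ?invr_gt0// ger0_norm; lra.
Qed.

Lemma bump_high M a b y : 0 < a -> a < b -> b <= M -> `|y| <= M -> b <= y -> bump M a b y = 1.
Proof.
move=> a0 ab bM yM ya; apply: ramp_high; first exact: bump_scale_ltr.
have M0 : 0 < M by lra.
by rewrite ler_sin1 ?div_le1// ?ler_pM2r ?invr_gt0// ger0_norm; lra.
Qed.

(** The bump vanishes while [sin (y / M)] is at most [sin (a / M)], so it can be localized with
    [s = sin (y / M)]; since [1 <= M], the weight [s ^+ 2] is at most [trunc_sqr y]. *)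
Lemma trig_approx_bump (I : zmodType) (U : Type) (ph : I -> U -> R)
    (phD : forall i j u, ph (i + j) u = ph i u + ph j u) (theta : I) (y : U -> R) M a b :
    0 < a -> a < b -> b <= M -> 1 <= M -> (forall u, ph theta u = y u / M) ->
  trig_approx ph (fun u => trunc_sqr (y u)) (fun u => bump M a b (y u)).
Proof.
move=> a0 ab bM M1 phE; have M0 : 0 < M by lra.
have sa : 0 < sin (a / M).
  by rewrite -[ltLHS]sin0 ltr_sin1 ?normr0// ?div_le1// ?divr_gt0// ger0_norm; lra.
pose s u := sin (ph theta u).
apply: (@trig_approx_weight _ _ _ _ (fun u => s u ^+ 2)) => [u|].
  rewrite /s phE mulrC; apply: sin_sqr_le_trunc.
  by rewrite invr_ge0 ltW//= invf_le1.
(* Halving [sin (a / M) ^+ 2] makes [sigma] strictly less than 1. *)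
apply: (@trig_approx_localize _ _ _ _ phD s _ (sin (a / M) ^+ 2 / 2)).
- have := sin_max (a / M); rewrite ger0_norm ?(ltW sa)// => s1.
  by rewrite divr_gt0 ?exprn_gt0//=; nra.
- exact: trig_sin.
- by move=> u; exact: sin_max.
- apply: (@trig_approx_ext _ _ _ _ _ (fun u => ramp (sin (a / M)) (sin (b / M)) (s u))).
    by move=> u; rewrite /bump /s phE.
  by apply: trig_approx_ramp => //; apply: trig_approx_span => //; exact: trig_sin.
- by move=> u; have /andP[h0 h1] := bump_01 (y u) a0 ab bM; rewrite ger0_norm.
- move=> u su; apply: ramp_low; first exact: bump_scale_ltr.
  rewrite leNgt; apply/negP => lt; move: su; rewrite /s phE; nra.
Qed.

End Bump.

Section VectorApprox.
Variables (R : realType) (n : nat).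
Implicit Types (y theta : 'rV[R]_n).

Lemma dotDl a b y : dot (a + b) y = dot a y + dot b y.
Proof. by rewrite /dot -big_split; apply: eq_bigr => i _; rewrite mxE mulrDl. Qed.

Lemma dotZl (c : R) theta y : dot (c *: theta) y = c * dot theta y.
Proof. by rewrite /dot mulr_sumr; apply: eq_bigr => i _; rewrite mxE mulrA. Qed.

Lemma dotZr (c : R) theta y : dot theta (c *: y) = c * dot theta y.
Proof. by rewrite /dot mulr_sumr; apply: eq_bigr => i _; rewrite mxE mulrCA. Qed.

Lemma dot_delta i y : dot (delta_mx ord0 i) y = y ord0 i.
Proof.
rewrite /dot (bigD1 i)//= mxE !eqxx mul1r big1 ?addr0// => j ji.
by rewrite mxE (negPf ji) andbF mul0r.
Qed.

Definition vtrunc_sqr y := \sum_i trunc_sqr (y ord0 i).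

Lemma vtrunc_sqr_ge0 y : 0 <= vtrunc_sqr y.
Proof. by apply: sumr_ge0 => i _; exact: trunc_sqr_ge0. Qed.

Lemma vtrunc_sqr_le y : vtrunc_sqr y <= n%:R.
Proof.
rewrite -[leRHS]mulr1 mulr_natl -[in leRHS](card_ord n) -sumr_const.
by apply: ler_sum => i _; exact: trunc_sqr_le1.
Qed.

Lemma vtrunc_sqr0 : vtrunc_sqr 0 = 0.
Proof. by rewrite /vtrunc_sqr big1// => i _; rewrite mxE trunc_sqr0. Qed.

Definition vapprox (f : 'rV[R]_n -> R) := trig_approx (@dot R n) vtrunc_sqr f.

(** The factor [c] is meant to be 1 or a sign, for large values of either sign. *)
Lemma vapprox_bump (c : R) i M a b : 0 < a -> a < b -> b <= M -> 1 <= M ->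
  `|c| <= 1 -> vapprox (fun y => bump M a b (c * y ord0 i)).
Proof.
move=> a0 ab bM M1 c1.
apply: (@trig_approx_weight _ _ _ _ (fun y => trunc_sqr (c * y ord0 i))) => [y|].
  rewrite /vtrunc_sqr (bigD1 i)//= (le_trans (ler_trunc_sqr (y := y ord0 i) _))//.
    by rewrite normrM ler_piMl.
  by rewrite lerDl sumr_ge0// => j _; exact: trunc_sqr_ge0.
apply: (trig_approx_bump dotDl (theta := (c / M) *: delta_mx ord0 i)) => // y.
by rewrite dotZl dot_delta mulrAC.
Qed.

End VectorApprox.

(** * Integrals of bounded functions *)

Section BoundedIntegral.
Context d (T : measurableType d) (R : realType).
Variable mu : {measure set T -> \bar R}.
Hypothesis mu_fin : (mu setT < +oo)%E.
Implicit Types f g : T -> R.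

Definition bmeas f := measurable_fun setT f /\ exists B : R, forall x, `|f x| <= B.

Lemma bmeas_integrable f : bmeas f -> mu.-integrable setT (EFin \o f).
Proof.
case=> mf [B fB]; apply: measurable_bounded_integrable => //.
by exists B; split => [|M BM x _]; [exact: num_real|rewrite /= (le_trans (fB x))// ltW].
Qed.

Lemma bmeas_cst c : bmeas (fun=> c).
Proof. by split; [exact: measurable_cst|exists `|c|]. Qed.

Lemma bmeas_add f g : bmeas f -> bmeas g -> bmeas (fun x => f x + g x).
Proof.
move=> [mf [B fB]] [mg [C gC]]; split; first exact: measurable_funD.
by exists (B + C) => x; rewrite (le_trans (ler_normD _ _))// lerD.
Qed.

Lemma bmeas_mul f g : bmeas f -> bmeas g -> bmeas (fun x => f x * g x).
Proof.
move=> [mf [B fB]] [mg [C gC]]; split; first exact: measurable_funM.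
by exists (B * C) => x; rewrite normrM ler_pM.
Qed.

Lemma bmeas_scale c f : bmeas f -> bmeas (fun x => c * f x).
Proof. by move=> bf; apply: bmeas_mul => //; exact: bmeas_cst. Qed.

Lemma bmeas_sub f g : bmeas f -> bmeas g -> bmeas (fun x => f x - g x).
Proof.
move=> bf bg; under eq_fun do rewrite -mulN1r.
by apply: bmeas_add => //; exact: bmeas_scale.
Qed.

Lemma bmeas_sum (J : Type) (s : seq J) (P : pred J) (F : J -> T -> R) :
  (forall j, bmeas (F j)) -> bmeas (fun x => \sum_(j <- s | P j) F j x).
Proof.
move=> bF; elim: s => [|j s IH].
  by under eq_fun do rewrite big_nil; exact: bmeas_cst.
under eq_fun do rewrite big_cons; case: (P j) => //; exact: bmeas_add.
Qed.

Lemma bmeas_bool (b : T -> bool) : measurable_fun setT b -> bmeas (fun x => (b x)%:R).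
Proof.
move=> mb; split; last by exists 1 => x; case: (b x); rewrite ?normr1 ?normr0.
have -> : (fun x => (b x)%:R) = (fun x => if b x then 1 else 0 : R).
  by apply/funext => x; case: (b x).
exact: measurable_fun_ifT.
Qed.

Lemma Rint_add f g : bmeas f -> bmeas g ->
  \int[mu]_x (f x + g x) = \int[mu]_x f x + \int[mu]_x g x.
Proof. by move=> bf bg; rewrite RintegralD//; exact: bmeas_integrable. Qed.

Lemma Rint_sub f g : bmeas f -> bmeas g ->
  \int[mu]_x (f x - g x) = \int[mu]_x f x - \int[mu]_x g x.
Proof. by move=> bf bg; rewrite RintegralB//; exact: bmeas_integrable. Qed.

Lemma Rint_scale c f : bmeas f -> \int[mu]_x (c * f x) = c * \int[mu]_x f x.
Proof. by move=> bf; rewrite RintegralZl//; exact: bmeas_integrable. Qed.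

Lemma Rint_sum (J : Type) (s : seq J) (P : pred J) (F : J -> T -> R) :
    (forall j, bmeas (F j)) ->
  \int[mu]_x (\sum_(j <- s | P j) F j x) = \sum_(j <- s | P j) \int[mu]_x F j x.
Proof.
move=> bF; elim: s => [|j s IH].
  under eq_Rintegral do rewrite big_nil.
  by rewrite Rintegral_cst// mul0r big_nil.
under eq_Rintegral do rewrite big_cons; rewrite big_cons.
by case: (P j) => //; rewrite Rint_add ?IH//; exact: bmeas_sum.
Qed.

Lemma le_Rint f g : bmeas f -> bmeas g -> (forall x, f x <= g x) ->
  \int[mu]_x f x <= \int[mu]_x g x.
Proof. by move=> bf bg fg; apply: le_Rintegral => //; exact: bmeas_integrable. Qed.

Lemma Rint_ge0 f : (forall x, 0 <= f x) -> 0 <= \int[mu]_x f x.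
Proof. by move=> f0; exact: Rintegral_ge0. Qed.

Lemma bmeas_norm f : bmeas f -> bmeas (fun x => `|f x|).
Proof.
move=> [mf [B fB]]; split; first exact: measurableT_comp.
by exists B => x; rewrite normr_id.
Qed.

Lemma Rint_norm_le f g : bmeas f -> bmeas g -> (forall x, `|f x| <= g x) ->
  `|\int[mu]_x f x| <= \int[mu]_x g x.
Proof.
move=> bf bg fg; apply: le_trans (le_normr_Rintegral _ (bmeas_integrable bf)) _ => //.
by apply: le_Rint => //; exact: bmeas_norm.
Qed.

Lemma Rint_bool (b : T -> bool) : measurable_fun setT b ->
  mu [set x | b x] = (\int[mu]_x (b x)%:R)%:E.
Proof.
move=> mb; have mB : measurable [set x | b x].
  rewrite (_ : [set x | b x] = b @^-1` [set true])// -[X in measurable X]setTI; exact: mb.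
rewrite /Rintegral fineK; last exact/integrable_fin_num/bmeas_integrable/bmeas_bool.
rewrite -[in LHS](setIT [set x | b x]) -integral_indic//; apply: eq_integral => x _.
rewrite indicE; case: (boolP (b x)) => bx.
  by rewrite mem_set.
by rewrite memNset//; exact/negP.
Qed.

Lemma RintE f : bmeas f -> (\int[mu]_x (f x)%:E)%E = (\int[mu]_x f x)%:E.
Proof. by move=> bf; rewrite /Rintegral fineK//; exact/integrable_fin_num/bmeas_integrable. Qed.

End BoundedIntegral.

Section MeasurableForall.
Context d (T : measurableType d) (R : realType).

Lemma measurable_forall (I : finType) (b : I -> T -> bool) :
  (forall i, measurable_fun setT (b i)) ->
  measurable_fun setT (fun x => [forall i, b i x]).
Proof.
move=> mb; have -> : (fun x => [forall i, b i x]) = (fun x => \big[andb/true]_i b i x).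
  by apply/funext => x; rewrite big_andE.
elim: (index_enum I) => [|i s IH].
  by under eq_fun do rewrite big_nil; exact: measurable_cst.
by under eq_fun do rewrite big_cons; exact: measurable_and.
Qed.

Lemma measurable_exists (I : finType) (b : I -> T -> bool) :
  (forall i, measurable_fun setT (b i)) ->
  measurable_fun setT (fun x => [exists i, b i x]).
Proof.
move=> mb; have -> : (fun x => [exists i, b i x]) = (fun x => \big[orb/false]_i b i x).
  by apply/funext => x; rewrite big_orE.
elim: (index_enum I) => [|i s IH].
  by under eq_fun do rewrite big_nil; exact: measurable_cst.
by under eq_fun do rewrite big_cons; exact: measurable_or.
Qed.

End MeasurableForall.

(** * Laws and characteristic functions *)

Section Expectations.
Context d (T : measurableType d) (R : realType) (P : probability T R).
Implicit Types Y : T -> R.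

Lemma prob_fin : (P setT < +oo)%E.
Proof. by rewrite probability_setT ltry. Qed.

Lemma Rint_prob_cst (c : R) : \int[P]_w c = c.
Proof. by rewrite Rintegral_cst// [X in fine X](probability_setT P) mulr1. Qed.

Lemma expect_expiP (u : T -> R) (x : R) : expect_expi P u = (x%:C)%C ->
  \int[P]_w cos (u w) = x /\ \int[P]_w sin (u w) = 0.
Proof. by rewrite /expect_expi unlock => -[]. Qed.

Lemma measurable_cos_comp Y : measurable_fun setT Y -> measurable_fun setT (fun w => cos (Y w)).
Proof.
by move=> mY; apply: measurableT_comp => //; apply: continuous_measurable_fun; exact: continuous_cos.
Qed.

Lemma measurable_sin_comp Y : measurable_fun setT Y -> measurable_fun setT (fun w => sin (Y w)).
Proof.
by move=> mY; apply: measurableT_comp => //; apply: continuous_measurable_fun; exact: continuous_sin.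
Qed.

Lemma bmeas_cos Y : measurable_fun setT Y -> bmeas (fun w => cos (Y w)).
Proof. by move=> /measurable_cos_comp mY; split=> //; exists 1 => w; exact: cos_max. Qed.

Lemma bmeas_sin Y : measurable_fun setT Y -> bmeas (fun w => sin (Y w)).
Proof. by move=> /measurable_sin_comp mY; split=> //; exists 1 => w; exact: sin_max. Qed.

Lemma bmeas_trunc_sqr Y : measurable_fun setT Y -> bmeas (fun w => trunc_sqr (Y w)).
Proof.
move=> mY; split.
  by apply: measurable_minr; [exact: measurable_cst|exact: measurable_funX].
by exists 1 => w; rewrite ger0_norm ?trunc_sqr_ge0// trunc_sqr_le1.
Qed.

Lemma measurable_scalel (c : R) Y : measurable_fun setT Y -> measurable_fun setT (fun w => c * Y w).
Proof. by move=> mY; apply: measurable_funM => //; exact: measurable_cst. Qed.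

Lemma bmeas_ltr Y Y' : measurable_fun setT Y -> measurable_fun setT Y' ->
  bmeas (fun w => (Y w < Y' w)%R%:R : R).
Proof. by move=> mY mY'; apply: bmeas_bool; exact: measurable_fun_ltr. Qed.

Lemma measurable_norm_comp Y : measurable_fun setT Y -> measurable_fun setT (fun w => `|Y w|).
Proof. by move=> mY; exact: measurableT_comp. Qed.

(** Bundling gives access to the limit and continuity properties of [ccdf]. *)
Lemma exists_RV Y : measurable_fun setT Y -> exists X : {RV P >-> R}, X = Y :> (T -> R).
Proof.
move=> mY; pose b := isMeasurableFun.Build _ _ _ _ Y mY.
by exists (HB.pack_for {RV P >-> R} Y b).
Qed.

Lemma ccdf_bool (X : {RV P >-> R}) (r : R) : ccdf X r = (\int[P]_w (r < X w)%R%:R)%:E.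
Proof.
rewrite -Rint_bool ?prob_fin//; last exact: measurable_fun_ltr.
by rewrite /ccdf /distribution /pushforward; congr (P _); apply/seteqP; split => w /=;
  rewrite in_itv/= andbT.
Qed.

Lemma tail_small Y (e : R) : measurable_fun setT Y -> 0 < e ->
  exists2 M : R, 0 < M & forall u, M <= u -> \int[P]_w (u < `|Y w|)%R%:R <= e.
Proof.
move=> mY e0; have [X XE] := exists_RV (measurable_norm_comp mY).
have /fine_cvgP[_ /cvgr0_norm_le /(_ e e0)[M [_ MP]]] := cvg_ccdfy0 X.
exists (`|M| + 1) => [|u Mu]; first by rewrite ltr_wpDl.
have := MP u; rewrite /= ccdf_bool/= XE => h; apply: le_trans (ler_norm _) (h _).
by have := ler_norm M; lra.
Qed.

(** Equal trigonometric expectations are compared through a bump between [a] and some [b > a]; then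
    [b] decreases to [a]. The two inequalities follow from each other by exchanging [Y] and [Y']. *)
Lemma tail_unique Y Y' (a : R) : measurable_fun setT Y -> measurable_fun setT Y' ->
    (forall t, \int[P]_w cos (t * Y w) = \int[P]_w cos (t * Y' w)) ->
    (forall t, \int[P]_w sin (t * Y w) = \int[P]_w sin (t * Y' w)) -> 0 < a ->
  \int[P]_w (a < Y w)%R%:R = \int[P]_w (a < Y' w)%R%:R.
Proof.
wlog suff: Y Y' / measurable_fun setT Y -> measurable_fun setT Y' ->
    (forall t, \int[P]_w cos (t * Y w) = \int[P]_w cos (t * Y' w)) ->
    (forall t, \int[P]_w sin (t * Y w) = \int[P]_w sin (t * Y' w)) -> 0 < a ->
    \int[P]_w (a < Y w)%R%:R <= \int[P]_w (a < Y' w)%R%:R.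
  move=> H mY mY' hc hs a0; apply/eqP; rewrite eq_le !H// => t; exact/esym.
move=> mY mY' hc hs a0; have fin := prob_fin.
pose ph := fun t y : R => t * y.
have phD t s y : ph (t + s) y = ph t y + ph s y by rewrite /ph mulrDl.
have bt t : trig_span ph t -> bmeas (fun w => t (Y w)) /\ bmeas (fun w => t (Y' w)).
  elim=> {t} [t|t|f g _ [bf bf'] _ [bg bg']|c f _ [bf bf']].
  - by split; apply: bmeas_cos; exact: measurable_scalel.
  - by split; apply: bmeas_sin; exact: measurable_scalel.
  - by split; exact: bmeas_add.
  - by split; exact: bmeas_scale.
have eqt t : trig_span ph t -> \int[P]_w t (Y w) = \int[P]_w t (Y' w).
  elim=> {t} [t|t|f g sf eqf sg eqg|c f sf eqf]; [exact: hc|exact: hs| |].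
    have [bf bf'] := bt _ sf; have [bg bg'] := bt _ sg.
    by rewrite !Rint_add// eqf eqg.
  by have [bf bf'] := bt _ sf; rewrite !Rint_scale// eqf.
have step b : a < b -> \int[P]_w (b < Y w)%R%:R <= \int[P]_w (a < Y' w)%R%:R.
  move=> ab; apply/ler_addgt0Pr => e e0.
  (* Four errors: an approximation and a tail beyond [M], for each of the two variables. *)
  have e4 : 0 < e / 4 by rewrite divr_gt0.
  have [M1 M10 tY] := tail_small mY e4; have [M2 M20 tY'] := tail_small mY' e4.
  pose M := M1 + M2 + b + 1; have b0 : 0 < b by lra.
  have M1M : M1 <= M by rewrite /M; lra.
  have M2M : M2 <= M by rewrite /M; lra.
  have bM : b <= M by rewrite /M; lra.
  have M1' : 1 <= M by rewrite /M; lra.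
  have : trig_approx ph (fun y => trunc_sqr y) (fun y => bump M a b y).
    by apply: (trig_approx_bump phD (theta := M^-1)) => // y; rewrite /ph mulrC.
  move=> /(_ _ e4)[t st ft]; have [bY bY'] := bt _ st.
  have ft' y : `|bump M a b y - t y| <= e / 4.
    by rewrite (le_trans (ft y))// ler_piMr ?(ltW e4)// trunc_sqr_le1.
  have h1 : \int[P]_w (b < Y w)%R%:R <=
      \int[P]_w (t (Y w) + (e / 4 + (M < `|Y w|)%R%:R)).
    have bb : bmeas (fun w => e / 4 + (M < `|Y w|)%R%:R).
      apply: bmeas_add; [exact: bmeas_cst|apply: bmeas_ltr; [exact: measurable_cst|]].
      exact: measurable_norm_comp.
    apply: le_Rint => //; first by apply: bmeas_ltr => //; exact: measurable_cst.
      exact: bmeas_add.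
    move=> w; have := ft' (Y w); rewrite ler_norml => /andP[_ tw].
    have /andP[p0 p1] := bump_01 (Y w) a0 ab bM.
    have [YM|YM] := ltP M `|Y w|; first by case: (b < Y w) => /=; lra.
    have [bY'w|] := ltP b (Y w) => /=; last by lra.
    by move: tw; rewrite bump_high// ?(ltW bY'w)//; lra.
  have h2 : \int[P]_w (t (Y' w)) <=
      \int[P]_w ((a < Y' w)%R%:R + (e / 4 + (M < `|Y' w|)%R%:R)).
    have bb : bmeas (fun w => e / 4 + (M < `|Y' w|)%R%:R).
      apply: bmeas_add; [exact: bmeas_cst|apply: bmeas_ltr; [exact: measurable_cst|]].
      exact: measurable_norm_comp.
    apply: le_Rint => //.
      by apply: bmeas_add => //; apply: bmeas_ltr => //; exact: measurable_cst.
    move=> w; have := ft' (Y' w); rewrite ler_norml => /andP[tw _].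
    have /andP[p0 p1] := bump_01 (Y' w) a0 ab bM.
    have [YM|YM] := ltP M `|Y' w|; first by case: (a < Y' w) => /=; lra.
    have [|aY] := ltP a (Y' w) => /=; first by lra.
    by move: tw; rewrite bump_low//; lra.
  move: h1 h2 (tY _ M1M) (tY' _ M2M).
  have bM1 : bmeas (fun w => (M < `|Y w|)%R%:R : R).
    by apply: bmeas_ltr; [exact: measurable_cst|exact: measurable_norm_comp].
  have bM2 : bmeas (fun w => (M < `|Y' w|)%R%:R : R).
    by apply: bmeas_ltr; [exact: measurable_cst|exact: measurable_norm_comp].
  have ba : bmeas (fun w => (a < Y' w)%R%:R : R).
    by apply: bmeas_ltr => //; exact: measurable_cst.
  rewrite !Rint_add ?Rint_prob_cst ?eqt//; try exact: bmeas_cst;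
    try by apply: bmeas_add => //; exact: bmeas_cst.
  lra.
(* Right continuity of the tail at [a] closes the gap between [b] and [a]. *)
have [X XE] := exists_RV mY.
have := @ccdf_right_continuous _ _ _ P X a.
rewrite ccdf_bool => /fine_cvgP[_]; rewrite /= XE => cv.
apply: (cvgr_to_le cv); near=> b.
by rewrite /= ccdf_bool/= XE; apply: step; near: b; exact: nbhs_right_gt.
Unshelve. all: by end_near.
Qed.

End Expectations.

Section ExpBounds.
Variable R : realType.
Implicit Types u x h : R.

Lemma onem_expRN_le u : 1 - expR (- u) <= u.
Proof. by have := expR_ge1Dx (- u); lra. Qed.

(** [expR (- u)] is at most [1 / (1 + u)], and [(1 - u + u ^+ 2) * (1 + u) = 1 + u ^+ 3]. *)
Lemma onem_expRN_ge u : 0 <= u -> u - u ^+ 2 <= 1 - expR (- u).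
Proof.
move=> u0; suff : expR (- u) <= 1 - u + u ^+ 2 by lra.
rewrite expRN; have e1 := expR_ge1Dx u.
have e0 : 0 < expR u by exact: expR_gt0.
rewrite -div1r ler_pdivrMr//.
have q0 : 0 <= 1 - u + u ^+ 2 by nra.
apply: le_trans (ler_wpM2l q0 e1); rewrite !exprS expr0; nra.
Qed.

Lemma powR_invM h a : 0 < h -> h `^ a * h^-1 `^ a = 1.
Proof.
by move=> h0; rewrite -powRM ?invr_ge0 ?ltW// divff ?powR1// gt_eqF.
Qed.

Lemma powR_exprn x a k : 0 <= x -> (x ^+ k) `^ a = (x `^ a) ^+ k.
Proof.
by move=> x0; rewrite -powR_mulrn// powRAC powR_mulrn// powR_ge0.
Qed.

Lemma geometric_sum_le x m : 0 <= x < 1 -> \sum_(k < m) x ^+ k <= (1 - x)^-1.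
Proof.
case/andP => x0 x1; rewrite -[leRHS]mul1r ler_pdivlMr ?subr_gt0//.
suff -> : (\sum_(k < m) x ^+ k) * (1 - x) = 1 - x ^+ m.
  by rewrite lerBlDr lerDl exprn_ge0.
elim: m => [|m IH]; first by rewrite big_ord0 mul0r expr0 subrr.
by rewrite big_ord_recr/= mulrDl IH exprS; ring.
Qed.

End ExpBounds.

(** The constant of [trunc_sqr_le_cos] times the geometric series produced by the dyadic scales. *)
Definition stable_const (R : realType) (alpha : R) : R :=
  2 / cos 1 ^+ 2 * (1 - 2^-1 `^ alpha)^-1.

Lemma half_powR_01 (R : realType) (alpha : R) : 0 < alpha -> 0 <= (2^-1 : R) `^ alpha < 1.
Proof.
move=> alpha0; have pow1 : 1 `^ alpha = 1 :> R by rewrite powR1.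
rewrite powR_ge0/= -[ltRHS]pow1 gt0_ltr_powR ?nnegrE//.
by rewrite invf_lt1// ltr1n.
Qed.

Lemma stable_const_gt0 (R : realType) (alpha : R) : 0 < alpha -> 0 < stable_const alpha.
Proof.
move=> /half_powR_01/andP[_ r1]; rewrite mulr_gt0// ?invr_gt0 ?subr_gt0//.
by rewrite divr_gt0// exprn_gt0// cos1_gt0.
Qed.

Section StableMoments.
Context d (T : measurableType d) (R : realType) (P : probability T R).
Variables (alpha : R) (Y : T -> R).
Hypotheses (alpha0 : 0 < alpha) (mY : measurable_fun setT Y).
Hypothesis (hY : std_sym_stable P alpha Y).

Lemma stable_cos t : \int[P]_w cos (t * Y w) = expR (- (`|t| `^ alpha)).
Proof. by case: (expect_expiP (hY t)). Qed.

Lemma stable_sin t : \int[P]_w sin (t * Y w) = 0.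
Proof. by case: (expect_expiP (hY t)). Qed.

Lemma stable_onem_cos t : \int[P]_w (1 - cos (t * Y w)) = 1 - expR (- (`|t| `^ alpha)).
Proof.
have := prob_fin P => fin; rewrite Rint_sub// ?Rint_prob_cst ?stable_cos//.
  exact: bmeas_cst.
exact/bmeas_cos/measurable_scalel.
Qed.

(** After multiplication by [h ^ alpha], the scale [2 ^- k * h^-1] contributes at most [r ^+ k]. The
    geometric series bounds any number of scales at once, so their number can be taken large enough
    to make the tail beyond the last one smaller than [e]. *)
Lemma stable_trunc_sqr_bound h : 0 < h ->
  h `^ alpha * \int[P]_w trunc_sqr (h^-1 * Y w) <= stable_const alpha.
Proof.
move=> h0; have fin := prob_fin P.
pose r : R := 2^-1 `^ alpha.
have r01 : 0 <= r < 1 by exact: half_powR_01.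
pose c : R := 2 / cos 1 ^+ 2.
have c0 : 0 < c by rewrite divr_gt0// exprn_gt0// cos1_gt0.
rewrite -[stable_const _]/(c * (1 - r)^-1); apply/ler_addgt0Pr => e e0.
have ha0 : 0 < h `^ alpha by exact: powR_gt0.
have [M M0 tM] := tail_small P mY (divr_gt0 e0 ha0).
pose K := Num.bound (M / h).
have MK : M <= h * 2 ^+ K.+1.
  rewrite mulrC -ler_pdivrMr//; apply: (@le_trans _ _ K%:R).
    by apply/ltW/archi_boundP; rewrite divr_ge0// ltW.
  by rewrite -natrX ler_nat ltnW// ltnW// ltn_expl.
pose D w := \sum_(k < K.+1) (1 - cos ((2 ^- k * h^-1) * Y w)).
have bt k : bmeas (fun w => 1 - cos ((2 ^- k * h^-1) * Y w)).
  by apply: bmeas_sub; [exact: bmeas_cst|exact/bmeas_cos/measurable_scalel].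
have bD : bmeas D by exact: bmeas_sum.
have bB : bmeas (fun w => (h * 2 ^+ K.+1 < `|Y w|)%R%:R : R).
  by apply: bmeas_ltr; [exact: measurable_cst|exact: measurable_norm_comp].
have le1 : \int[P]_w trunc_sqr (h^-1 * Y w) <=
    \int[P]_w (c * D w + (h * 2 ^+ K.+1 < `|Y w|)%R%:R).
  apply: le_Rint => //; first exact/bmeas_trunc_sqr/measurable_scalel.
    by apply: bmeas_add => //; exact: bmeas_scale.
  move=> w; have D0 : 0 <= c * D w.
    by rewrite mulr_ge0 ?(ltW c0)// sumr_ge0// => k _; rewrite subr_ge0 cos_le1.
  have [YK|YK] := ltP (h * 2 ^+ K.+1) `|Y w|.
    by rewrite (le_trans (trunc_sqr_le1 _))// lerDr.
  rewrite addr0 /D; under eq_bigr do rewrite -mulrA.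
  apply: trunc_sqr_le_cos.
  by rewrite normrM normfV (gtr0_norm h0) mulrC ler_pdivrMr// mulrC.
apply: le_trans (ler_wpM2l (ltW ha0) le1) _.
rewrite Rint_add//; last exact: bmeas_scale.
rewrite Rint_scale// mulrDr; apply: lerD; last first.
  by have := tM _ MK; rewrite ler_pdivlMr// mulrC.
rewrite mulrCA ler_wpM2l ?(ltW c0)// /D Rint_sum// mulr_sumr.
apply: le_trans (geometric_sum_le K.+1 r01); apply: ler_sum => k _.
rewrite stable_onem_cos (le_trans (ler_wpM2l (ltW ha0) (onem_expRN_le _)))//.
rewrite ger0_norm ?mulr_ge0 ?invr_ge0 ?exprn_ge0 ?(ltW h0)//.
rewrite powRM ?invr_ge0 ?exprn_ge0 ?(ltW h0)// mulrCA powR_invM// mulr1.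
by rewrite -exprVn powR_exprn ?invr_ge0.
Qed.

(** Markov's inequality: [trunc_sqr (u^-1 * Y w)] equals 1 where [|Y w|] exceeds [u]. *)
Lemma stable_tail_bound u : 0 < u ->
  u `^ alpha * \int[P]_w (u < `|Y w|)%R%:R <= stable_const alpha.
Proof.
move=> u0; apply: le_trans (stable_trunc_sqr_bound u0); rewrite ler_wpM2l ?powR_ge0//.
apply: le_Rint; first exact: prob_fin.
- by apply: bmeas_ltr; [exact: measurable_cst|exact: measurable_norm_comp].
- exact/bmeas_trunc_sqr/measurable_scalel.
- move=> w; case: ltP => [uY|_]; last exact: trunc_sqr_ge0.
  rewrite trunc_sqr_ge1// normrM normfV (gtr0_norm u0) mulrC ler_pdivlMr// mul1r.
  exact: ltW.
Qed.

End StableMoments.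

(** * Vectors with the same exponent *)

Section CommonLimit.
Variable R : realType.

(** The approximate limit [l] may depend on [e]; completeness yields a limit of [f], and [g] has to
    share it. *)
Lemma common_limit (f g : R -> R) :
    (forall e, 0 < e -> exists l : R, \forall h \near +oo, `|f h - l| <= e /\ `|g h - l| <= e) ->
  exists l : R, f h @[h --> +oo] --> l /\ g h @[h --> +oo] --> l.
Proof.
move=> H; have cf : cvg (f h @[h --> +oo]).
  apply/cauchy_cvgP/cauchy_exP => e e0.
  have [l lP] := H (e / 2) (divr_gt0 e0 (ltr0Sn _ _)); exists l.
  by apply: filterS lP => h [+ _]; rewrite /ball /= distrC; lra.
exists (lim (f h @[h --> +oo])); split => //.
apply/cvgrPdist_le => e e0.
have [l lP] := H (e / 3) (divr_gt0 e0 (ltr0Sn _ _)).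
have e3 : 0 < e / 3 by rewrite divr_gt0.
move/cvgrPdist_le : cf => /(_ _ e3) cf.
apply: filterS2 lP cf => h [fl gl] fL.
move: (lim _) fL => L fL.
have -> : L - g h = (L - f h) + ((f h - l) - (g h - l)) by ring.
apply: le_trans (ler_normD _ _) _.
have := ler_normB (f h - l) (g h - l); lra.
Qed.

End CommonLimit.

Section StableSystem.
Variables (R : realType) (n : nat) (alpha : R).

(** What [X] under [P] and [Z x] under the product have in common: a finite measure, the exponent
    [I], symmetry, and control of the weight uniformly in [h]. *)
Record stable_system d (T : measurableType d) (mu : {measure set T -> \bar R})
    (Y : 'I_n -> T -> R) (I : 'rV[R]_n -> R) : Prop := {
  system_fin : (mu setT < +oo)%E;
  system_meas : forall i, measurable_fun setT (Y i);
  system_cos : forall theta, h `^ alpha *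
    \int[mu]_w (1 - cos (dot theta (h^-1 *: \row_i Y i w))) @[h --> +oo] --> I theta;
  system_sin : forall theta, \int[mu]_w sin (dot theta (\row_i Y i w)) = 0;
  system_bound : exists2 C : R, 0 < C & forall h, 0 < h ->
    h `^ alpha * \int[mu]_w vtrunc_sqr (h^-1 *: \row_i Y i w) <= C }.

Lemma dotr0 (theta : 'rV[R]_n) : dot theta 0 = 0.
Proof. by rewrite -(scale0r (0 : 'rV[R]_n)) dotZr mul0r. Qed.

Section Functional.
Context d (T : measurableType d) (mu : {measure set T -> \bar R}).
Variable Y : 'I_n -> T -> R.
Hypothesis mY : forall i, measurable_fun setT (Y i).

(** [f 0] is subtracted because [h ^ alpha * f 0] would diverge, and with different total masses in
    the two systems. *)
Definition scaled (f : 'rV[R]_n -> R) (h : R) : R :=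
  h `^ alpha * \int[mu]_w (f (h^-1 *: \row_i Y i w) - f 0).

Lemma measurable_dot theta (c : R) :
  measurable_fun setT (fun w => dot theta (c *: \row_i Y i w)).
Proof.
apply: measurable_sum => i; apply: measurable_funM; first exact: measurable_cst.
by under eq_fun do rewrite !mxE; exact: measurable_scalel.
Qed.

Lemma bmeas_trig t (c : R) : trig_span (@dot R n) t ->
  bmeas (fun w => t (c *: \row_i Y i w)).
Proof.
elim=> {t} [a|a|f g _ bf _ bg|a f _ bf].
- exact/bmeas_cos/measurable_dot.
- exact/bmeas_sin/measurable_dot.
- exact: bmeas_add.
- exact: bmeas_scale.
Qed.

Lemma bmeas_vtrunc_sqr (c : R) : bmeas (fun w => vtrunc_sqr (c *: \row_i Y i w)).
Proof.
apply: bmeas_sum => i; apply: bmeas_trunc_sqr.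
by under eq_fun do rewrite !mxE; exact: measurable_scalel.
Qed.

(** Measurability is inherited from the trigonometric polynomials, of which [f] is a pointwise
    limit. *)
Lemma bmeas_vapprox f (c : R) : vapprox f -> bmeas (fun w => f (c *: \row_i Y i w)).
Proof.
move=> af; split; last first.
  have [B B0 fB] := trig_approx_bounded (@vtrunc_sqr_le R n) af.
  by exists B => w.
have /choice[t tP] : forall k : nat, exists t, trig_span (@dot R n) t /\
    forall y, `|f y - t y| <= k.+1%:R^-1 * vtrunc_sqr y.
  by move=> k; have [|t st ft] := af k.+1%:R^-1; [rewrite invr_gt0|exists t].
apply: (@measurable_fun_cvg _ _ _ _ (fun k w => t k (c *: \row_i Y i w))).
  by move=> k; have [st _] := tP k; have [] := bmeas_trig c st.
move=> w _; apply/cvgrPdist_le => e e0.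
pose K := Num.bound (n%:R / e); exists K => // k Kk; have [_ ft] := tP k.
apply: le_trans (ft _) _; apply: (@le_trans _ _ (k.+1%:R^-1 * n%:R)).
  by rewrite ler_wpM2l ?invr_ge0// vtrunc_sqr_le.
rewrite mulrC ler_pdivrMr ?ltr0n// mulrC -ler_pdivrMr//.
apply: (@le_trans _ _ K%:R); first by apply/ltW/archi_boundP; rewrite divr_ge0// ltW.
by rewrite ler_nat (leq_trans Kk).
Qed.

End Functional.

(** The limit is chosen before the system, so it depends on [t] and [I] only: a cosine gives
    [- I a], a sine gives 0. *)
Lemma trig_scaled_limit t : trig_span (@dot R n) t -> forall I : 'rV[R]_n -> R,
  exists l : R, forall d (T : measurableType d) (mu : {measure set T -> \bar R}) Y,
    stable_system mu Y I -> scaled mu Y t h @[h --> +oo] --> l.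
Proof.
move=> st I; elim: st => {t} [a|a|f g sf [l IHf] sg [m IHg]|c f sf [l IHf]].
- exists (- I a) => d T mu Y sys.
  have -> : scaled mu Y (fun y => cos (dot a y)) = (fun h => - (h `^ alpha *
    \int[mu]_w (1 - cos (dot a (h^-1 *: \row_i Y i w))))).
    apply/funext => h; rewrite /scaled -mulrN; congr (_ * _).
    rewrite -[RHS]mulN1r -Rint_scale; last 2 first.
    + exact: system_fin sys.
    + apply: bmeas_sub; first exact: bmeas_cst.
      by apply/bmeas_cos/measurable_dot; exact: system_meas sys.
    apply: eq_Rintegral => w _; rewrite dotr0 cos0.
    by rewrite mulN1r opprB.
  apply: cvgN; exact: system_cos sys a.
- exists 0 => d T mu Y sys.
  have -> : scaled mu Y (fun y => sin (dot a y)) = (fun=> 0).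
    apply/funext => h; rewrite /scaled.
    under eq_Rintegral do rewrite dotr0 sin0 subr0 dotZr -dotZl.
    by rewrite (system_sin sys) mulr0.
  exact: cvg_cst.
- exists (l + m) => d T mu Y sys.
  have mY := system_meas sys; have fin := system_fin sys.
  have -> : scaled mu Y (fun y => f y + g y) = (fun h => scaled mu Y f h + scaled mu Y g h).
    apply/funext => h; rewrite /scaled -mulrDr -Rint_add//; last 2 first.
    + by apply: bmeas_sub; [exact: bmeas_trig|exact: bmeas_cst].
    + by apply: bmeas_sub; [exact: bmeas_trig|exact: bmeas_cst].
    by congr (_ * _); apply: eq_Rintegral => w _; ring.
  by apply: cvgD; [exact: IHf|exact: IHg].
- exists (c * l) => d T mu Y sys.
  have mY := system_meas sys; have fin := system_fin sys.
  have -> : scaled mu Y (fun y => c * f y) = (fun h => c * scaled mu Y f h).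
    apply/funext => h; rewrite /scaled mulrCA -[in RHS]Rint_scale//; last first.
      by apply: bmeas_sub; [exact: bmeas_trig|exact: bmeas_cst].
    by congr (_ * _); apply: eq_Rintegral => w _; ring.
  by apply: cvgM; [exact: cvg_cst|exact: IHf].
Qed.

(** The weight vanishes at the origin, so [f 0 = t 0] and the subtracted constants cancel. *)
Lemma scaled_dist d (T : measurableType d) (mu : {measure set T -> \bar R}) Y I f t (e : R) :
    stable_system mu Y I -> vapprox f -> trig_span (@dot R n) t -> 0 <= e ->
    (forall y, `|f y - t y| <= e * vtrunc_sqr y) -> forall h, 0 < h ->
  `|scaled mu Y f h - scaled mu Y t h| <=
  e * (h `^ alpha * \int[mu]_w vtrunc_sqr (h^-1 *: \row_i Y i w)).
Proof.
move=> sys af st e0 ft h h0; have mY := system_meas sys; have fin := system_fin sys.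
rewrite /scaled -mulrBr normrM (ger0_norm (powR_ge0 _ _)) mulrCA ler_wpM2l ?powR_ge0//.
have bf := bmeas_vapprox mY h^-1 af; have bt := bmeas_trig mY h^-1 st.
rewrite -Rint_sub//; last 2 first.
- by apply: bmeas_sub => //; exact: bmeas_cst.
- by apply: bmeas_sub => //; exact: bmeas_cst.
have bW := bmeas_vtrunc_sqr mY h^-1.
rewrite -Rint_scale//; apply: Rint_norm_le => //.
- by do 2?[apply: bmeas_sub] => //; exact: bmeas_cst.
- exact: bmeas_scale.
move=> w; have ft0 : f 0 = t 0.
  apply/eqP; rewrite -subr_eq0 -normr_le0 (le_trans (ft 0))//.
  by rewrite vtrunc_sqr0 mulr0.
by rewrite ft0 opprD addrACA subrr addr0.
Qed.

Lemma scaled_common_limit d1 (T1 : measurableType d1) (mu1 : {measure set T1 -> \bar R}) Y1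
    d2 (T2 : measurableType d2) (mu2 : {measure set T2 -> \bar R}) Y2 I f :
    stable_system mu1 Y1 I -> stable_system mu2 Y2 I -> vapprox f ->
  exists l : R, scaled mu1 Y1 f h @[h --> +oo] --> l /\ scaled mu2 Y2 f h @[h --> +oo] --> l.
Proof.
move=> sys1 sys2 af; apply: common_limit => e e0.
have [C1 C10 C1P] := system_bound sys1; have [C2 C20 C2P] := system_bound sys2.
(* Precision [e / (2 * (C1 + C2))] keeps the scaled error below [e / 2] in both systems. *)
have C0 : 0 < 2 * (C1 + C2) by rewrite mulr_gt0// addr_gt0.
have eC0 := divr_gt0 e0 C0.
have [t st ft] := af _ eC0; have [l lP] := trig_scaled_limit st I; exists l.
have e2 : 0 < e / 2 by rewrite divr_gt0.
have /cvgrPdist_le/(_ _ e2) l1 := lP _ _ _ _ sys1.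
have /cvgrPdist_le/(_ _ e2) l2 := lP _ _ _ _ sys2.
near=> h.
have h0 : 0 < h by near: h; exact: nbhs_pinfty_gt.
have d1h : `|l - scaled mu1 Y1 t h| <= e / 2 by near: h; exact: l1.
have d2h : `|l - scaled mu2 Y2 t h| <= e / 2 by near: h; exact: l2.
have aux (C W x : R) : 0 < C -> C <= C1 + C2 -> W <= C ->
    x <= e / (2 * (C1 + C2)) * W -> x <= e / 2.
  move=> C0' CC WC /le_trans; apply.
  apply: (@le_trans _ _ (e / (2 * (C1 + C2)) * (C1 + C2))).
    by rewrite ler_wpM2l ?(ltW eC0)// (le_trans WC).
  by rewrite invfM -!mulrA mulVf ?mulr1// gt_eqF// addr_gt0.
have dist (L x y : R) : `|L - y| <= e / 2 -> `|x - y| <= e / 2 -> `|x - L| <= e.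
  by move=> Ly xy; have := ler_normB (x - y) (L - y); rewrite opprB addrA subrK; lra.
split; [apply: (dist _ _ _ d1h)|apply: (dist _ _ _ d2h)].
  apply: (aux C1) (C1P _ h0) (scaled_dist sys1 af st (ltW eC0) ft h0) => //.
  by rewrite lerDl ltW.
apply: (aux C2) (C2P _ h0) (scaled_dist sys2 af st (ltW eC0) ft h0) => //.
by rewrite lerDr ltW.
Unshelve. all: by end_near.
Qed.

End StableSystem.

(** * Borel vectors and integrals over the sphere *)

Section BorelVectors.
Variables (R : realType) (n : nat).

Lemma measurable_continuous_rV (f : 'rV[R]_n -> R) :
  continuous f -> measurable_fun setT (f : borel_rV R n -> R).
Proof.
move=> /continuousP cf; apply: (measurability _ (RGenOpens.measurableE R)) => //.
move=> _ [_ [a [b ->]] <-]; rewrite setTI; apply: sub_sigma_algebra.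
exact/cf/interval_open.
Qed.

Lemma measurable_coord i : measurable_fun setT ((fun x => x ord0 i) : borel_rV R n -> R).
Proof. by apply: measurable_continuous_rV => x; exact: coord_continuous. Qed.

Lemma measurable_usphere : @measurable _ (borel_rV R n) usphere.
Proof.
have mS : measurable_fun setT ((fun x => \sum_i x ord0 i ^+ 2) : borel_rV R n -> R).
  by apply: measurable_sum => i; apply: measurable_funX; exact: measurable_coord.
rewrite -[X in measurable X]setTI.
have := mS measurableT [set 1] (measurable_set1 _); congr (measurable (_ `&` _)).
Qed.

(* Vanishing off the sphere turns integrals over the sphere into integrals over
   the whole space. *)
Definition sphv (x : 'rV[R]_n) : 'rV[R]_n := if x \in usphere then x else 0.

Lemma usphere_coord (x : 'rV[R]_n) i : usphere x -> `|x ord0 i| <= 1.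
Proof.
move=> xS; rewrite -ler_sqr ?nnegrE// expr1n real_normK ?num_real//.
by rewrite -xS (bigD1 i)//= lerDl sumr_ge0// => j _; exact: sqr_ge0.
Qed.

Lemma sphv_coord x i : `|sphv x ord0 i| <= 1.
Proof.
rewrite /sphv; case: ifPn => [/set_mem/usphere_coord//|_].
by rewrite mxE normr0.
Qed.

Lemma measurable_sphv i : measurable_fun setT ((fun x => sphv x ord0 i) : borel_rV R n -> R).
Proof.
have -> : (fun x : borel_rV R n => sphv x ord0 i) =
    (fun x => if x \in (usphere : set (borel_rV R n)) then x ord0 i else 0).
  by apply/funext => x; rewrite /sphv; case: ifP => //; rewrite mxE.
apply: measurable_fun_ifT; [|exact: measurable_coord|exact: measurable_cst].
apply: (measurable_fun_bool true).
rewrite setTI (_ : _ @^-1` _ = usphere); first exact: measurable_usphere.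
by apply/seteqP; split => x /=; [exact: set_mem|exact: mem_set].
Qed.

Lemma dot_sphv_le theta x : `|dot theta (sphv x)| <= \sum_i `|theta ord0 i|.
Proof.
apply: le_trans (ler_norm_sum _ _ _) _; apply: ler_sum => i _.
by rewrite normrM ler_piMr// sphv_coord.
Qed.

Lemma measurable_dot_sphv theta :
  measurable_fun setT ((fun x => dot theta (sphv x)) : borel_rV R n -> R).
Proof.
apply: measurable_sum => i; apply: measurable_funM; first exact: measurable_cst.
exact: measurable_sphv.
Qed.

Lemma bmeas_powR_dot_sphv (a : R) theta : 0 <= a ->
  bmeas ((fun x => `|dot theta (sphv x)| `^ a) : borel_rV R n -> R).
Proof.
move=> a0; split.
  have m := measurable_norm_comp (measurable_dot_sphv theta).
  exact: (measurableT_comp (measurable_powR a) m).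
exists ((\sum_i `|theta ord0 i|) `^ a) => x; rewrite ger0_norm ?powR_ge0//.
by rewrite ge0_ler_powR ?nnegrE ?sumr_ge0 ?dot_sphv_le.
Qed.

Lemma Rintegral_usphere (L : {finite_measure set (borel_rV R n) -> \bar R})
    (f : 'rV[R]_n -> R) : f 0 = 0 ->
  \int[L]_(x in usphere) f x = \int[L]_x f (sphv x).
Proof.
move=> f0; rewrite Rintegral_mkcond; apply: eq_Rintegral => x _.
by rewrite patchE /sphv; case: ifP.
Qed.

End BorelVectors.

Section InversePower.
Variable R : realType.

Lemma cvg_powR_inv (a : R) : 0 < a -> h^-1 `^ a @[h --> +oo] --> (0 : R).
Proof.
move=> a0; apply/cvgr0Pnorm_lt => e e0.
have p0 : 0 < (e^-1) `^ a^-1 by rewrite powR_gt0// invr_gt0.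
near=> h; have h0 : 0 < h by near: h; exact: nbhs_pinfty_gt.
rewrite ger0_norm ?powR_ge0//.
have : (e^-1) `^ a^-1 < h by near: h; exact: nbhs_pinfty_gt.
move=> /(gt0_ltr_powR a0); rewrite !nnegrE !ltW// => /(_ isT isT).
rewrite -powRrM mulVf ?gt_eqF// powRr1 ?invr_ge0 ?ltW// => eh.
have := powR_invM a h0; have := powR_ge0 h^-1 a; have := powR_gt0 a h0.
move: (h `^ a) (h^-1 `^ a) eh => u v eu u0 v0 uv.
rewrite ltNge; apply/negP => ev; have : e * e^-1 = 1 by rewrite divff// gt_eqF.
by move: (e^-1) eu => e' eu ee'; nra.
Unshelve. all: by end_near.
Qed.

Lemma cvg_inv_power_error (a c K : R) (F : R -> R) : 0 < a ->
    (forall h, 0 < h -> c - h^-1 `^ a * K <= F h <= c) ->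
  F h @[h --> +oo] --> c.
Proof.
move=> a0 FP; apply: (@squeeze_cvgr _ _ _ _ (fun h => c - h^-1 `^ a * K) (fun=> c)).
- by near=> h; apply: FP; near: h; exact: nbhs_pinfty_gt.
- rewrite -[X in _ --> X]subr0 -(mul0r K); apply: cvgB; first exact: cvg_cst.
  by apply: cvgM; [exact: cvg_powR_inv|exact: cvg_cst].
- exact: cvg_cst.
Unshelve. all: by end_near.
Qed.

(** Used with [u] the power [alpha] of [h] and [v] its inverse: the rescaled exponential is linear
    up to an error of order [v]. *)
Lemma onem_expRN_scaled (u v c : R) : 0 <= u -> 0 <= v -> 0 <= c -> u * v = 1 ->
  c - v * (c * c) <= u * (1 - expR (- (v * c))) <= c.
Proof.
move=> u0 v0 c0 uv.
have := onem_expRN_le (v * c); have := onem_expRN_ge (mulr_ge0 v0 c0).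
move=> /(ler_wpM2l u0) ge /(ler_wpM2l u0) le.
have e1 : u * (v * c - (v * c) ^+ 2) = (u * v) * (c - v * (c * c)) by ring.
have e2 : u * (v * c) = c by rewrite mulrA uv mul1r.
by move: ge le; rewrite e1 e2 uv mul1r => -> ->.
Qed.

End InversePower.

Section ProductIntegral.
Context d1 (T1 : measurableType d1) d (T : measurableType d) (R : realType).
Variables (L : {finite_measure set T1 -> \bar R}) (P : probability T R).

Lemma finite_measure_lty : (L setT < +oo)%E.
Proof. by rewrite ltey_eq fin_num_measure. Qed.

Lemma product_fin : ((L \x P)%E setT < +oo)%E.
Proof.
rewrite -setXTT product_measure1E// [X in (_ * X)%E](probability_setT P) mule1.
exact: finite_measure_lty.
Qed.

Lemma Rint_product (f : T1 * T -> R) : bmeas f -> (forall z, 0 <= f z) ->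
  bmeas (fun x => \int[P]_w f (x, w)) /\
  \int[(L \x P)%E]_z f z = \int[L]_x \int[P]_w f (x, w).
Proof.
move=> bf f0; have [mf [B fB]] := bf; have fin := prob_fin P.
have mfE : measurable_fun setT (EFin \o f) by exact/measurable_EFinP.
have f0E z : (0 <= (EFin \o f) z)%E by rewrite lee_fin.
have bfx x : bmeas (fun w => f (x, w)).
  split; last by exists B => w.
  exact: measurableT_comp (measurable_pair1 _).
have FE : fubini_F P (EFin \o f) = EFin \o (fun x => \int[P]_w f (x, w)).
  by apply/funext => x; rewrite /fubini_F /= RintE.
have mF : measurable_fun setT (fubini_F P (EFin \o f)).
  exact: measurable_fun_fubini_tonelli_F.
split.
  split; first by apply/measurable_EFinP; rewrite -FE.
  exists B => x; rewrite ger0_norm ?Rint_ge0//.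
  rewrite -[leRHS](Rint_prob_cst P); apply: le_Rint => //; first exact: bmeas_cst.
  by move=> w; rewrite (le_trans (ler_norm _)).
by rewrite [LHS]/Rintegral fubini_tonelli1// FE.
Qed.

End ProductIntegral.

(** * The stable vector and its radial counterpart share the exponent *)

Section TwoSystems.
Context (R : realType) d (T : measurableType d) (P : probability T R) (n : nat).
Variables (alpha : R) (L : {finite_measure set (borel_rV R n) -> \bar R}).
Hypothesis alpha0 : 0 < alpha.

Definition spectral_exponent (theta : 'rV[R]_n) : R :=
  \int[L]_x `|dot theta (sphv x)| `^ alpha.

Lemma spectral_exponentE theta :
  spectral_exponent theta = \int[L]_(x in usphere) `|dot theta x| `^ alpha.
Proof.
rewrite (@Rintegral_usphere _ _ L (fun x => `|dot theta x| `^ alpha))//.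
by rewrite dotr0 normr0 powR0// gt_eqF.
Qed.

Lemma spectral_exponentZ theta (c : R) : 0 < c ->
  spectral_exponent (c *: theta) = c `^ alpha * spectral_exponent theta.
Proof.
move=> c0; rewrite /spectral_exponent -Rint_scale ?finite_measure_lty//; last first.
  exact/bmeas_powR_dot_sphv/ltW.
by apply: eq_Rintegral => x _; rewrite dotZl normrM (gtr0_norm c0) powRM// ltW.
Qed.

Section Marginals.
Variable X : 'I_n -> {RV P >-> R}.
Hypothesis (hX : sym_stable P alpha X L) (hmarg : forall i, std_sym_stable P alpha (X i)).

Lemma vector_cos theta :
  \int[P]_w cos (dot theta (\row_i X i w)) = expR (- spectral_exponent theta).
Proof. by rewrite spectral_exponentE; case: (expect_expiP (hX.2 theta)). Qed.

Lemma vector_system : stable_system alpha P (fun i => X i : T -> R) spectral_exponent.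
Proof.
have fin := prob_fin P; have mX i : measurable_fun setT (X i : T -> R) by [].
split => //.
- move=> theta; pose c := spectral_exponent theta.
  have c0 : 0 <= c by apply: Rint_ge0 => x; exact: powR_ge0.
  apply: (@cvg_inv_power_error _ alpha c (c ^+ 2)) => // h h0.
  have -> : \int[P]_w (1 - cos (dot theta (h^-1 *: \row_i X i w))) =
      1 - expR (- (h^-1 `^ alpha * c)).
    rewrite Rint_sub//; [|exact: bmeas_cst|exact/bmeas_cos/measurable_dot].
    rewrite Rint_prob_cst -spectral_exponentZ ?invr_gt0// -vector_cos.
    by under [in LHS]eq_Rintegral do rewrite dotZr -dotZl.
  rewrite expr2; apply: onem_expRN_scaled => //; try exact: powR_ge0.
  exact: powR_invM.
- by move=> theta; case: (expect_expiP (hX.2 theta)).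
- exists (n%:R * stable_const alpha + 1) => [|h h0].
    by rewrite ltr_wpDl// mulr_ge0// ltW// stable_const_gt0.
  rewrite /vtrunc_sqr Rint_sum//; last first.
    move=> i; under eq_fun do rewrite !mxE.
    exact/bmeas_trunc_sqr/measurable_scalel.
  apply: (@le_trans _ _ (\sum_(i < n) stable_const alpha)); last first.
    by rewrite sumr_const card_ord mulr_natl lerDl.
  rewrite mulr_sumr; apply: ler_sum => i _; under eq_Rintegral do rewrite !mxE.
  exact: stable_trunc_sqr_bound (hmarg i) _ h0.
Qed.

End Marginals.

Section OneDimensional.
Variable Z : T -> R.
Hypothesis (mZ : measurable_fun setT Z) (hZ : std_sym_stable P alpha Z).

Definition radial (i : 'I_n) (z : borel_rV R n * T) : R := Z z.2 * sphv z.1 ord0 i.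

Lemma row_radial z : \row_i radial i z = Z z.2 *: sphv z.1.
Proof. by apply/rowP => i; rewrite !mxE. Qed.

Lemma dot_radial theta c x w :
  dot theta (c *: \row_i radial i (x, w)) = c * dot theta (sphv x) * Z w.
Proof. by rewrite row_radial/= !dotZr; ring. Qed.

Lemma measurable_radial i : measurable_fun setT (radial i).
Proof.
apply: measurable_funM.
  exact: (measurableT_comp mZ measurable_snd).
exact: (measurableT_comp (measurable_sphv i) measurable_fst).
Qed.

(** For fixed [x] the phase is [dot theta (sphv x)] times [Z], whose cosine integral is explicit;
    integrating over [L] gives the exponent of [X]. The bound on the weight is uniform in [x], as
    coordinates on the sphere are at most 1. *)
Lemma radial_system : stable_system alpha (L \x P)%E radial spectral_exponent.
Proof.
have fin := product_fin L P; have Pfin := prob_fin P; have Lfin := finite_measure_lty L.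
have mV := measurable_radial.
split => //.
- move=> theta; pose J x := `|dot theta (sphv x)| `^ alpha.
  have bJ : bmeas (J : borel_rV R n -> R) by exact/bmeas_powR_dot_sphv/ltW.
  have J0 x : 0 <= J x by exact: powR_ge0.
  apply: (@cvg_inv_power_error _ alpha _ (\int[L]_x (J x * J x))) => // h h0.
  have bf : bmeas (fun z => 1 - cos (dot theta (h^-1 *: \row_i radial i z))).
    by apply: bmeas_sub; [exact: bmeas_cst|exact/bmeas_cos/measurable_dot].
  have f0 z : 0 <= 1 - cos (dot theta (h^-1 *: \row_i radial i z)).
    by rewrite subr_ge0 cos_le1.
  have [bF ->] := Rint_product L P bf f0.
  have FE x : \int[P]_w (1 - cos (dot theta (h^-1 *: \row_i radial i (x, w)))) =
      1 - expR (- (h^-1 `^ alpha * J x)).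
    under eq_Rintegral do rewrite dot_radial.
    rewrite (stable_onem_cos mZ hZ) normrM (powRM _ (normr_ge0 _) (normr_ge0 _)).
    by rewrite [`|h^-1|]gtr0_norm ?invr_gt0.
  rewrite [X in _ <= _ * X <= _](@eq_Rintegral _ _ _ L setT
    (fun x => 1 - expR (- (h^-1 `^ alpha * J x)))); last by move=> x _; exact: FE.
  have bF' : bmeas ((fun x => 1 - expR (- (h^-1 `^ alpha * J x))) : borel_rV R n -> R).
    by move: bF; congr bmeas; apply/funext => x; rewrite FE.
  have := powR_invM alpha h0; have := powR_ge0 h^-1 alpha; have := powR_ge0 h alpha.
  move: (h `^ alpha) (h^-1 `^ alpha) bF' => u v bF' u0 v0 uv.
  have bJJ : bmeas ((fun x => J x * J x) : borel_rV R n -> R) by exact: bmeas_mul.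
  rewrite -(Rint_scale Lfin u bF') -(Rint_scale Lfin v bJJ) -Rint_sub//; last exact: bmeas_scale.
  apply/andP; split; apply: le_Rint => //; try exact: bmeas_scale.
  + by apply: bmeas_sub => //; exact: bmeas_scale.
  + by move=> x; have /andP[] := onem_expRN_scaled u0 v0 (J0 x) uv.
  + by move=> x; have /andP[] := onem_expRN_scaled u0 v0 (J0 x) uv.
- move=> theta.
  have bs : bmeas (fun z => sin (dot theta (\row_i radial i z))).
    apply: bmeas_sin; have := measurable_dot mV theta 1.
    by under eq_fun do rewrite scale1r.
  (* [Rint_product] asks for a nonnegative integrand, hence the shift of the sine by 1. *)
  have b1 : bmeas (fun _ : borel_rV R n * T => 1 : R) by exact: bmeas_cst.
  have b1s : bmeas (fun z => 1 + sin (dot theta (\row_i radial i z))).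
    exact: bmeas_add.
  have [_ E1] := Rint_product L P b1 (fun=> ler01).
  have [|_ E2] := Rint_product L P b1s.
    by move=> z; have := sin_geN1 (dot theta (\row_i radial i z)); lra.
  suff : \int[(L \x P)%E]_z (1 + sin (dot theta (\row_i radial i z))) = \int[(L \x P)%E]_z 1.
    by rewrite Rint_add// => E; apply: (@addrI _ (\int[(L \x P)%E]_z 1)); rewrite addr0.
  rewrite E1 E2; apply: eq_Rintegral => x _.
  rewrite Rint_add//; last 2 first.
  + exact: bmeas_cst.
  + under eq_fun do rewrite row_radial/= dotZr mulrC.
    exact/bmeas_sin/measurable_scalel.
  under [X in _ + X]eq_Rintegral do rewrite row_radial/= dotZr mulrC.
  by rewrite (stable_sin hZ) addr0.
- pose C := n%:R * stable_const alpha.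
  have C0 : 0 <= C by rewrite mulr_ge0// ltW// stable_const_gt0.
  exists (\int[L]_x C + 1) => [|h h0].
    by rewrite ltr_wpDl// Rint_ge0.
  have bW := bmeas_vtrunc_sqr mV h^-1.
  have [bF ->] := Rint_product L P bW (fun z => vtrunc_sqr_ge0 _).
  rewrite -Rint_scale//.
  apply: (@le_trans _ _ (\int[L]_x C)); last by rewrite lerDl.
  apply: le_Rint => //; [exact: bmeas_scale|exact: bmeas_cst|move=> x].
  have bt : bmeas (fun w => trunc_sqr (h^-1 * Z w)) by exact/bmeas_trunc_sqr/measurable_scalel.
  apply: (@le_trans _ _ (h `^ alpha * \int[P]_w (\sum_(i < n) trunc_sqr (h^-1 * Z w)))).
    rewrite ler_wpM2l ?powR_ge0//; apply: le_Rint => //; last 2 first.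
    - exact: bmeas_sum.
    - move=> w; apply: ler_sum => i _; rewrite row_radial/= !mxE; apply: ler_trunc_sqr.
      by rewrite mulrA normrM ler_piMr// sphv_coord.
    apply: (bmeas_vtrunc_sqr (Y := fun i w => radial i (x, w))) => i.
    by under eq_fun do rewrite /radial/= mulrC; exact: measurable_scalel.
  rewrite Rint_sum// mulr_sumr /C -[n in n%:R](card_ord n) mulr_natl -sumr_const.
  by apply: ler_sum => i _; exact: stable_trunc_sqr_bound.
Qed.

End OneDimensional.

End TwoSystems.

(** * Tail asymptotics *)

Section TailAsymptotics.
Context (R : realType) d (T : measurableType d) (P : probability T R) (alpha : R).
Hypothesis halpha : 0 < alpha < 2.
Let alpha0 : 0 < alpha. Proof. by case/andP: halpha. Qed.

Definition utail (Z : T -> R) (h : R) : R := \int[P]_w (h < Z w)%R%:R.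
Definition stail (Z : T -> R) (h : R) : R := h `^ alpha * utail Z h.

Lemma bmeas_utail (Z : T -> R) h : measurable_fun setT Z -> bmeas (fun w => (h < Z w)%R%:R : R).
Proof. by move=> mZ; apply: bmeas_ltr => //; exact: measurable_cst. Qed.

Lemma utail_le (Z Z' : T -> R) (h h' : R) : measurable_fun setT Z -> measurable_fun setT Z' ->
  (forall w, h < Z w -> h' < Z' w) -> utail Z h <= utail Z' h'.
Proof.
move=> mZ mZ' H; apply: le_Rint; [exact: prob_fin|exact: bmeas_utail|exact: bmeas_utail|].
by move=> w; rewrite ler_nat; case: ltP => // /H ->.
Qed.

Section TwoVariables.
Implicit Types h M b : R.
Variables (Z Z' : T -> R).
Hypotheses (mZ : measurable_fun setT Z) (mZ' : measurable_fun setT Z').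
Hypotheses (hZ : std_sym_stable P alpha Z) (hZ' : std_sym_stable P alpha Z').

Lemma utail_eq h : 0 < h -> utail Z h = utail Z' h.
Proof.
move=> h0; apply: tail_unique => // t.
  by rewrite (stable_cos hZ) (stable_cos hZ').
by rewrite (stable_sin hZ) (stable_sin hZ').
Qed.

Lemma utail_opp h : 0 < h -> utail (fun w => - Z w) h = utail Z h.
Proof.
move=> h0; apply: tail_unique => // [|t|t].
- exact: measurable_funN.
- by apply: eq_Rintegral => w _; rewrite mulrN cosN.
- rewrite (stable_sin hZ); under eq_Rintegral do rewrite mulrN -mulNr.
  exact: stable_sin hZ _.
Qed.

Lemma utail_norm_le h : 0 < h -> utail (fun w => `|Z w|) h <= 2 * utail Z h.
Proof.
move=> h0; have fin := prob_fin P; rewrite mulr_natl mulr2n -{2}utail_opp//.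
have mN : measurable_fun setT (fun w => - Z w) by exact: measurable_funN.
rewrite -Rint_add; [|exact: fin|exact: bmeas_utail|exact: bmeas_utail].
apply: le_Rint => //; first exact/bmeas_utail/measurable_norm_comp.
  by apply: bmeas_add; exact: bmeas_utail.
move=> w; rewrite ltr_normr; case: (h < Z w); case: (h < - Z w) => /=; lra.
Qed.

(** The price of the region beyond [M * h], where bumps carry no information: uniform in [h] and
    small for large [M]. *)
Lemma scaled_tail_le M h : 0 < M -> 0 < h ->
  h `^ alpha * utail (fun w => `|Z w|) (M * h) <= M^-1 `^ alpha * stable_const alpha.
Proof.
move=> M0 h0; have Mh0 : 0 < M * h by rewrite mulr_gt0.
have := stable_tail_bound alpha0 mZ hZ Mh0.
move=> /(ler_wpM2l (powR_ge0 M^-1 alpha)); apply: le_trans.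
have E : M^-1 `^ alpha * (M * h) `^ alpha = h `^ alpha.
  by rewrite powRM ?ltW// mulrA [M^-1 `^ _ * _]mulrC powR_invM// mul1r.
by rewrite mulrA E.
Qed.

Lemma stail_le h : 0 < h -> stail Z h <= stable_const alpha.
Proof.
move=> h0; apply: le_trans (stable_tail_bound alpha0 mZ hZ h0).
rewrite ler_wpM2l ?powR_ge0//; apply: utail_le => //.
  exact: measurable_norm_comp.
by move=> w hw; rewrite (lt_le_trans hw)// ler_norm.
Qed.

Lemma stail_scale b h : 0 < b -> 0 < h ->
  h `^ alpha * utail Z (b * h) = b^-1 `^ alpha * stail Z (b * h).
Proof.
move=> b0 h0; rewrite /stail powRM ?ltW// !mulrA [b^-1 `^ _ * _]mulrC powR_invM//.
by rewrite mul1r.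
Qed.

End TwoVariables.

Lemma small_inv_power (K e m : R) : 0 <= K -> 0 < e ->
  exists2 M : R, m <= M & M^-1 `^ alpha * K <= e.
Proof.
move=> K0 e0; have : M^-1 `^ alpha * K @[M --> +oo] --> (0 : R).
  rewrite -[X in _ --> X](mul0r K); apply: cvgM; [exact: cvg_powR_inv|exact: cvg_cst].
move=> /cvgr0_norm_le/(_ _ e0)[A [_ AP]].
exists (Num.max m (A + 1)); first by rewrite le_max lexx.
apply: le_trans (ler_norm _) (AP _ _).
by rewrite lt_max ltrDl ltr01 orbT.
Qed.

Lemma near_pinfty_scale (Q : R -> Prop) (b : R) : 0 < b ->
  (\forall h \near +oo, Q h) -> \forall h \near +oo, Q (b * h).
Proof.
move=> b0 [A [_ AP]]; exists (A / b); split; first exact: num_real.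
by move=> h; rewrite ltr_pdivrMr// mulrC => /AP.
Qed.

Lemma cvg_pinfty_scale (f : R -> R) (b l : R) : 0 < b ->
  f h @[h --> +oo] --> l -> f (b * h) @[h --> +oo] --> l.
Proof.
move=> b0 fl; apply/cvgrPdist_le => e e0.
by move/cvgrPdist_le : fl => /(_ _ e0); exact: near_pinfty_scale.
Qed.

Section Limit.
Variables (n : nat) (X : 'I_n -> {RV P >-> R}).
Variable (L : {finite_measure set (borel_rV R n) -> \bar R}).
Hypotheses (hX : sym_stable P alpha X L) (hmarg : forall i, std_sym_stable P alpha (X i)).
Variable i0 : 'I_n.

Let Z : T -> R := X i0.
Let mZ : measurable_fun setT Z. Proof. by []. Qed.
Let hZ : std_sym_stable P alpha Z := hmarg i0.
Let fin := prob_fin P.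

(** A bump between 1 and [b] lies between the indicators of [Z > b h] and [Z > h], up to the tail
    beyond [M h], and its scaled integral converges. With [b ^ alpha] close to 1 the two resulting
    bounds on [stail] nearly meet. *)
Lemma stail_cvg : exists c : R, stail Z h @[h --> +oo] --> c.
Proof.
suff [c [hc _]] : exists c : R, stail Z h @[h --> +oo] --> c /\ stail Z h @[h --> +oo] --> c.
  by exists c.
apply: common_limit => e e0; pose C := stable_const alpha.
have C0 : 0 < C by exact: stable_const_gt0.
pose e2 := Num.min 1 (e / 8); have e20 : 0 < e2 by rewrite lt_min ltr01 divr_gt0.
pose dl := e / (4 * (C + 3)).
have dl0 : 0 < dl by rewrite divr_gt0// mulr_gt0// addr_gt0.
(* [b] is fixed through [b ^ alpha = 1 + dl], the factor by which a change of threshold alters the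
   normalization. *)
pose b := (1 + dl) `^ alpha^-1.
have ba : b `^ alpha = 1 + dl by rewrite -powRrM mulVf ?gt_eqF// powRr1; lra.
have b0 : 0 < b by rewrite powR_gt0; lra.
have b1 : 1 < b.
  rewrite ltNge; apply/negP => b1.
  have : b `^ alpha <= 1 `^ alpha by rewrite ge0_ler_powR ?nnegrE ?(ltW b0) ?(ltW alpha0).
  by rewrite ba powR1; lra.
have [M bM MC] := small_inv_power b (ltW C0) e20.
have M1 : 1 <= M by lra.
have M0 : 0 < M by lra.
pose f (y : 'rV[R]_n) := bump M 1 b (1 * y ord0 i0).
have af : vapprox f by apply: vapprox_bump => //; rewrite normr1.
have f0 : f 0 = 0 by rewrite /f mxE mulr0 bump_low ?normr0//; lra.
have sys := vector_system alpha0 hX hmarg.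
have [l [fl _]] := scaled_common_limit sys sys af.
have bf h : bmeas (fun w => f (h^-1 *: \row_i X i w)).
  exact: (bmeas_vapprox (system_meas sys)).
have fE h w : f (h^-1 *: \row_i X i w) = bump M 1 b (h^-1 * Z w).
  by rewrite /f !mxE mul1r.
have scE h : scaled alpha P (fun i => X i : T -> R) f h =
    h `^ alpha * \int[P]_w f (h^-1 *: \row_i X i w).
  by rewrite /scaled; under eq_Rintegral do rewrite f0 subr0.
have bN h : bmeas (fun w => (M * h < `|Z w|)%R%:R : R).
  exact/bmeas_utail/measurable_norm_comp.
have low h : 0 < h -> scaled alpha P (fun i => X i : T -> R) f h <= stail Z h + e2.
  move=> h0; have := scaled_tail_le mZ hZ M0 h0; rewrite scE -/C => tl.
  have : \int[P]_w f (h^-1 *: \row_i X i w) <= utail Z h + utail (fun w => `|Z w|) (M * h).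
    rewrite -Rint_add//; last exact: bmeas_utail.
    apply: le_Rint => //; first by apply: bmeas_add => //; exact: bmeas_utail.
    move=> w; rewrite fE; have /andP[p0 p1] := bump_01 (h^-1 * Z w) ltr01 b1 bM.
    have [ZM|ZM] := ltP (M * h) `|Z w|; first by case: (h < Z w) => /=; lra.
    have [hw|hw] := ltP h (Z w); rewrite /=; first by lra.
    have -> : bump M 1 b (h^-1 * Z w) = 0.
      apply: bump_low => //; last by rewrite mulrC ler_pdivrMr// mul1r.
      by rewrite normrM normfV (gtr0_norm h0) mulrC ler_pdivrMr.
    by rewrite addr0.
  by move=> /(ler_wpM2l (powR_ge0 h alpha)); rewrite mulrDr -/(stail Z h); lra.
have high h : 0 < h -> h `^ alpha * utail Z (b * h) <=
    scaled alpha P (fun i => X i : T -> R) f h + e2.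
  move=> h0; have := scaled_tail_le mZ hZ M0 h0; rewrite scE -/C => tl.
  have : utail Z (b * h) <= \int[P]_w f (h^-1 *: \row_i X i w) + utail (fun w => `|Z w|) (M * h).
    rewrite -Rint_add//.
    apply: le_Rint => //; [exact: bmeas_utail|exact: bmeas_add|].
    move=> w; rewrite fE; have /andP[p0 p1] := bump_01 (h^-1 * Z w) ltr01 b1 bM.
    have [ZM|ZM] := ltP (M * h) `|Z w|; first by case: (b * h < Z w) => /=; lra.
    have [hw|hw] := ltP (b * h) (Z w); rewrite /=; last by lra.
    have -> : bump M 1 b (h^-1 * Z w) = 1.
      apply: bump_high => //; last by rewrite mulrC ler_pdivlMr// ltW.
      by rewrite normrM normfV (gtr0_norm h0) mulrC ler_pdivrMr.
    by rewrite addr0.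
  by move=> /(ler_wpM2l (powR_ge0 h alpha)); rewrite mulrDr; lra.
have e21 : e2 <= 1 by rewrite ge_min lexx.
exists l; move/cvgrPdist_le : fl => /(_ _ e20) fl.
have binv : 0 < b^-1 by rewrite invr_gt0.
have fl' := near_pinfty_scale binv fl.
(* A bound on [l] that does not involve [dl], because the final error contains [dl * l]. *)
have lC : l <= C + 2.
  have [A [_ AP]] := fl; pose h := Num.max (A + 1) 1.
  have h0 : 0 < h by rewrite lt_max ltr01 orbT.
  have := AP h; rewrite lt_max ltrDl ltr01 => /(_ isT).
  rewrite ler_norml => /andP[_]; have := low _ h0; have := stail_le mZ hZ h0.
  by rewrite -/C; lra.
have e2e : e2 <= e / 8 by rewrite ge_min lexx orbT.
near=> h; have h0 : 0 < h by near: h; exact: nbhs_pinfty_gt.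
suff lh : `|stail Z h - l| <= e by split.
have l1 : `|l - scaled alpha P (fun i => X i : T -> R) f h| <= e2 by near: h; exact: fl.
have l2 : `|l - scaled alpha P (fun i => X i : T -> R) f (b^-1 * h)| <= e2 by near: h; exact: fl'.
have hb0 : 0 < b^-1 * h by rewrite mulr_gt0.
(* Applying [high] at [b^-1 * h] bounds the tail at [h] itself. *)
have := low _ h0; have := high _ hb0; rewrite mulrA divff ?gt_eqF// mul1r.
rewrite (powRM _ (ltW binv) (ltW h0)) => hi lo.
have hi' : stail Z h <= (1 + dl) * (l + 2 * e2).
  have : b^-1 `^ alpha * stail Z h <= l + 2 * e2.
    by move: hi l2; rewrite -mulrA -/(stail Z h) ler_norml => ? /andP[]; lra.
  move=> /(ler_wpM2l (powR_ge0 b alpha)); rewrite mulrA powR_invM// mul1r ba.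
  exact.
have dlC : dl * (C + 3) = e / 4 by rewrite /dl; field; rewrite gt_eqF// addr_gt0.
have : dl * (l + 2 * e2) <= dl * (C + 4).
  by rewrite ler_wpM2l ?(ltW dl0)//; lra.
have : dl * 1 <= e / 4 by rewrite -dlC ler_wpM2l ?(ltW dl0)//; lra.
move: l1; rewrite !ler_norml => /andP[? ?] ? ?; apply/andP; split; lra.
Unshelve. all: by end_near.
Qed.

(** [1 - cos (e Z / h)] is at most [e ^+ 2 / 2] times [trunc_sqr (Z / h)], plus 2 where [|Z| > h].
    After scaling, the left side tends to [e ^ alpha] and the first term stays below
    [e ^+ 2 * C / 2]. Since [alpha < 2], one can solve [e ^+ 2 * C = e ^ alpha]; the first term is
    then at most half of the limit, and the tail carries the rest. *)
Lemma stail_limit_gt0 c : stail Z h @[h --> +oo] --> c -> 0 < c.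
Proof.
move=> cc; pose C := stable_const alpha.
have C0 : 0 < C by exact: stable_const_gt0.
have a2 : 0 < 2 - alpha by case/andP: halpha => _; rewrite subr_gt0.
pose e := C^-1 `^ (2 - alpha)^-1.
have e0 : 0 < e by rewrite powR_gt0// invr_gt0.
have ea0 : 0 < e `^ alpha by exact: powR_gt0.
have eC : e ^+ 2 * C = e `^ alpha.
  rewrite -powR_mulrn ?(ltW e0)// -(subrK alpha 2%:R) powRD ?(gt_eqF e0) ?implybT//.
  rewrite -powRrM mulVf ?gt_eqF// powRr1 ?invr_ge0 ?(ltW C0)//.
  by rewrite mulrAC mulVf ?mul1r// gt_eqF.
have lim : h `^ alpha * (1 - expR (- (h^-1 `^ alpha * e `^ alpha))) @[h --> +oo] --> e `^ alpha.
  apply: (@cvg_inv_power_error _ alpha _ (e `^ alpha * e `^ alpha)) => // h h0.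
  by apply: onem_expRN_scaled; rewrite ?powR_ge0// powR_invM.
have bound h : 0 < h -> h `^ alpha * (1 - expR (- (h^-1 `^ alpha * e `^ alpha))) <=
    e `^ alpha / 2 + 4 * stail Z h.
  move=> h0.
  have -> : 1 - expR (- (h^-1 `^ alpha * e `^ alpha)) = \int[P]_w (1 - cos (e * h^-1 * Z w)).
    have hi0 : 0 < h^-1 by rewrite invr_gt0.
    rewrite (stable_onem_cos mZ hZ) (gtr0_norm (mulr_gt0 e0 hi0)).
    by rewrite (powRM _ (ltW e0) (ltW hi0)) [h^-1 `^ _ * _]mulrC.
  have bt : bmeas (fun w => trunc_sqr (h^-1 * Z w)).
    exact/bmeas_trunc_sqr/measurable_scalel.
  have bn : bmeas (fun w => (h < `|Z w|)%R%:R : R) by exact/bmeas_utail/measurable_norm_comp.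
  have : \int[P]_w (1 - cos (e * h^-1 * Z w)) <=
      e ^+ 2 / 2 * \int[P]_w trunc_sqr (h^-1 * Z w) + 2 * utail (fun w => `|Z w|) h.
    rewrite -!Rint_scale// -Rint_add//; try exact: bmeas_scale.
    apply: le_Rint => //.
    - by apply: bmeas_sub; [exact: bmeas_cst|exact/bmeas_cos/measurable_scalel].
    - by apply: bmeas_add; exact: bmeas_scale.
    move=> w; have := trunc_sqr_ge0 (h^-1 * Z w).
    have e20 : 0 <= e ^+ 2 / 2 by rewrite divr_ge0// sqr_ge0.
    have [hw t0|hw _] := ltP h `|Z w|.
      have := mulr_ge0 e20 t0; have := cos_geN1 (e * h^-1 * Z w); rewrite /=; lra.
    rewrite mulr0 addr0 (le_trans (onem_cos_le _))// /trunc_sqr min_r; last first.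
      rewrite -(real_normK (num_real _)) -[leRHS](expr1n _ 2) ler_sqr ?nnegrE//.
      by rewrite normrM normfV (gtr0_norm h0) mulrC ler_pdivrMr// mul1r.
    by rewrite -mulrA exprMn; lra.
  move=> /(ler_wpM2l (powR_ge0 h alpha)) h1.
  have h2 := stable_trunc_sqr_bound alpha0 mZ hZ h0.
  have h3 := ler_wpM2l (powR_ge0 h alpha) (utail_norm_le mZ hZ h0).
  have h4 : e ^+ 2 / 2 * (h `^ alpha * \int[P]_w trunc_sqr (h^-1 * Z w)) <= e `^ alpha / 2.
    have -> : e `^ alpha / 2 = e ^+ 2 / 2 * C by rewrite -eC mulrAC.
    by rewrite ler_wpM2l// divr_ge0// sqr_ge0.
  move: h1 h3 h4; rewrite /stail; lra.
have : e `^ alpha <= e `^ alpha / 2 + 4 * c.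
  have lim' : e `^ alpha / 2 + 4 * stail Z h @[h --> +oo] --> e `^ alpha / 2 + 4 * c.
    by apply: cvgD; [exact: cvg_cst|apply: cvgM => //; exact: cvg_cst].
  apply: ler_cvg_to lim lim' _.
  by near=> h; apply: bound; near: h; exact: nbhs_pinfty_gt.
lra.
Unshelve. all: by end_near.
Qed.

End Limit.

End TailAsymptotics.

(** * The second largest coordinate *)

Section SecondLargest.
Variables (R : realType) (n : nat).
Implicit Types (x : 'rV[R]_n) (t : R).

Definition two_exceed t (v : 'I_n -> R) : bool :=
  [exists i, [exists j, [&& i != j, t < v i & t < v j]]].

(** Sorting preserves the number of entries above [t]; in a nonincreasing list this number exceeds 1
    exactly when the second entry is above [t]. *)
Lemma second_largest_gt t x : (1 < n)%N ->
  (t < second_largest x) = two_exceed t (x ord0).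
Proof.
move=> n1; rewrite /second_largest; set s := [seq x ord0 i | i <- enum 'I_n].
have tot : total (>=%R : rel R) by move=> a b; exact: le_total.
have cntE : count (> t) (sort >=%R s) = #|[pred i | t < x ord0 i]|.
  by rewrite count_sort /s count_map cardE -size_filter enumT; congr size; apply: eq_filter.
have -> : two_exceed t (x ord0) = (1 < count (> t) (sort >=%R s))%N.
  rewrite cntE; apply/existsP/card_gt1P => [[i /existsP[j /and3P[ij ti tj]]]|[i [j [ti tj ij]]]].
    by exists i, j.
  by exists i; apply/existsP; exists j; rewrite ij; move: ti tj; rewrite !inE => -> ->.
have : (1 < size (sort >=%R s))%N by rewrite size_sort /s size_map size_enum_ord.
have := sort_sorted tot s; case: (sort _ s) => [|a [|b r]]//= /andP[ba pr] _.
have [tb|bt] := ltP t b.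
  by rewrite (lt_le_trans tb ba)/=.
have -> : count (> t) r = 0%N.
  have trans : transitive (>=%R : rel R) by move=> u v w uv vw; exact: le_trans vw uv.
  apply/eqP; rewrite -leqn0 leqNgt -has_count; apply/hasPn => u ur.
  rewrite -leNgt; apply: le_trans bt.
  by have := order_path_min trans pr; move/allP => /(_ u ur).
by case: (t < a).
Qed.

Definition pos_second x := Num.max (second_largest x) 0.

Lemma pos_second_ge0 x : 0 <= pos_second x.
Proof. by rewrite le_max lexx orbT. Qed.

Lemma pos_second_gt t x : (1 < n)%N -> 0 <= t -> (t < pos_second x) = two_exceed t (x ord0).
Proof.
by move=> n1 t0; rewrite lt_max second_largest_gt// [t < 0]ltNge t0/= orbF.
Qed.

Lemma pos_second0 : (1 < n)%N -> pos_second 0 = 0.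
Proof.
move=> n1; apply/eqP; rewrite eq_le pos_second_ge0 andbT leNgt pos_second_gt//.
by apply/existsP => -[i /existsP[j /and3P[_]]]; rewrite mxE ltxx.
Qed.

Lemma pos_second_sphv_le1 x : (1 < n)%N -> pos_second (sphv x) <= 1.
Proof.
move=> n1; rewrite leNgt pos_second_gt//; apply/existsP => -[i /existsP[j /and3P[_]]].
by rewrite ltNge (le_trans (ler_norm _) (sphv_coord _ _)).
Qed.

Lemma sphvN x : sphv (- x) = - sphv x.
Proof.
have S : (- x \in usphere) = (x \in usphere).
  have E : usphere (- x) = usphere x.
    rewrite /usphere /=; apply/propext; split => <-;
      by apply: eq_bigr => i _; rewrite mxE sqrrN.
  by apply/idP/idP => /set_mem; rewrite ?E => h; apply/mem_set; rewrite ?E.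
by rewrite /sphv S; case: ifP => // _; rewrite oppr0.
Qed.

(** Preimages of rays are the sets where two coordinates exceed [t], a finite combination of
    measurable conditions. *)
Lemma bmeas_pos_second (a : R) : (1 < n)%N -> 0 <= a ->
  bmeas ((fun x => pos_second (sphv x) `^ a) : borel_rV R n -> R).
Proof.
move=> n1 a0; split; last first.
  exists 1 => x; rewrite ger0_norm ?powR_ge0//.
  have pow1 : 1 `^ a = 1 :> R by rewrite powR1.
  by rewrite -[leRHS]pow1 ge0_ler_powR ?nnegrE ?pos_second_ge0 ?pos_second_sphv_le1.
apply: (measurableT_comp (measurable_powR a)).
apply: measurable_maxr; last exact: measurable_cst.
apply: (measurability _ (RGenOInfty.measurableE R)) => //.
move=> _ [_ [t ->] <-].
have mb : measurable_fun setT ((fun x => two_exceed t (sphv x ord0)) : borel_rV R n -> bool).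
  apply: measurable_exists => i; apply: measurable_exists => j.
  apply: measurable_and; first exact: measurable_cst.
  by apply: measurable_and; apply: measurable_fun_ltr => //; exact: measurable_sphv.
have := mb measurableT [set true] (I : measurable [set true]).
congr measurable; rewrite !setTI; apply/seteqP; split => x /=.
  by rewrite in_itv/= andbT second_largest_gt.
by rewrite in_itv/= andbT second_largest_gt.
Qed.

End SecondLargest.

Section SymmetricSpectral.
Variables (R : realType) (n : nat).

Definition opp_rV : borel_rV R n -> borel_rV R n := fun x => - (x : 'rV[R]_n).

Lemma measurable_opp_rV : measurable_fun setT opp_rV.
Proof.
apply: (@measurability _ _ _ _ setT opp_rV (@open 'rV[R]_n)) => //.
move=> _ [U oU <-]; rewrite setTI; apply: sub_sigma_algebra.
by apply: open_comp => // x _; exact: oppr_continuous.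
Qed.

Variable L : {finite_measure set (borel_rV R n) -> \bar R}.
Hypothesis Lsym : forall A : set (borel_rV R n), measurable A ->
  L ((fun x : 'rV[R]_n => - x) @^-1` A) = L A.

Lemma Rint_spectral_opp (F : borel_rV R n -> R) : measurable_fun setT F ->
  (forall x, 0 <= F x) -> \int[L]_x F (- (x : 'rV[R]_n)) = \int[L]_x F x.
Proof.
move=> mF F0; rewrite /Rintegral; congr fine.
have mneg := measurable_opp_rV.
have := @ge0_integral_pushforward _ _ _ _ R opp_rV mneg L setT (EFin \o F) measurableT.
rewrite preimage_setT => <-//; last 2 first.
- exact/measurable_EFinP.
- by move=> x _; rewrite lee_fin.
by apply: eq_measure_integral => A mA _; exact: Lsym.
Qed.

End SymmetricSpectral.

(** * Upper bound for two coordinates above the threshold *)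

Section Asymptotics.
Context (R : realType) d (T : measurableType d) (P : probability T R) (alpha : R).
Variables (n : nat) (X : 'I_n -> {RV P >-> R}).
Variable (L : {finite_measure set (borel_rV R n) -> \bar R}).
Hypothesis halpha : 0 < alpha < 2.
Hypothesis n1 : (1 < n)%N.
Hypotheses (hX : sym_stable P alpha X L) (hmarg : forall i, std_sym_stable P alpha (X i)).
Variables (i0 : 'I_n) (c : R).

Let alpha0 : 0 < alpha. Proof. by case/andP: halpha. Qed.
Let Z : T -> R := X i0.
Let mZ : measurable_fun setT Z. Proof. by []. Qed.
Let hZ : std_sym_stable P alpha Z := hmarg i0.
Let fin := prob_fin P.
Let Lfin := finite_measure_lty L.
Let C := stable_const alpha.
Let C0 : 0 < C. Proof. exact: stable_const_gt0. Qed.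
Let V := @radial R d T n Z.
Let sysX := vector_system alpha0 hX hmarg.
Let sysV := radial_system L alpha0 mZ hZ.
Let mass := fine (L setT).

Hypothesis cc : stail P alpha Z h @[h --> +oo] --> c.

Let c0 : 0 < c. Proof. exact: stail_limit_gt0 cc. Qed.

Let mass0 : 0 <= mass. Proof. exact: fine_ge0. Qed.

Lemma scaled_diff_small f (e : R) : vapprox f -> 0 < e -> \forall h \near +oo,
  `|scaled alpha P (fun i => X i : T -> R) f h - scaled alpha (L \x P)%E V f h| <= e.
Proof.
move=> af e0; have [l [l1 l2]] := scaled_common_limit sysX sysV af.
have : scaled alpha P (fun i => X i : T -> R) f h - scaled alpha (L \x P)%E V f h
    @[h --> +oo] --> l - l by exact: cvgB.
by rewrite subrr => /cvgr0_norm_le; exact.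
Qed.

Lemma marginal_tail_le M h i : 0 < M -> 0 < h ->
  h `^ alpha * \int[P]_w (M * h < `|X i w|)%R%:R <= M^-1 `^ alpha * C.
Proof.
have mX : measurable_fun setT (X i : T -> R) by [].
by move=> M0 h0; exact: (scaled_tail_le halpha mX (hmarg i) M0 h0).
Qed.

Lemma radial_norm_le i z : `|V i z| <= `|Z z.2|.
Proof. by rewrite /V /radial normrM ler_piMr// sphv_coord. Qed.

Lemma bmeas_radial_tail u i : bmeas (fun z => (u < `|V i z|)%R%:R : R).
Proof.
apply: bmeas_ltr; first exact: measurable_cst.
by apply: measurable_norm_comp; exact: measurable_radial.
Qed.

Lemma radial_tail_le M h i : 0 < M -> 0 < h ->
  h `^ alpha * \int[(L \x P)%E]_z (M * h < `|V i z|)%R%:R <= mass * (M^-1 `^ alpha * C).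
Proof.
move=> M0 h0; have bV := bmeas_radial_tail (M * h) i.
have [bF ->] := Rint_product L P bV (fun z => ler0n _ _).
have tl := scaled_tail_le halpha mZ hZ M0 h0.
apply: (@le_trans _ _ (h `^ alpha * \int[L]_x utail P (fun w => `|Z w|) (M * h))).
  apply: ler_wpM2l; first exact: powR_ge0.
  apply: (le_Rint Lfin bF); first exact: bmeas_cst.
  move=> x; apply: (le_Rint fin).
  - apply: bmeas_ltr; first exact: measurable_cst.
    apply: measurable_norm_comp; rewrite /V /radial/=.
    by under eq_fun do rewrite mulrC; exact: measurable_scalel.
  - exact/bmeas_utail/measurable_norm_comp.
  - move=> w; rewrite ler_nat; have := radial_norm_le i (x, w) => /= le.
    by case: ltP => // /lt_le_trans/(_ le) ->.
by rewrite Rintegral_cst// mulrA mulrC ler_wpM2l.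
Qed.

(** For [m > 0], [Y m > h] means [Y > h / m], and [h / m] is at least [h] because [m <= 1]. One
    bound on [stail] beyond [h0] thus serves all [m], which makes the estimate uniform in the
    direction. *)
Lemma cone_tail_le (Y : T -> R) (K h0 m h : R) :
    (forall u, h0 < u -> stail P alpha Y u <= K) -> 0 <= K -> 0 < h0 ->
    0 <= m <= 1 -> h0 < h ->
  h `^ alpha * \int[P]_w (h < Y w * m)%R%:R <= m `^ alpha * K.
Proof.
move=> YK K0 h00 /andP[m0 m1] hh; have hpos : 0 < h by exact: lt_trans hh.
have [->|mn0] := eqVneq m 0.
  under eq_Rintegral do rewrite mulr0 ltNge (ltW hpos)/=.
  by rewrite Rint_prob_cst mulr0 mulr_ge0 ?powR_ge0.
have mp : 0 < m by rewrite lt_neqAle eq_sym mn0.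
have -> : \int[P]_w (h < Y w * m)%R%:R = utail P Y (m^-1 * h).
  by apply: eq_Rintegral => w _; rewrite -ltr_pdivrMr// mulrC.
rewrite stail_scale ?invr_gt0// invrK ler_wpM2l ?powR_ge0// YK//.
by rewrite (lt_le_trans hh)// ler_peMl ?(ltW hpos)// invf_ge1.
Qed.

(** A negative [Z] brings in the second largest coordinate of the opposite direction; hence the
    factor 2 in the hypothesis on [L]. *)
Lemma two_exceed_radial (h : R) x w : 0 < h -> two_exceed h (V ^~ (x, w)) ->
  h < Z w * pos_second (sphv x) \/ h < - Z w * pos_second (- sphv x).
Proof.
move=> h0 /existsP[i /existsP[j /and3P[ij]]]; rewrite /V /radial/= => hi hj.
have [Zp|Zn|Z0] := ltgtP 0 (Z w); last by move: hi; rewrite -Z0 mul0r ltNge ltW.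
- left; rewrite -ltr_pdivrMl// pos_second_gt//; last by rewrite mulr_ge0 ?invr_ge0 ?ltW.
  by apply/existsP; exists i; apply/existsP; exists j; rewrite ij !ltr_pdivrMl// hi hj.
- have Zn' : 0 < - Z w by rewrite oppr_gt0.
  right; rewrite -ltr_pdivrMl// pos_second_gt//; last by rewrite mulr_ge0 ?invr_ge0 ?ltW.
  apply/existsP; exists i; apply/existsP; exists j.
  by rewrite ij !ltr_pdivrMl// !mxE !mulrNN hi hj.
Qed.

Lemma bmeas_two_exceed d' (T' : measurableType d') (Y : 'I_n -> T' -> R) h :
  (forall i, measurable_fun setT (Y i)) ->
  bmeas (fun w => (two_exceed h (Y ^~ w))%:R : R).
Proof.
move=> mY; apply: bmeas_bool; apply: measurable_exists => i; apply: measurable_exists => j.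
apply: measurable_and; first exact: measurable_cst.
by apply: measurable_and; apply: measurable_fun_ltr => //; exact: measurable_cst.
Qed.

Let J := \int[L]_x pos_second (sphv x) `^ alpha.

(** [Z] and [- Z] have the same tail, and by symmetry of [L] both signs integrate to the same
    [J]. *)
Lemma radial_two_exceed_upper e : 0 < e -> \forall h \near +oo,
  h `^ alpha * \int[(L \x P)%E]_z (two_exceed h (V ^~ z))%:R <= (c + e) * (2 * J).
Proof.
move=> e0; have [A [_ AP]] : \forall u \near +oo, stail P alpha Z u <= c + e.
  by move/cvgr_le : cc => /(_ (c + e)); apply; rewrite ltrDl.
pose h0 := Num.max A 1; have h00 : 0 < h0 by rewrite lt_max ltr01 orbT.
have h0P u : h0 < u -> stail P alpha Z u <= c + e.
  by move=> hu; apply: AP; rewrite (le_lt_trans _ hu)// le_max lexx.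
have h0P' u : h0 < u -> stail P alpha (fun w => - Z w) u <= c + e.
  by move=> hu; rewrite /stail (utail_opp mZ hZ) ?(lt_trans h00)//; exact: h0P.
exists h0; split=> [|h hh]; first exact: num_real.
have hp : 0 < h by exact: lt_trans hh.
have mV := system_meas sysV.
have bt := bmeas_two_exceed h mV.
have [bF ->] := Rint_product L P bt (fun z => ler0n _ _).
have bm := bmeas_pos_second n1 (ltW alpha0) : bmeas ((fun x => _) : borel_rV R n -> R).
have bm' : bmeas ((fun x => pos_second (sphv (- (x : 'rV[R]_n))) `^ alpha) : borel_rV R n -> R).
  have [mm [B mB]] := bm; split; last by exists B => x; exact: mB.
  exact: (measurableT_comp mm (@measurable_opp_rV R n)).
have Lsym := hX.1.2.
have JE : J = \int[L]_x pos_second (sphv (- (x : 'rV[R]_n))) `^ alpha.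
  rewrite (Rint_spectral_opp Lsym (F := fun x => pos_second (sphv x) `^ alpha))//.
    by case: bm.
  by move=> x; exact: powR_ge0.
have bmm := bmeas_add bm bm'.
have -> : 2 * J = \int[L]_x (pos_second (sphv x) `^ alpha +
    pos_second (sphv (- (x : 'rV[R]_n))) `^ alpha).
  rewrite (Rint_add Lfin bm bm') -JE.
  have E2 (z : R) : 2 * z = z + z by ring.
  exact: E2.
rewrite -(Rint_scale Lfin _ bF) -(Rint_scale Lfin _ bmm).
apply: (le_Rint Lfin (bmeas_scale _ bF) (bmeas_scale _ bmm)).
move=> x; have ce : 0 <= c + e by rewrite addr_ge0 ?ltW.
have m1 : 0 <= pos_second (sphv x) <= 1 by rewrite pos_second_ge0 pos_second_sphv_le1.
have m2 : 0 <= pos_second (sphv (- x)) <= 1 by rewrite pos_second_ge0 pos_second_sphv_le1.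
have t1 := cone_tail_le h0P ce h00 m1 hh.
have t2 := cone_tail_le h0P' ce h00 m2 hh.
have b1 (Y : T -> R) m : measurable_fun setT Y -> bmeas (fun w => (h < Y w * m)%R%:R : R).
  move=> mY; apply: bmeas_ltr; first exact: measurable_cst.
  by under eq_fun do rewrite mulrC; exact: measurable_scalel.
have mN : measurable_fun setT (fun w => - Z w) by exact: measurable_funN.
apply: (@le_trans _ _ (h `^ alpha * (\int[P]_w (h < Z w * pos_second (sphv x))%R%:R +
    \int[P]_w (h < - Z w * pos_second (sphv (- x)))%R%:R))); last first.
  rewrite mulrDr [leRHS]mulrDr; apply: lerD; rewrite [leRHS]mulrC; [exact: t1|exact: t2].
apply: ler_wpM2l; first exact: powR_ge0.
rewrite -(Rint_add fin (b1 _ _ mZ) (b1 _ _ mN)); apply: (le_Rint fin).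
- apply: bmeas_two_exceed => i; rewrite /V /radial/=.
  by under eq_fun do rewrite mulrC; exact: measurable_scalel.
- by apply: bmeas_add; exact: b1.
- move=> w; case: (boolP (two_exceed _ _)) => [/(two_exceed_radial hp)|_]; last first.
    by rewrite addr_ge0.
  by rewrite sphvN => -[->|->] /=; rewrite ?lerDl ?lerDr.
Qed.

Lemma sum_le_natl (F : 'I_n -> R) K : (forall i, F i <= K) -> \sum_i F i <= n%:R * K.
Proof.
move=> FK; rewrite -[n in n%:R](card_ord n) mulr_natl -sumr_const.
by apply: ler_sum => i _; exact: FK.
Qed.

(** The probability that at least two of [n] independent events occur, their probabilities being the
    bumps. A polynomial in bumps, it is approximable, and it stays in [[0, 1]]. *)
Definition two_bump M b (y : 'rV[R]_n) : R := \sum_(S : {set 'I_n} | (1 < #|S|)%N)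
  \prod_i (if i \in S then bump M 1 b (1 * y ord0 i) else 1 - bump M 1 b (1 * y ord0 i)).

Lemma vapprox_two_bump M b : 1 < b -> b <= M -> vapprox (two_bump M b).
Proof.
move=> b1 bM; have M1 : 1 <= M by lra.
have W0 := @vtrunc_sqr_ge0 R n; have WB := @vtrunc_sqr_le R n; have dD := @dotDl R n.
apply: trig_approx_sum => // S; apply: (trig_approx_prod dD W0 WB) => i.
have ab : vapprox (fun y : 'rV[R]_n => bump M 1 b (1 * y ord0 i)).
  by apply: vapprox_bump => //; rewrite normr1.
case: (i \in S) => //.
by apply: trig_approx_sub => //; exact: trig_approx_cst.
Qed.

Section TwoBump.
Variables (M b : R).
Hypotheses (b1 : 1 < b) (bM : b <= M).
Let p (y : 'rV[R]_n) i := bump M 1 b (1 * y ord0 i).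
Let p01 y i : 0 <= p y i <= 1. Proof. exact: bump_01. Qed.

Let term_ge0 y (S : {set 'I_n}) : 0 <= \prod_i (if i \in S then p y i else 1 - p y i).
Proof.
by apply: prodr_ge0 => i _; have /andP[? ?] := p01 y i; case: ifP => // _; rewrite subr_ge0.
Qed.

Let term_tot y : \sum_(S : {set 'I_n}) \prod_i (if i \in S then p y i else 1 - p y i) = 1.
Proof. by rewrite -bigA_distr big1// => i _ /=; rewrite subrKC. Qed.

Lemma two_bump_01 y : 0 <= two_bump M b y <= 1.
Proof.
apply/andP; split; first by apply: sumr_ge0 => S _; exact: term_ge0.
rewrite -(term_tot y) [leRHS](bigID (fun S : {set 'I_n} => (1 < #|S|)%N))/=.
by rewrite lerDl; apply: sumr_ge0 => S _; exact: term_ge0.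
Qed.

Lemma two_bump_low (y : 'rV[R]_n) : ~~ two_exceed 1 (y ord0) -> (forall i, `|y ord0 i| <= M) ->
  two_bump M b y = 0.
Proof.
move=> two yM; apply: big1 => S /card_gt1P[i [j [iS jS ij]]].
have [k kS yk] : exists2 k, k \in S & y ord0 k <= 1.
  have [yi|yi] := leP (y ord0 i) 1; first by exists i.
  exists j => //; rewrite leNgt; apply: contra two => yj.
  by apply/existsP; exists i; apply/existsP; exists j; rewrite ij yi yj.
by rewrite (bigD1 k)//= kS bump_low ?mul0r// mul1r.
Qed.

Lemma two_bump_high (y : 'rV[R]_n) : two_exceed b (y ord0) -> (forall i, `|y ord0 i| <= M) ->
  two_bump M b y = 1.
Proof.
move=> /existsP[i /existsP[j /and3P[ij yi yj]]] yM.
rewrite -[RHS](term_tot y) [RHS](bigID (fun S : {set 'I_n} => (1 < #|S|)%N))/=.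
rewrite [X in _ = _ + X]big1 ?addr0// => S S1.
(* One of the two large coordinates lies outside [S], and its factor vanishes. *)
have [k kS yk] : exists2 k, k \notin S & b <= y ord0 k.
  have [iS|iS] := boolP (i \in S); last by exists i => //; exact: ltW.
  exists j; last exact: ltW.
  by apply: contra S1 => jS; apply/card_gt1P; exists i, j.
by rewrite (bigD1 k)//= (negPf kS) /p bump_high ?subrr ?mul0r// mul1r.
Qed.

Lemma two_bump0 : two_bump M b 0 = 0.
Proof.
apply: two_bump_low => [|i]; last by rewrite mxE normr0 (le_trans ler01)// (le_trans (ltW b1)).
by apply/existsP => -[i /existsP[j /and3P[_]]]; rewrite mxE ltNge ler01.
Qed.

End TwoBump.

Lemma two_exceed_scale (h u : R) (v : 'I_n -> R) : 0 < h ->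
  two_exceed u ((h^-1 *: \row_i v i) ord0) = two_exceed (u * h) v.
Proof.
move=> h0; apply: eq_existsb => i; apply: eq_existsb => j.
by rewrite !mxE ![h^-1 * _]mulrC !ltr_pdivlMr.
Qed.

Lemma scaled_le_high (h M : R) (v : 'I_n -> R) : 0 < h ->
  ~~ [exists i, M * h < `|v i|] -> forall i, `|(h^-1 *: \row_i v i) ord0 i| <= M.
Proof.
move=> h0; rewrite negb_exists => /forallP vM i; have := vM i.
rewrite -leNgt => le; by rewrite !mxE normrM normfV (gtr0_norm h0) mulrC ler_pdivrMr.
Qed.

Lemma exists_le_sum (q : 'I_n -> bool) : [exists i, q i] -> 1 <= \sum_i (q i)%:R :> R.
Proof. by case/existsP => i qi; rewrite (bigD1 i)//= qi lerDl sumr_ge0. Qed.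

(** [two_bump] carries the radial estimate over to [X]. It compares the thresholds [h] and [b * h],
    at the cost of the factor [b ^ alpha = 1 + dl]. *)
Lemma two_exceed_upper e : 0 < e -> \forall h \near +oo,
  h `^ alpha * \int[P]_w (two_exceed h (fun i => X i w))%:R <= 2 * J * c + e.
Proof.
move=> e0; have J0 : 0 <= J by apply: Rint_ge0 => x; exact: powR_ge0.
have cJ : 0 <= 2 * J * c by rewrite !mulr_ge0// ltW.
(* A budget of [e / 8] each for the excess over [c], the comparison of the two systems and the tails
   beyond [M], within [e / 2] in total. *)
pose e1 := e / (8 * (2 * J + 1)).
have e10 : 0 < e1 by rewrite divr_gt0// mulr_gt0// ltr_wpDl// mulr_ge0.
have e1J : e1 * (2 * J) <= e / 8.
  have aux (j : R) : 0 <= j -> e / (8 * (2 * j + 1)) * (2 * j) <= e / 8.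
    move=> j0; have j1 : 0 < 2 * j + 1 by rewrite ltr_wpDl// mulr_ge0.
    have E : e / (8 * (2 * j + 1)) * (2 * j + 1) = e / 8 by field; rewrite gt_eqF.
    rewrite -E ler_wpM2l ?lerDl// divr_ge0 ?(ltW e0)// mulr_ge0// ltW//.
  exact: aux.
(* The solution of [(1 + dl) * (2 * J * c + e / 2) = 2 * J * c + e]. *)
pose dl := (e / 2) / (2 * J * c + e / 2).
have den0 : 0 < 2 * J * c + e / 2 by rewrite ltr_wpDl// divr_gt0.
have dl0 : 0 < dl by rewrite divr_gt0// divr_gt0.
pose b := (1 + dl) `^ alpha^-1.
have ba : b `^ alpha = 1 + dl by rewrite -powRrM mulVf ?gt_eqF// powRr1; lra.
have b0 : 0 < b by rewrite powR_gt0; lra.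
have b1 : 1 < b.
  rewrite ltNge; apply/negP => b1.
  have : b `^ alpha <= 1 `^ alpha by rewrite ge0_ler_powR ?nnegrE ?(ltW b0) ?(ltW alpha0).
  by rewrite ba powR1; lra.
have e8 : 0 < e / 8 by rewrite divr_gt0.
have nK0 : 0 <= (n%:R + n%:R * mass) * C.
  by apply: mulr_ge0 (ltW C0); apply: addr_ge0 => //; exact: mulr_ge0.
have [M bM MC] := small_inv_power halpha b nK0 e8.
have M0 : 0 < M by lra.
have af := vapprox_two_bump b1 bM.
have f0 := two_bump0 b1 bM.
have scX h : scaled alpha P (fun i => X i : T -> R) (two_bump M b) h =
    h `^ alpha * \int[P]_w two_bump M b (h^-1 *: \row_i X i w).
  by rewrite /scaled; under eq_Rintegral do rewrite f0 subr0.
have scV h : scaled alpha (L \x P)%E V (two_bump M b) h =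
    h `^ alpha * \int[(L \x P)%E]_z two_bump M b (h^-1 *: \row_i V i z).
  by rewrite /scaled; under eq_Rintegral do rewrite f0 subr0.
have sysfV := system_fin sysV.
have mX i : measurable_fun setT (X i : T -> R) by [].
have bfX h : bmeas (fun w => two_bump M b (h^-1 *: \row_i X i w)).
  exact: (bmeas_vapprox mX).
have bfV h : bmeas (fun z => two_bump M b (h^-1 *: \row_i V i z)).
  exact: (bmeas_vapprox (system_meas sysV)).
have bX h i : bmeas (fun w => (M * h < `|X i w|)%R%:R : R).
  by apply: bmeas_ltr; [exact: measurable_cst|exact: measurable_norm_comp].
have bV h := bmeas_radial_tail (M * h).
have stepX h : 0 < h -> h `^ alpha * \int[P]_w (two_exceed (b * h) (fun i => X i w))%:R <=
    scaled alpha P (fun i => X i : T -> R) (two_bump M b) h + n%:R * (M^-1 `^ alpha * C).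
  move=> h0; rewrite scX.
  have bsum : bmeas (fun w => \sum_i (M * h < `|X i w|)%R%:R : R) by exact: bmeas_sum.
  have : \int[P]_w (two_exceed (b * h) (fun i => X i w))%:R <=
      \int[P]_w (two_bump M b (h^-1 *: \row_i X i w) + \sum_i (M * h < `|X i w|)%R%:R).
    apply: le_Rint => //; [exact: bmeas_two_exceed|exact: bmeas_add|move=> w].
    have /andP[p0 p1] := two_bump_01 b1 bM (h^-1 *: \row_i X i w).
    have [ex|nex] := boolP [exists i, M * h < `|X i w|].
      by apply: le_trans (lerD p0 (exists_le_sum ex)); rewrite add0r; case: two_exceed.
    have s0 : 0 <= \sum_i (M * h < `|X i w|)%R%:R :> R by exact: sumr_ge0.
    case: (boolP (two_exceed _ _)) => [two|_] /=; last by rewrite addr_ge0.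
    rewrite two_bump_high// ?lerDl// ?two_exceed_scale//.
    exact: (scaled_le_high h0 nex).
  move=> /(ler_wpM2l (powR_ge0 h alpha)) /le_trans; apply.
  rewrite Rint_add// mulrDr lerD2l Rint_sum// mulr_sumr.
  by apply: sum_le_natl => i; exact: marginal_tail_le.
have stepV h : 0 < h -> scaled alpha (L \x P)%E V (two_bump M b) h <=
    h `^ alpha * \int[(L \x P)%E]_z (two_exceed h (V ^~ z))%:R +
    n%:R * (mass * (M^-1 `^ alpha * C)).
  move=> h0; rewrite scV.
  have bsum : bmeas (fun z => \sum_i (M * h < `|V i z|)%R%:R : R) by exact: bmeas_sum.
  have bt := bmeas_two_exceed h (system_meas sysV).
  have : \int[(L \x P)%E]_z two_bump M b (h^-1 *: \row_i V i z) <=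
      \int[(L \x P)%E]_z ((two_exceed h (V ^~ z))%:R + \sum_i (M * h < `|V i z|)%R%:R).
    apply: le_Rint => //; [exact: bmeas_add|move=> z].
    have /andP[p0 p1] := two_bump_01 b1 bM (h^-1 *: \row_i V i z).
    have [ex|nex] := boolP [exists i, M * h < `|V i z|].
      by apply: (le_trans p1); rewrite (le_trans (exists_le_sum ex))// lerDr ler0n.
    have s0 : 0 <= \sum_i (M * h < `|V i z|)%R%:R :> R by exact: sumr_ge0.
    case: (boolP (two_exceed _ _)) => [two|two] /=; first by rewrite (le_trans p1)// lerDl.
    rewrite two_bump_low ?add0r// ?two_exceed_scale ?mul1r//.
    exact: (scaled_le_high h0 nex).
  move=> /(ler_wpM2l (powR_ge0 h alpha)) /le_trans; apply.
  rewrite Rint_add// mulrDr lerD2l Rint_sum// mulr_sumr.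
  by apply: sum_le_natl => i; exact: radial_tail_le.
have : \forall h \near +oo, (b * h) `^ alpha *
    \int[P]_w (two_exceed (b * h) (fun i => X i w))%:R <= 2 * J * c + e.
  near=> h; have h0 : 0 < h by near: h; exact: nbhs_pinfty_gt.
  have r1 : h `^ alpha * \int[(L \x P)%E]_z (two_exceed h (V ^~ z))%:R <= (c + e1) * (2 * J).
    by near: h; exact: radial_two_exceed_upper.
  have r2 : `|scaled alpha P (fun i => X i : T -> R) (two_bump M b) h -
      scaled alpha (L \x P)%E V (two_bump M b) h| <= e / 8.
    by near: h; exact: scaled_diff_small.
  have r3 := stepX h h0; have r4 := stepV h h0.
  have : h `^ alpha * \int[P]_w (two_exceed (b * h) (fun i => X i w))%:R <= 2 * J * c + e / 2.
    have MC' : n%:R * (M^-1 `^ alpha * C) + n%:R * (mass * (M^-1 `^ alpha * C)) <= e / 8.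
      by apply: le_trans MC; rewrite le_eqVlt; apply/orP; left; apply/eqP; ring.
    by move: r2; rewrite ler_norml => /andP[_ r2]; lra.
  move=> r5; rewrite (powRM _ (ltW b0) (ltW h0)) ba -mulrA.
  have dl1 : 0 <= 1 + dl by rewrite addr_ge0// ltW.
  apply: le_trans (ler_wpM2l dl1 r5) _.
  have -> : (1 + dl) * (2 * J * c + e / 2) = 2 * J * c + e / 2 + dl * (2 * J * c + e / 2).
    by ring.
  by rewrite /dl divfK ?gt_eqF// -addrA -splitr.
have binv : 0 < b^-1 by rewrite invr_gt0.
move=> /(near_pinfty_scale binv); apply: filterS => h.
by rewrite mulrA (divff (lt0r_neq0 b0)) mul1r.
Unshelve. all: by end_near.
Qed.

End Asymptotics.

(** * Spectral mass in the interior of an orthant *)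

Section SupportInOrthant.
Variables (R : realType) (n : nat).
Variable L : {finite_measure set (borel_rV R n) -> \bar R}.

(** If a coordinate vanished, a small move against its sign would leave the orthant while staying in
    the ball. *)
Lemma interior_orthant_gt0 (s : {ffun 'I_n -> bool}) (x : 'rV[R]_n) :
  (orthant s)° x -> forall i, 0 < (-1) ^+ s i * x ord0 i.
Proof.
move=> sx i; rewrite lt_neqAle; apply/andP; split; last exact: (interior_subset sx).
apply/negP => /eqP xi0.
have /nbhs_ballP [e /= e0 xe] := sx.
pose y : 'rV[R]_n := x - (e / 2 * (-1) ^+ s i) *: delta_mx ord0 i.
have /xe/(_ i) : ball x e y.
  split=> // a j; rewrite /y /ball /= !mxE (ord1 a).
  have e2 : `|e / 2 * (-1) ^+ s i| < e.
    by rewrite normrM normrX normrN1 expr1n mulr1 gtr0_norm ?divr_gt0//; lra.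
  by rewrite opprB addrCA subrr addr0; case: (_ && _); rewrite ?mulr1// mulr0 normr0.
rewrite /y !mxE !eqxx mulr1 mulrBr -xi0 sub0r mulrCA -expr2 sqrr_sign mulr1.
by rewrite oppr_ge0 leNgt divr_gt0.
Qed.

Definition in_cone (eta : R) (s : 'I_n -> bool) (x : 'rV[R]_n) : bool :=
  [forall i, eta < (-1) ^+ s i * x ord0 i].

Lemma measurable_in_cone eta s :
  measurable_fun setT ((fun x => in_cone eta s (sphv x)) : borel_rV R n -> bool).
Proof.
apply: measurable_forall => i; apply: measurable_fun_ltr; first exact: measurable_cst.
apply: measurable_funM; first exact: measurable_cst.
exact: measurable_sphv.
Qed.

(** A support point strictly inside the orthant has all signed coordinates above some [eta]. This
    condition is open, so it has positive mass, and the mass lies on the sphere, where [sphv] is the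
    identity. *)
Lemma support_orthant_mass (s : {ffun 'I_n -> bool}) : (0 < n)%N -> spectral_measure L ->
    msupport L `&` (orthant s)° !=set0 ->
  exists2 eta : R, 0 < eta & 0 < \int[L]_x (in_cone eta s (sphv x))%:R.
Proof.
move=> n0 [Lsph _] [x0 [supp /interior_orthant_gt0 x0s]].
have [eta eta0 etax] : exists2 eta : R, 0 < eta & in_cone eta s x0.
  pose m := \big[Num.min/1]_i ((-1) ^+ s i * x0 ord0 i).
  have m0 : 0 < m.
    by apply: lt_bigmin => // i _; exact: x0s.
  (* Half of the minimum makes the margin strict. *)
  exists (m / 2); first by rewrite divr_gt0.
  apply/forallP => i; apply: (@lt_le_trans _ _ m); first by lra.
  exact: bigmin_le.
exists eta => //; pose U := [set x : 'rV[R]_n | in_cone eta s x].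
have mU : measurable (U : set (borel_rV R n)).
  have mb : measurable_fun setT (in_cone eta s : borel_rV R n -> bool).
    apply: measurable_forall => i; apply: measurable_fun_ltr; first exact: measurable_cst.
    by apply: measurable_funM; [exact: measurable_cst|exact: measurable_coord].
  by have := mb measurableT [set true] I; rewrite setTI.
have oU : open U.
  rewrite openE => x /= /forallP xU.
  have cf i : (-1) ^+ s i * (y : 'rV[R]_n) ord0 i @[y --> x] --> (-1) ^+ s i * x ord0 i.
    apply: (@cvgM R _ (nbhs x) _ (fun=> (-1) ^+ s i) (fun y => y ord0 i)).
      exact: cvg_cst.
    exact: coord_continuous.
  have near_i i : \forall y \near x, eta < (-1) ^+ s i * (y : 'rV[R]_n) ord0 i.
    exact: (cvgr_gt _ (cf i) _ (xU i)).
  by apply: filterS (filter_forall _ near_i) => y yU; exact/forallP.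
have LU := supp U oU etax.
have Lfin := finite_measure_lty L.
have mcone := measurable_in_cone eta s.
rewrite -lte_fin -(Rint_bool Lfin mcone).
apply: (lt_le_trans LU).
have LUS : L (U `\` usphere) = 0%E.
  apply/eqP; rewrite eq_le measure_ge0 andbT -Lsph.
  apply: le_measure; rewrite ?inE; last by move=> x [].
    by apply: measurableD => //; exact: measurable_usphere.
  by apply: measurableC; exact: measurable_usphere.
have UE : U = (U `\` usphere) `|` (U `&` usphere) :> set (borel_rV R n).
  by rewrite setUC setUIDK.
rewrite UE measureU//; last 3 first.
- by apply: measurableD => //; exact: measurable_usphere.
- by apply: measurableI => //; exact: measurable_usphere.
- by apply/seteqP; split => // x [[]] _ nS [_ /nS].
rewrite [X in (X + _)%E]LUS add0e; apply: le_measure; rewrite ?inE.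
- by apply: measurableI => //; exact: measurable_usphere.
- by have := mcone measurableT [set true] I; rewrite setTI.
- by move=> x [xU xS] /=; rewrite /sphv mem_set.
Qed.

End SupportInOrthant.

(** * Lower bound for orthant probabilities *)

Section OrthantLower.
Context (R : realType) d (T : measurableType d) (P : probability T R) (alpha : R).
Variables (n : nat) (X : 'I_n -> {RV P >-> R}).
Variable (L : {finite_measure set (borel_rV R n) -> \bar R}).
Hypothesis halpha : 0 < alpha < 2.
Hypothesis n1 : (1 < n)%N.
Hypotheses (hX : sym_stable P alpha X L) (hmarg : forall i, std_sym_stable P alpha (X i)).
Variables (i0 : 'I_n) (c : R).
Hypothesis cc : stail P alpha (X i0 : T -> R) h @[h --> +oo] --> c.

Let alpha0 : 0 < alpha. Proof. by case/andP: halpha. Qed.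
Let Z : T -> R := X i0.
Let mZ : measurable_fun setT Z. Proof. by []. Qed.
Let hZ : std_sym_stable P alpha Z := hmarg i0.
Let V := @radial R d T n Z.

Section Product.
Variables (M : R) (s : 'I_n -> bool).
Hypothesis M2 : 2 <= M.

(** The levels 1 and 2 may be far apart here, unlike in [two_bump]: some positive lower bound is the
    aim, so constants can be lost. *)
Definition orthant_bump (y : 'rV[R]_n) : R := \prod_i bump M 1 2 ((-1) ^+ s i * y ord0 i).

Let sgn1 i : `|(-1) ^+ s i : R| = 1. Proof. by rewrite normrX normrN1 expr1n. Qed.
Let lt12 : 1 < 2 :> R. Proof. by rewrite ltr1n. Qed.

Lemma vapprox_orthant_bump : vapprox orthant_bump.
Proof.
apply: (trig_approx_prod (@dotDl R n) (@vtrunc_sqr_ge0 R n) (@vtrunc_sqr_le R n)) => i.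
apply: vapprox_bump => //; last by rewrite sgn1.
by rewrite (le_trans _ M2)// ler1n.
Qed.

Lemma orthant_bump_01 y : 0 <= orthant_bump y <= 1.
Proof.
by rewrite prodr_ge0 ?prodr_ile1//= => i _; have /andP[? ?] := bump_01 ((-1) ^+ s i * y ord0 i) ltr01 lt12 M2;
  rewrite ?lexx//; apply/andP.
Qed.

Lemma orthant_bump_low (y : 'rV[R]_n) : ~~ in_cone 1 s y -> (forall i, `|y ord0 i| <= M) ->
  orthant_bump y = 0.
Proof.
rewrite negb_forall; case/existsP => i; rewrite -leNgt => yi yM.
by rewrite /orthant_bump (bigD1 i)//= bump_low ?mul0r// normrM sgn1 mul1r.
Qed.

Lemma orthant_bump_high (y : 'rV[R]_n) :
    (forall i, 2 <= (-1) ^+ s i * y ord0 i) -> (forall i, `|y ord0 i| <= M) ->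
  orthant_bump y = 1.
Proof.
by move=> yi yM; apply: big1 => i _; rewrite bump_high// normrM sgn1 mul1r.
Qed.

Lemma orthant_bump0 : orthant_bump 0 = 0.
Proof.
apply: orthant_bump_low => [|i]; last by rewrite mxE normr0 (le_trans _ M2).
by apply/forallP => /(_ i0); rewrite mxE mulr0 ltNge ler01.
Qed.

End Product.

Lemma in_cone_scale (h : R) (s : 'I_n -> bool) (v : 'I_n -> R) : 0 < h ->
  in_cone 1 s (h^-1 *: \row_i v i) = [forall i, h < (-1) ^+ s i * v i].
Proof.
move=> h0; apply: eq_forallb => i.
by rewrite !mxE mulrCA ltr_pdivlMl// mulr1.
Qed.

Lemma measurable_orthant (s : 'I_n -> bool) (h : R) :
  measurable_fun setT (fun w => [forall i, h < (-1) ^+ s i * X i w]).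
Proof.
apply: measurable_forall => i; apply: measurable_fun_ltr; first exact: measurable_cst.
exact: measurable_scalel.
Qed.

(** A direction with margin [eta] and a value [Z > 2 h / eta] put every signed coordinate of
    [Z x / h] above 2. The subtracted indicator removes the region beyond [M * h], where the bump is
    unreliable. *)
Lemma orthant_bump_radial (M eta h : R) (s : 'I_n -> bool) x w : 2 <= M -> 0 < eta -> 0 < h ->
  (in_cone eta s (sphv x))%:R *
    ((2 / eta * h < Z w)%R%:R - (M * h < `|Z w|)%R%:R) <=
  orthant_bump M s (h^-1 *: \row_i V i (x, w)).
Proof.
move=> M2 eta0 h0; have /andP[b0 b1] := orthant_bump_01 s M2 (h^-1 *: \row_i V i (x, w)).
case: (boolP (in_cone _ _ _)) => [/forallP xs|_]; last by rewrite mul0r.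
rewrite mul1r; have [zh|zh] := ltP (2 / eta * h) (Z w); last first.
  by rewrite sub0r (le_trans _ b0)// oppr_le0.
have [ZM|ZM] := ltP (M * h) `|Z w|; first by rewrite subrr.
have zpos : 0 <= Z w by rewrite (le_trans _ (ltW zh))// mulr_ge0 ?divr_ge0 ?ltW.
rewrite subr0 orthant_bump_high// => i; rewrite !mxE /V /radial/=.
  have -> : (-1) ^+ s i * (h^-1 * (Z w * sphv x ord0 i)) =
      Z w * ((-1) ^+ s i * sphv x ord0 i) / h by ring.
  rewrite ler_pdivlMr//; apply: (@le_trans _ _ (Z w * eta)).
    have -> : 2 * h = 2 / eta * h * eta by field; rewrite gt_eqF.
    by rewrite ler_wpM2r ?ltW.
  by rewrite ler_wpM2l// ltW.
rewrite mulrC normrM normfV (gtr0_norm h0) ler_pdivrMr// normrM.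
by apply: le_trans ZM; rewrite ler_piMr// sphv_coord.
Qed.

Lemma orthant_lower (s : {ffun 'I_n -> bool}) :
    msupport L `&` (orthant s)° !=set0 ->
  exists2 delta : R, 0 < delta & \forall h \near +oo,
    delta <= h `^ alpha * \int[P]_w [forall i, h < (-1) ^+ s i * X i w]%:R.
Proof.
move=> hs; have n0 : (0 < n)%N by exact: ltn_trans n1.
have [eta eta0 lam0] := support_orthant_mass n0 hX.1 hs.
set lam := \int[L]_x _ in lam0.
have c0 : 0 < c by exact: (stail_limit_gt0 halpha hmarg cc).
pose C := stable_const alpha; have C0 : 0 < C by exact: stable_const_gt0.
pose a := 2 / eta; have a0 : 0 < a by rewrite divr_gt0.
pose K := lam * (a^-1 `^ alpha * c).
have K0 : 0 < K by rewrite !mulr_gt0// powR_gt0// invr_gt0.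
have K8 : 0 < K / 8 by rewrite divr_gt0.
have nK0 : 0 <= (n%:R + lam) * C by apply: mulr_ge0 (ltW C0); rewrite addr_ge0// ltW.
have [M M2 MC] := small_inv_power halpha 2 nK0 K8.
have M0 : 0 < M by lra.
have sysX := vector_system alpha0 hX hmarg.
have sysV := radial_system L alpha0 mZ hZ.
have fin := prob_fin P; have Lfin := finite_measure_lty L.
have finV := product_fin L P.
pose f := orthant_bump M s.
have af : vapprox f := vapprox_orthant_bump s M2.
have f0 : f 0 = 0 := orthant_bump0 s M2.
have scX h : scaled alpha P (fun i => X i : T -> R) f h =
    h `^ alpha * \int[P]_w f (h^-1 *: \row_i X i w).
  by rewrite /scaled; under eq_Rintegral do rewrite f0 subr0.
have scV h : scaled alpha (L \x P)%E V f h =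
    h `^ alpha * \int[(L \x P)%E]_z f (h^-1 *: \row_i V i z).
  by rewrite /scaled; under eq_Rintegral do rewrite f0 subr0.
have mX i : measurable_fun setT (X i : T -> R) by [].
have bfX h : bmeas (fun w => f (h^-1 *: \row_i X i w)) by exact: (bmeas_vapprox mX).
have bfV h : bmeas (fun z => f (h^-1 *: \row_i V i z)).
  exact: (bmeas_vapprox (system_meas sysV)).
have bX h i : bmeas (fun w => (M * h < `|X i w|)%R%:R : R).
  by apply: bmeas_ltr; [exact: measurable_cst|exact: measurable_norm_comp].
have bO h := bmeas_bool R (measurable_orthant s h).
have stepX h : 0 < h -> scaled alpha P (fun i => X i : T -> R) f h <=
    h `^ alpha * \int[P]_w [forall i, h < (-1) ^+ s i * X i w]%:R +
    n%:R * (M^-1 `^ alpha * C).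
  move=> h0; rewrite scX.
  have bsum : bmeas (fun w => \sum_i (M * h < `|X i w|)%R%:R : R) by exact: bmeas_sum.
  have : \int[P]_w f (h^-1 *: \row_i X i w) <=
      \int[P]_w ([forall i, h < (-1) ^+ s i * X i w]%:R + \sum_i (M * h < `|X i w|)%R%:R).
    apply: (le_Rint fin (bfX h) (bmeas_add (bO h) bsum)) => w.
    have /andP[p0 p1] := orthant_bump_01 s M2 (h^-1 *: \row_i X i w).
    have [ex|nex] := boolP [exists i, M * h < `|X i w|].
      by apply: (le_trans p1); rewrite (le_trans (exists_le_sum R ex))// lerDr.
    have s0 : 0 <= \sum_i (M * h < `|X i w|)%R%:R :> R by exact: sumr_ge0.
    case: (boolP [forall _, _]) => [two|two].
      by apply: (le_trans p1); rewrite lerDl.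
    rewrite /f orthant_bump_low ?in_cone_scale//; first by rewrite add0r.
    exact: (scaled_le_high h0 nex).
  move=> /(ler_wpM2l (powR_ge0 h alpha)) /le_trans; apply.
  rewrite (Rint_add fin (bO h) bsum) mulrDr lerD2l (Rint_sum fin _ _ (bX h)) mulr_sumr.
  by apply: sum_le_natl => i; exact: (marginal_tail_le halpha hmarg).
have stepV h : 0 < h -> lam * (a^-1 `^ alpha * stail P alpha Z (a * h)) -
    lam * (M^-1 `^ alpha * C) <= scaled alpha (L \x P)%E V f h.
  move=> h0; rewrite scV.
  have f_ge0 z : 0 <= f (h^-1 *: \row_i V i z) by case/andP: (orthant_bump_01 s M2 (h^-1 *: \row_i V i z)).
  have [bF ->] := Rint_product L P (bfV h) f_ge0.
  have bc := bmeas_bool R (measurable_in_cone eta s).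
  pose D := utail P Z (a * h) - utail P (fun w => `|Z w|) (M * h).
  have : \int[L]_x (D * (in_cone eta s (sphv x))%:R) <=
      \int[L]_x \int[P]_w f (h^-1 *: \row_i V i (x, w)).
    apply: (le_Rint Lfin (bmeas_scale _ bc) bF) => x.
    have bu := bmeas_utail (a * h) mZ.
    have bn := bmeas_utail (M * h) (measurable_norm_comp mZ).
    rewrite /D /utail -(Rint_sub fin bu bn) mulrC -(Rint_scale fin _ (bmeas_sub bu bn)).
    apply: (le_Rint fin (bmeas_scale _ (bmeas_sub bu bn))).
      apply: (bmeas_vapprox (Y := fun i w => V i (x, w)) _ _ af) => i.
      by rewrite /V /radial/=; under eq_fun do rewrite mulrC; exact: measurable_scalel.
    by move=> w; exact: orthant_bump_radial.
  rewrite (Rint_scale Lfin _ bc) -/lam => /(ler_wpM2l (powR_ge0 h alpha)); apply: le_trans.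
  have -> : h `^ alpha * (D * lam) = lam * (h `^ alpha * utail P Z (a * h)) -
      lam * (h `^ alpha * utail P (fun w => `|Z w|) (M * h)) by rewrite /D; ring.
  rewrite (stail_scale _ _ _ a0 h0) lerD2l lerN2 ler_wpM2l ?(ltW lam0)//.
  exact: (scaled_tail_le halpha mZ hZ M0 h0).
(* Errors of [K / 8] each from the limit, the comparison and the tails leave more than [K / 4]. *)
exists (K / 4); first by rewrite divr_gt0.
have lim : lam * (a^-1 `^ alpha * stail P alpha Z (a * h)) @[h --> +oo] --> K.
  apply: cvgM; first exact: cvg_cst.
  by apply: cvgM; [exact: cvg_cst|exact: cvg_pinfty_scale].
have near1 : \forall h \near +oo, K - K / 8 <= lam * (a^-1 `^ alpha * stail P alpha Z (a * h)).
  by apply: (cvgr_ge _ lim); rewrite ltrBlDr ltrDl.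
have near2 := scaled_diff_small halpha hX hmarg i0 af K8.
have near3 : \forall h \near +oo, 0 < (h : R) by exact: nbhs_pinfty_gt.
apply: filterS3 near1 near2 near3 => h r1 r2 h0.
have r3 := stepX h h0; have r4 := stepV h h0.
have MC' : n%:R * (M^-1 `^ alpha * C) + lam * (M^-1 `^ alpha * C) <= K / 8.
  by apply: le_trans MC; rewrite le_eqVlt; apply/orP; left; apply/eqP; ring.
move: r2; rewrite ler_norml => /andP[r2 _].
move: (h `^ alpha * _) r3 => F r3.
move: (scaled _ _ _ _ _) r2 r3 => SX; move: (scaled _ _ _ _ _) r4 => SV.
clear - r1 MC' K0 => r4 r2 r3.
move: (lam * (_ * stail _ _ _ _)) r1 r4 => q r1 r4.
lra.
Qed.

End OrthantLower.

(** * Large thresholds *)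

Section ThresholdLaw.
Context (R : realType) d (T : measurableType d) (P : probability T R).
Variables (n : nat) (X : 'I_n -> {RV P >-> R}) (h : R).

Definition config (w : T) : {ffun 'I_n -> bool} := [ffun i => threshold X h i w].

Definition config_law (eta : {ffun 'I_n -> bool}) : R := \int[P]_w (config w == eta)%:R.

Let fin := prob_fin P.

Lemma measurable_threshold i : measurable_fun setT (fun w => h < X i w).
Proof. by apply: measurable_fun_ltr => //; exact: measurable_cst. Qed.

Lemma measurable_config eta : measurable_fun setT (fun w => config w == eta).
Proof.
have -> : (fun w => config w == eta) = (fun w => [forall i, (h < X i w) == eta i]).
  apply/funext => w; apply/eqP/forallP => [<- i|H]; first by rewrite ffunE.
  by apply/ffunP => i; rewrite ffunE; exact/eqP/H.
apply: measurable_forall => i; have mt := measurable_threshold i.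
case: (eta i).
  by under eq_fun do rewrite eqb_id.
by under eq_fun do rewrite eqbF_neg; exact: measurable_neg.
Qed.

Let bconfig eta : bmeas (fun w => (config w == eta)%:R : R).
Proof. exact/bmeas_bool/measurable_config. Qed.

Lemma config_lawE (eta : {ffun 'I_n -> bool}) :
  P [set w | forall i, threshold X h i w = eta i] = (config_law eta)%:E.
Proof.
rewrite -(Rint_bool fin (measurable_config eta)); congr (P _).
apply/seteqP; split => w /= H; last by move=> i; rewrite -(eqP H) ffunE.
by apply/eqP/ffunP => i; rewrite ffunE H.
Qed.

Lemma config_law_ge0 (eta : {ffun 'I_n -> bool}) : 0 <= config_law eta.
Proof. by apply: Rint_ge0 => w; exact: ler0n. Qed.

Lemma sum_config (Q : pred {ffun 'I_n -> bool}) w :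
  \sum_(eta | Q eta) (config w == eta)%:R = (Q (config w))%:R :> R.
Proof.
case: (boolP (Q (config w))) => Qw.
  rewrite (bigD1 (config w))//= eqxx big1 ?addr0// => eta /andP[_ /negPf ne].
  by rewrite eq_sym ne.
by rewrite big1// => eta Qe; case: eqP Qw => // ->; rewrite Qe.
Qed.

Lemma config_law_tot : \sum_eta config_law eta = 1.
Proof.
rewrite /config_law -(Rint_sum fin _ _ bconfig).
under eq_Rintegral do rewrite sum_config.
exact: Rint_prob_cst.
Qed.

Lemma config_law_marginal i :
  \sum_(eta : {ffun 'I_n -> bool} | eta i) config_law eta = utail P (X i : T -> R) h.
Proof.
rewrite /config_law -(Rint_sum fin _ _ bconfig).
by under eq_Rintegral do rewrite sum_config ffunE.
Qed.

(** The events for different [A] are disjoint, and each has two coordinates above [h]. *)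
Lemma config_law_two :
  \sum_(A : {set 'I_n} | (1 < #|A|)%N) config_law (indic A) <=
  \int[P]_w (two_exceed h (fun i => X i w))%:R.
Proof.
rewrite /config_law -(Rint_sum fin _ _ (fun A => bconfig (indic A))).
apply: (le_Rint fin).
- exact: bmeas_sum.
- by apply: bmeas_two_exceed.
move=> w; pose A0 := [set i | config w i]%SET.
have E A : (config w == indic A) = (A == A0).
  by rewrite -(inj_eq (@indic_inj _)) indicK eq_sym.
under eq_bigr do rewrite E.
have [A02|A02] := boolP (1 < #|A0|)%N; last first.
  rewrite big1 ?ler0n// => A A2; case: eqP => // AE.
  by move: A02; rewrite -AE A2.
rewrite (bigD1 A0)//= eqxx big1 ?addr0; last by move=> A /andP[_ /negPf->].
have [i [j [ti tj ij]]] := card_gt1P A02; move: ti tj; rewrite !inE !ffunE => ti tj.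
rewrite (_ : two_exceed _ _)//; apply/existsP; exists i; apply/existsP; exists j.
by apply/and3P.
Qed.

(** Coordinates outside [A] are asked to lie below [- h], which is stronger than not exceeding [h],
    so that the event is one covered by [orthant_lower]. *)
Lemma config_law_ge (A : {set 'I_n}) : 0 < h ->
  \int[P]_w [forall i, h < (-1) ^+ (i \notin A) * X i w]%:R <= config_law (indic A).
Proof.
move=> h0; apply: (le_Rint fin) => //.
  by apply: bmeas_bool; exact: measurable_orthant.
move=> w; case: (boolP [forall _, _]) => [/forallP H|_]; last exact: ler0n.
rewrite (_ : _ == _)//; apply/eqP/ffunP => i; rewrite !ffunE /threshold.
have := H i; case: (i \in A) => /=; first by rewrite expr0 mul1r => ->.
rewrite expr1 mulN1r => hX; apply/negbTE; rewrite -leNgt.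
by have := lt_trans h0 hX; rewrite oppr_gt0 => /ltW/le_trans; apply; exact: ltW.
Qed.

End ThresholdLaw.

Theorem theorem1p8 (R : realType) (d : measure_display) (T : measurableType d)
    (P : probability T R) (n : nat) (alpha : R)
    (X : 'I_n -> {RV P >-> R})
    (L : {finite_measure set (borel_rV R n) -> \bar R})
    (halpha : 0 < alpha < 2)
    (hn : (2 <= n)%N)
    (hX : sym_stable P alpha X L)
    (hmarg : forall i, std_sym_stable P alpha (X i))
    (hsupp : forall s : {ffun 'I_n -> bool},
      msupport L `&` (orthant s)° !=set0)
    (hint : 2 * \int[L]_(x in usphere)
                  (Num.max (second_largest x) 0 `^ alpha) < 1) :
  \forall h \near +oo, is_color_process P (threshold X h).
Proof.
have alpha0 : 0 < alpha by case/andP: halpha.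
pose i0 : 'I_n := Ordinal (ltn_trans (ltnSn 0) hn).
have [c cc] := stail_cvg halpha hX hmarg i0.
have c0 := stail_limit_gt0 halpha hmarg cc.
pose Z : T -> R := X i0.
pose J := \int[L]_x pos_second (sphv x) `^ alpha.
have JE : \int[L]_(x in usphere) (Num.max (second_largest x) 0 `^ alpha) = J.
  rewrite (@Rintegral_usphere _ _ L (fun x => pos_second x `^ alpha))//.
  by rewrite pos_second0// powR0// gt_eqF.
rewrite {}JE in hint.
have J0 : 0 <= J by apply: Rint_ge0 => x; exact: powR_ge0.
have twoJ e : 0 < e -> \forall h \near +oo,
    h `^ alpha * \int[P]_w (two_exceed h (fun i => X i w))%:R <= 2 * J * c + e.
  exact: (two_exceed_upper halpha hn hX hmarg cc).
clearbody J.
(* A quarter of the slack in the hypothesis: the final estimate rests on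
   [1 - 3 * dB <= (1 - dB) ^+ 2]. That [dB] is at most [4^-1] reflects [J >= 0]. *)
have [dB [dB0 dB1 JdB]] : exists dB : R, [/\ 0 < dB, dB <= 4^-1 & 2 * J = 1 - 4 * dB].
  by exists ((1 - 2 * J) / 4); split; lra.
(* Each [A] uses the orthant whose signs are negative exactly off [A]. *)
have /choice[dA dAP] : forall A : {set 'I_n}, exists delta : R, 0 < delta /\
    \forall h \near +oo,
      delta <= h `^ alpha * \int[P]_w [forall i, h < (-1) ^+ (i \notin A) * X i w]%:R.
  move=> A; have [delta delta0 H] :=
    orthant_lower halpha hn hX hmarg cc (hsupp [ffun i => i \notin A]).
  exists delta; split => //; apply: filterS H => h.
  congr (_ <= _ * _); apply: eq_Rintegral => w _; congr (nat_of_bool _)%:R.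
  by apply: eq_forallb => i; rewrite ffunE.
pose m := \big[Num.min/1]_A dA A.
have m0 : 0 < m by apply: lt_bigmin => // A _; case: (dAP A).
(* The scaled tail is eventually at most [2 * c], so dividing by [2 * c] turns a bound on scaled
   probabilities into one relative to [p]. *)
pose delta := Num.min (m / (2 * c)) dB.
have delta0 : 0 < delta by rewrite lt_min dB0 divr_gt0// mulr_gt0.
have [p0 p00 crit] := @color_law_criterion R 'I_n _ delta0.
have nearA : \forall h \near +oo, forall A : {set 'I_n},
    m <= h `^ alpha * \int[P]_w [forall i, h < (-1) ^+ (i \notin A) * X i w]%:R.
  apply: (filter_forall _) => A; case: (dAP A) => _; apply: filterS => h.
  by apply: le_trans; exact: bigmin_le.
have e0 : 0 < dB * c by rewrite mulr_gt0.
have nearB := twoJ _ e0.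
have nearT1 : \forall h \near +oo, c - dB * c <= stail P alpha Z h.
  by apply: (cvgr_ge _ cc); rewrite ltrBlDr ltrDl.
have nearT2 : \forall h \near +oo, stail P alpha Z h <= 2 * c.
  by apply: (cvgr_le _ cc); rewrite ltr_pMl// ltr1n.
(* With the upper bound on [stail] this forces [p < p0]. *)
have nearp : \forall h \near +oo, h^-1 `^ alpha * (2 * c) < p0.
  have : h^-1 `^ alpha * (2 * c) @[h --> +oo] --> 0 * (2 * c).
    by apply: cvgM; [exact: cvg_powR_inv|exact: cvg_cst].
  by move=> /cvgr_lt; apply; rewrite mul0r.
near=> h.
have h0 : 0 < h by near: h; exact: nbhs_pinfty_gt.
have A_ : forall A : {set 'I_n},
    m <= h `^ alpha * \int[P]_w [forall i, h < (-1) ^+ (i \notin A) * X i w]%:R.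
  by near: h; exact: nearA.
have B_ : h `^ alpha * \int[P]_w (two_exceed h (fun i => X i w))%:R <= 2 * J * c + dB * c.
  by near: h; exact: nearB.
have T1 : c - dB * c <= stail P alpha Z h by near: h; exact: nearT1.
have T2 : stail P alpha Z h <= 2 * c by near: h; exact: nearT2.
have p_ : h^-1 `^ alpha * (2 * c) < p0 by near: h; exact: nearp.
pose p := utail P Z h.
have ha0 : 0 < h `^ alpha by exact: powR_gt0.
have dBc : dB * c <= c / 4 by rewrite mulrC ler_wpM2l ?(ltW c0).
have pE : h `^ alpha * p = stail P alpha Z h by [].
have pgt0 : 0 < p.
  by rewrite -(pmulr_rgt0 _ ha0) pE; apply: lt_le_trans T1; lra.
have pp0 : 0 < p < p0.
  rewrite pgt0; apply: le_lt_trans p_.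
  have -> : p = h^-1 `^ alpha * stail P alpha Z h.
    by rewrite -pE mulrA [h^-1 `^ _ * _]mulrC powR_invM// mul1r.
  by rewrite ler_wpM2l ?powR_ge0.
have marg i : \sum_(eta : {ffun 'I_n -> bool} | eta i) config_law X h eta = p.
  rewrite config_law_marginal; have mX j : measurable_fun setT (X j : T -> R) by [].
  exact: (utail_eq (mX i) (mX i0) (hmarg i) (hmarg i0)).
have lowA (A : {set 'I_n}) : (1 < #|A|)%N -> delta * p <= config_law X h (indic A).
  move=> _; apply: le_trans (config_law_ge X A h0).
  rewrite -(ler_pM2l ha0); apply: le_trans (A_ A).
  rewrite mulrCA pE; apply: (@le_trans _ _ (m / (2 * c) * (2 * c))).
    apply: ler_pM => //; [exact: ltW|by rewrite -pE mulr_ge0 ?ltW|].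
    by rewrite ge_min lexx.
  by rewrite divfK// gt_eqF// mulr_gt0.
have upB : \sum_(A : {set 'I_n} | (1 < #|A|)%N) config_law X h (indic A) <= (1 - delta) * p.
  apply: le_trans (config_law_two X h) _; rewrite -(ler_pM2l ha0).
  apply: (le_trans B_); rewrite mulrCA pE.
  have dd : 1 - dB <= 1 - delta by rewrite lerD2l lerN2 ge_min lexx orbT.
  apply: (@le_trans _ _ ((1 - dB) * (c - dB * c))); last first.
    by apply: ler_pM => //; [clear - dB1; lra|clear - dBc c0; lra].
  have -> : 2 * J * c = (1 - 4 * dB) * c by rewrite JdB.
  by have := mulr_ge0 (sqr_ge0 dB) (ltW c0); have := ltW e0; clear; lra.
have [q rq qP] := crit p _ pp0 (config_law_ge0 X h) (config_law_tot X h) marg lowA upB.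
exists p, q; split => //.
  rewrite ltW//=; have : p <= 1.
    rewrite -(Rint_prob_cst P 1); apply: (le_Rint (prob_fin P)).
    - by apply: bmeas_utail.
    - exact: bmeas_cst.
    - by move=> w; case: (h < Z w).
  by [].
by move=> eta; rewrite config_lawE qP.
Unshelve. all: by end_near.
Qed.
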